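(* Let $X$ be a proper geodesic $\delta$-hyperbolic metric space, let $b \in \hat{\mathcal{B}}(X)$ with basepoint $\omega \in X \cup \partial X$, and suppose that $X$ is $K$-roughly starlike from $\omega$. Let $\varepsilon > 0$ be such that $\rho_{\varepsilon,b}(x) = e^{-\varepsilon b(x)}$ is a GH-density for $X$ with constant $M$. Suppose that the metric measure space $(X,d,\mu)$ is uniformly locally doubling and supports a uniformly local $p$-Poincaré inequality for some $p \geq 1$. Suppose further that for a given $\beta > 0$ the measure $\mu_{\beta,b}$ is doubling on $\bar{X}_{\varepsilon,b}$ with constant $C_{\mu_{\beta}}$. Then the metric measure spaces $(X_{\varepsilon,b},d_{\varepsilon,b},\mu_{\beta,b})$ and $(\bar{X}_{\varepsilon,b},d_{\varepsilon,b},\mu_{\beta,b})$ each support a $p$-Poincaré inequality with constant $C_{\mathrm{PI}}^{*}$ depending only on $\delta$, $K$, $\varepsilon$, $M$, $\beta$, $C_{\mu_\beta}$, $p$, the radius and the constants $C_{\mathrm{PI}}$ and $\lambda$ in the uniformly local $p$-Poincaré inequality for $(X,d,\mu)$, and the local doubling radius and local doubling constant $C_\mu$ of $\mu$.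
   Context: A geodesic in a metric space $(X,d)$ is an isometric map $\gamma : I \to X$ of an interval $I \subset \mathbb{R}$; $X$ is geodesic if any two points are joined by a geodesic, and proper if closed balls are compact. A geodesic metric space is $\delta$-hyperbolic ($\delta \ge 0$) if all geodesic triangles are $\delta$-thin: each point of each edge lies within distance $\delta$ of some point on another edge. The Gromov boundary $\partial X$ is the set of geodesic rays $\gamma:[0,\infty)\to X$ modulo the equivalence of being at bounded distance; the class of $\gamma$ is its endpoint. For a geodesic ray $\gamma$, $b_{\gamma}(x) = \lim_{t\to\infty} (d(\gamma(t),x)-t)$. $\mathcal{B}(X) = \{b_{\gamma}+s : \gamma \text{ a geodesic ray in } X,\ s\in\mathbb{R}\}$; the basepoint of $b_\gamma+s$ is the endpoint $\omega\in\partial X$ of $\gamma$. For $z \in X$, $b_{z}(x) = d(x,z)$, and $\mathcal{D}(X) = \{b_{z}+s: z\in X, s\in\mathbb{R}\}$; the basepoint of $b_z+s$ is $z$. $\hat{\mathcal{B}}(X) = \mathcal{D}(X)\cup\mathcal{B}(X)$. $X$ is $K$-roughly starlike ($K\ge 0$) from $z\in X$ if for each $x \in X$ there is a geodesic ray $\gamma:[0,\infty)\to X$ with $\gamma(0)=z$ and $\mathrm{dist}(x,\gamma)\le K$. $X$ is $K$-roughly starlike from $\omega\in\partial X$ if for each $x\in X$ there is a geodesic line $\gamma:\mathbb{R}\to X$ such that the ray $t\mapsto\gamma(-t)$, $t \ge 0$, belongs to the class $\omega$ and $\mathrm{dist}(x,\gamma)\le K$. For $b\in\hat{\mathcal{B}}(X)$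 and $\varepsilon>0$, $\rho_{\varepsilon,b}(x)=e^{-\varepsilon b(x)}$, $\ell_{\varepsilon,b}(\gamma)=\int_\gamma\rho_{\varepsilon,b}\,ds$ for a curve $\gamma$, and $X_{\varepsilon,b}$ is the set $X$ with the metric $d_{\varepsilon,b}(x,y)=\inf\ell_{\varepsilon,b}(\gamma)$, the infimum over all curves $\gamma$ joining $x$ to $y$. $\bar X_{\varepsilon,b}$ is its completion and $\partial X_{\varepsilon,b}=\bar X_{\varepsilon,b}\setminus X_{\varepsilon,b}$. $\rho_{\varepsilon,b}$ is a GH-density with constant $M\ge1$ if for all $x,y\in X$ and each geodesic $\gamma$ of $(X,d)$ joining $x$ to $y$, $\ell_{\varepsilon,b}(\gamma)\le M\, d_{\varepsilon,b}(x,y)$. A metric measure space is a metric space with a Borel measure. A Borel measure $\mu$ is doubling with constant $C_\mu\geq 1$ if $\mu(B(x,2r))\le C_\mu\,\mu(B(x,r))$ for all points $x$ and all $r>0$ (open balls); it is uniformly locally doubling if there is $R_0>0$ (the local doubling radius) such that this holds for all $x$ and all $0<r\le R_0$. For $\beta>0$, $\mu_{\beta,b}$ is defined by $d\mu_{\beta,b}(x)=e^{-\beta b(x)}d\mu(x)$ on $X$, extended to $\bar X_{\varepsilon,b}$ by $\mu_{\beta,b}(\partial X_{\varepsilon,b})=0$. Poincaré inequalities are considered for metric measure spaces $(Z,d,\nu)$ with $0<\nu(B)<\infty$ for all balls $B$; in particular $0<\mu(B)<\infty$ for all balls $B\subset X$. A Borel function $g: Z \to [0,\infty]$ is an upper gradient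 of $u:Z\to\mathbb{R}$ if $|u(x)-u(y)|\le\int_\gamma g\,ds$ for each rectifiable curve $\gamma$ joining two points $x,y\in Z$. $u$ is integrable on balls if it is measurable and integrable over each ball. With $u_B=\frac{1}{\nu(B)}\int_B u\,d\nu$, $Z$ supports a $p$-Poincaré inequality if there are constants $\lambda\ge1$ (dilation constant) and $C_{\mathrm{PI}}>0$ such that for each $u$ integrable on balls, each ball $B$, and each upper gradient $g$ of $u$, $$\frac{1}{\nu(B)}\int_B|u-u_B|\,d\nu\le C_{\mathrm{PI}}\,\mathrm{diam}(B)\left(\frac{1}{\nu(\lambda B)}\int_{\lambda B}g^p\,d\nu\right)^{1/p},$$ where $\lambda B$ is the ball with the same center and radius multiplied by $\lambda$. $Z$ supports a uniformly local $p$-Poincaré inequality if there is a radius $R_0>0$ such that this holds for all balls $B$ of radius at most $R_0$. *)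

(* Defs.v *)
From HB Require Import structures.
From mathcomp Require Import all_boot all_order all_algebra.
From mathcomp Require Import all_classical all_reals all_analysis.
From mathcomp Require Import measurable_realfun.

Set Implicit Arguments.
Unset Strict Implicit.
Unset Printing Implicit Defensive.
Import Order.TTheory GRing.Theory Num.Theory.
Import numFieldNormedType.Exports.
Local Open Scope classical_set_scope.
Local Open Scope ring_scope.

(* Measurable types are pointed in MathComp-Analysis, so the metric spaces
   below carry an (irrelevant) distinguished point. *)
#[short(type="pmetricType")]
HB.structure Definition PMetric (R : numDomainType) :=
  { Z of Metric R Z & Pointed Z }.

#[short(type="completePMetricType")]
HB.structure Definition CompletePMetric (R : numDomainType) :=
  { Z of PMetric R Z & Complete Z }.

Definition borel {R : realType} (Z : pmetricType R) :=
  g_sigma_algebraType (@open Z).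

Section Metrized.
Context {R : realType} {T : pointedType}.

Definition is_metric (d : T -> T -> R) : Prop :=
  [/\ forall x, d x x = 0,
      forall x y, d x y = 0 -> x = y,
      forall x y, d x y = d y x &
      forall y x z, d x z <= d x y + d y z].

(* [metrized d] is the set T with the metric d. So that it is a metric space
   for every function d, the discrete metric replaces d when d is not a
   metric (cf. [mdist_metrized]). *)
Definition metrized (d : T -> T -> R) : Type := T.

Definition metrized_dist (d : T -> T -> R) (x y : T) : R :=
  if `[< is_metric d >] then d x y else (x != y)%:R.

Lemma metrized_distP (d : T -> T -> R) : is_metric (metrized_dist d).
Proof.
rewrite /metrized_dist; case: asboolP => [//|_]; split.
- by move=> x; rewrite eqxx.
- by move=> x y; case: eqVneq => //= _ /eqP; rewrite oner_eq0.
- by move=> x y; rewrite eq_sym.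
- move=> y x z; rewrite -natrD ler_nat.
  case: (eqVneq x z) => //= xz; case: (eqVneq x y) => // <-.
  by rewrite xz.
Qed.

HB.instance Definition _ (d : T -> T -> R) := Pointed.on (metrized d).
HB.instance Definition _ (d : T -> T -> R) := isMetric.Build R (metrized d)
  (let: And4 h _ _ _ := metrized_distP d in h)
  (let: And4 _ h _ _ := metrized_distP d in h)
  (let: And4 _ _ h _ := metrized_distP d in h)
  (let: And4 _ _ _ h := metrized_distP d in h).

Lemma mdist_metrized (d : T -> T -> R) (x y : metrized d) :
  is_metric d -> mdist x y = d x y.
Proof.
move=> dP; have -> : mdist x y = metrized_dist d x y by [].
by rewrite /metrized_dist asboolT.
Qed.

End Metrized.

Section Curves.
Context {R : realType} {Z : pmetricType R}.
Implicit Types (c : R -> Z) (a b : R).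

(* A curve is a continuous map of a compact interval [a, b]; values of
   c : R -> Z outside of [a, b] are irrelevant. *)
Definition is_curve a b c : Prop :=
  a <= b /\ {within `[a, b], continuous c}.

Definition curve_length a b c : \bar R :=
  ereal_sup [set (let F := c \o nth b (a :: s) in
                  \sum_(0 <= n < size s) mdist (F n) (F n.+1))%:E
            | s in itv_partition a b].

Definition rectifiable a b c : Prop :=
  is_curve a b c /\ (curve_length a b c < +oo)%E.

(* Parametrization by arc length. The value at s does not depend on the
   parameter t chosen, since c is constant where its length is. *)
Definition arc_param a b c (s : R) : Z :=
  c (xget a [set t | a <= t <= b /\ curve_length a t c = s%:E]).

(* The integral of g along c with respect to arc length; a curve of infinite
   length is given the integral +oo. *)
Definition curve_integral a b c (g : Z -> \bar R) : \bar R :=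
  if curve_length a b c is L%:E then
    (\int[lebesgue_measure]_(s in `[0%R, L]) g (arc_param a b c s))%E
  else +oo%E.

End Curves.

Section HyperbolicGeometry.
Context {R : realType} {X : pmetricType R}.
Implicit Types (c : R -> X) (I : set R).

Definition geodesic I c : Prop :=
  forall s t, I s -> I t -> mdist (c s) (c t) = `|s - t|.

Definition geodesic_joins (a b : R) c (x y : X) : Prop :=
  [/\ a <= b, geodesic `[a, b] c, c a = x & c b = y].

Definition geodesic_space : Prop :=
  forall x y : X, exists a b c, geodesic_joins a b c x y.

Definition proper_space : Prop :=
  forall (x : X) (r : R), compact [set y | mdist x y <= r].

Definition geodesic_edge (x y : X) (E : set X) : Prop :=
  exists a b c, geodesic_joins a b c x y /\ E = c @` `[a, b].

(* Thinness is only required of the first edge: the other two cases follow by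
   cyclically relabelling the triangle. *)
Definition hyperbolic (delta : R) : Prop :=
  [/\ 0 <= delta, geodesic_space &
      forall (x y z : X) (E1 E2 E3 : set X),
        geodesic_edge x y E1 -> geodesic_edge y z E2 -> geodesic_edge z x E3 ->
        forall q, E1 q -> exists2 q', (E2 `|` E3) q' & mdist q q' <= delta].

Definition geodesic_ray c : Prop := geodesic `[0, +oo[ c.

Definition geodesic_line c : Prop := geodesic setT c.

Definition ray_class c : set (R -> X) :=
  [set c' | geodesic_ray c' /\
            exists C : R, forall t, 0 <= t -> mdist (c t) (c' t) <= C].

Definition gromov_boundary : set (set (R -> X)) :=
  [set ray_class c | c in geodesic_ray].

Definition busemann c (x : X) : R := lim (mdist (c t) x - t @[t --> +oo]).

(* [is_Bhat b w]: b belongs to \hat{B}(X) and has basepoint w, a point of X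
   (inl) or of the Gromov boundary (inr). *)
Definition is_Bhat (b : X -> R) (w : X + set (R -> X)) : Prop :=
  match w with
  | inl z => exists s : R, b = (fun x => mdist x z + s)
  | inr xi => exists c (s : R),
      [/\ geodesic_ray c, ray_class c = xi & b = (fun x => busemann c x + s)]
  end.

Definition dist_to (x : X) (A : set X) : R := inf [set mdist x y | y in A].

Definition roughly_starlike (K : R) (w : X + set (R -> X)) : Prop :=
  0 <= K /\
  match w with
  | inl z => forall x, exists c,
      [/\ geodesic_ray c, c 0 = z & dist_to x (c @` `[0, +oo[) <= K]
  | inr xi => gromov_boundary xi /\
      forall x, exists c,
      [/\ geodesic_line c, xi (fun t => c (- t)) & dist_to x (range c) <= K]
  end.

Definition density (eps : R) (b : X -> R) (x : X) : R := expR (- eps * b x).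

Definition weighted_length (eps : R) (b : X -> R) (u v : R) c : \bar R :=
  curve_integral u v c (EFin \o density eps b).

Definition unif_dist (eps : R) (b : X -> R) (x y : X) : R :=
  fine (ereal_inf [set l : \bar R | exists u v c,
    [/\ is_curve u v c, c u = x, c v = y & l = weighted_length eps b u v c]]).

Definition GH_density (eps : R) (b : X -> R) (M : R) : Prop :=
  1 <= M /\
  forall (x y : X) u v c, geodesic_joins u v c x y ->
    (weighted_length eps b u v c <= (M * unif_dist eps b x y)%:E)%E.

End HyperbolicGeometry.

Arguments geodesic_space {R} X.
Arguments proper_space {R} X.
Arguments hyperbolic {R} X delta.
Arguments gromov_boundary {R} X.

Definition uniformized {R : realType} (X : pmetricType R) (eps : R)
    (b : X -> R) : pmetricType R :=
  metrized (unif_dist eps b).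

(* Completions are unique up to isometry, so they are described by their
   universal property rather than constructed. *)
Definition is_completion {R : realType} (Z : pmetricType R)
    (Y : completePMetricType R) (i : Z -> Y) : Prop :=
  (forall x y, mdist (i x) (i y) = mdist x y) /\ dense (range i).

(* Measures are handled as set functions on the Borel sets, so that the same
   definitions apply to the weighted measures below. *)
Section MetricMeasureSpaces.
Context {R : realType} {Z : pmetricType R}.
Implicit Types (nu : set (borel Z) -> \bar R) (u : Z -> R) (g : Z -> \bar R).

Definition doubling_upto nu (R0 : \bar R) (C : R) : Prop :=
  1 <= C /\
  forall (x : Z) (r : R), 0 < r -> (r%:E <= R0)%E ->
    (nu (ball x (2 * r)) <= C%:E * nu (ball x r))%E.

Definition doubling nu (C : R) : Prop := doubling_upto nu +oo%E C.

Definition locally_doubling nu (R0 C : R) : Prop :=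
  0 < R0 /\ doubling_upto nu R0%:E C.

Definition upper_gradient u g : Prop :=
  [/\ forall x, (0 <= g x)%E,
      measurable_fun [set: borel Z] (g : borel Z -> \bar R) &
      forall a b (c : R -> Z), rectifiable a b c ->
        (`|u (c a) - u (c b)|%:E <= curve_integral a b c g)%E].

Definition integrable_on_balls nu u : Prop :=
  measurable_fun [set: borel Z] (u : borel Z -> R) /\
  forall (x : Z) (r : R), 0 < r ->
    nu.-integrable (ball x r : set (borel Z)) (EFin \o u).

Definition average nu (A : set Z) (f : Z -> \bar R) : \bar R :=
  ((fine (nu A))^-1%:E * \int[nu]_(x in (A : set (borel Z))) f x)%E.

Definition diam (A : set Z) : R := sup [set mdist x y | x in A & y in A].

Definition poincare_upto nu (p : R) (R0 : \bar R) (lambda C : R) : Prop :=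
  [/\ forall (x : Z) (r : R), 0 < r -> (0 < nu (ball x r) < +oo)%E,
      1 <= lambda, 0 < C &
      forall (x : Z) (r : R) u g, 0 < r -> (r%:E <= R0)%E ->
        integrable_on_balls nu u -> upper_gradient u g ->
        let B := ball x r in
        let uB := fine (average nu B (EFin \o u)) in
        (average nu B (fun y => `|u y - uB|%:E) <=
         C%:E * (diam B)%:E *
           (average nu (ball x (lambda * r)%R) (fun y => g y `^ p)) `^ p^-1)%E].

Definition poincare nu (p lambda C : R) : Prop :=
  poincare_upto nu p +oo%E lambda C.

Definition locally_poincare nu (p R0 lambda C : R) : Prop :=
  0 < R0 /\ poincare_upto nu p R0%:E lambda C.

End MetricMeasureSpaces.

Section WeightedMeasure.
Context {R : realType} {X : pmetricType R}.

Definition weighted_measure (mu : {measure set (borel X) -> \bar R})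
    (beta : R) (b : X -> R) (A : set X) : \bar R :=
  (\int[mu]_(x in (A : set (borel X))) (expR (- beta * b x))%:E)%E.

(* Extension of [weighted_measure] to a completion i : X_(eps,b) -> Y by zero
   on the complement of X. *)
Definition weighted_measure_ext (mu : {measure set (borel X) -> \bar R})
    (beta eps : R) (b : X -> R) (Y : pmetricType R)
    (i : uniformized eps b -> Y) (A : set Y) : \bar R :=
  weighted_measure mu beta b (i @^-1` A).

End WeightedMeasure.

(* Main.v *)
From HB Require Import structures.
Require Import Defs.
From mathcomp Require Import all_boot all_order all_algebra.
From mathcomp Require Import all_classical all_reals all_analysis.
From mathcomp Require Import measurable_realfun.
From mathcomp Require Import ring lra.
Import Order.TTheory GRing.Theory Num.Theory.
Import numFieldNormedType.Exports.
Local Open Scope classical_set_scope.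
Local Open Scope ring_scope.

(** The proof is a chaining argument in (X,d) on the scale of the radius of the
local Poincare inequality; write rho for the density and [de] for the distance
of the uniformization.

Since b is 1-Lipschitz, rho varies by a bounded factor on balls of (X,d) of
bounded radius. Such a ball B(y,s) looks like a [de]-ball of radius comparable
with s rho(y), and on it the weight of the measure is almost constant. Upper
gradients transform well: if g is an upper gradient with respect to [de], then
g rho is one with respect to d ([embed_upper_gradient]). The local Poincare
inequality therefore gives the desired one on all [de]-balls whose radius is at
most a fixed multiple of rho at the center.

On any larger [de]-ball, of radius r about x0, rho is at most a multiple A r of
the radius. The points of the ball are joined to a common point z0 by chains of
bounded step in (X,d) that are discrete John curves: each point q of a chain
starting at x satisfies de(x,q) <= C rho(q) and rho(q) <= C r ([john_chain]).
The chain first descends along b, so that rho grows geometrically, until rho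
reaches the height A r or b cannot decrease any more, which happens only near a
basepoint in X ([horo_descent], [descending_chain]). The ends of two such chains
are at bounded distance in X: by thinness of triangles b is quasiconvex along
geodesics ([horo_quasiconvex]), so a geodesic between the two ends stays at
height at least a multiple of r, and the Gehring-Hayman condition bounds its
length by a multiple of de / r ([GH_separation], [ends_close]). Short geodesics
join the ends to one of them.

The chains are projected to a separated net of X. Telescoping the averages of a
function u over balls about the net points of a chain bounds |u(x) - c| by a sum
of local oscillations ([chain_averages]). A net point q is visited only by
chains that start in the [de]-ball of radius C rho(q) about q, whose measure is
comparable with that of the unit size ball of X about q, by the doubling
property. Hence integrating over x cancels the normalization of the averages,
and the bounded overlap of the balls about the net points sums up the right-hand
sides ([net_poincare]).

All this is linear in the right-hand side, that is, adapted to p = 1. The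
exponent p is handled by the inequality S^(1/p) <= k + k^(1-p) S for all k > 0,
with equality up to a factor 2 for k = S^(1/p): the local inequalities are put
in the linear form with k + k^(1-p) g^p in place of g ([poweR_inv_le]), and k is
optimized once the global linear form is proved ([poweR_optimize]).

The uniformization and its completion are treated together, as spaces Z with a
map h from X onto a dense subset that is isometric for [de], and with the image
of the weighted measure ([global_poincare]). *)

Set Implicit Arguments.
Unset Strict Implicit.
Unset Printing Implicit Defensive.

(** * Length of curves *)

Section CurveLength.
Context {R : realType} {Z : pmetricType R}.
Implicit Types (c : R -> Z) (a b m t : R) (s : seq R).

(** The sums in the definition of [curve_length], by recursion on the partition
instead of indices, for proofs by induction. *)
Fixpoint chord_sum c a s : R :=
  if s is x :: s' then mdist (c a) (c x) + chord_sum c x s' else 0.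

Lemma chord_sumE c a b s :
  (let F := c \o nth b (a :: s) in
   \sum_(0 <= n < size s) mdist (F n) (F n.+1)) = chord_sum c a s.
Proof.
elim: s a => [|x s IH] a /=; first by rewrite big_nil.
by rewrite big_nat_recl//= -IH.
Qed.

Lemma curve_lengthE a b c :
  curve_length a b c = ereal_sup [set (chord_sum c a s)%:E | s in itv_partition a b].
Proof.
by rewrite /curve_length; congr ereal_sup; apply: eq_imagel => s _; rewrite -(chord_sumE c a b).
Qed.

Lemma chord_sum_ge0 c a s : 0 <= chord_sum c a s.
Proof. by elim: s a => //= x s IH a; rewrite addr_ge0// mdist_ge0. Qed.

Lemma chord_sum_cat c a s1 s2 :
  chord_sum c a (s1 ++ s2) = chord_sum c a s1 + chord_sum c (last a s1) s2.
Proof. by elim: s1 a => [|x s IH] a /=; rewrite ?add0r// IH addrA. Qed.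

Lemma chord_sum_le_length a b c s :
  itv_partition a b s -> ((chord_sum c a s)%:E <= curve_length a b c)%E.
Proof. by move=> abs; rewrite curve_lengthE; apply: ereal_sup_ubound; exists s. Qed.

Lemma length_le a b c (l : \bar R) :
  (forall s, itv_partition a b s -> ((chord_sum c a s)%:E <= l)%E) ->
  (curve_length a b c <= l)%E.
Proof. by move=> H; rewrite curve_lengthE; apply: ge_ereal_sup => _ [s /H sl <-]. Qed.

Lemma mdist_le_length a b c : a <= b ->
  ((mdist (c a) (c b))%:E <= curve_length a b c)%E.
Proof.
rewrite le_eqVlt => /predU1P[<-|ab].
  by rewrite mdistxx -[0]/(chord_sum c a [::]) chord_sum_le_length//; split.
have := chord_sum_le_length c (itv_partition1 ab).
by rewrite /= addr0.
Qed.

Lemma length_ge0 a b c : a <= b -> (0 <= curve_length a b c)%E.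
Proof.
move=> /(mdist_le_length c); apply: le_trans; by rewrite lee_fin mdist_ge0.
Qed.

Lemma lengthxx a c : curve_length a a c = 0%E.
Proof.
apply/eqP; rewrite eq_le length_ge0// andbT; apply: length_le => s /itv_partitionxx ->.
by [].
Qed.

(** Inserting the point m into a partition does not decrease the sum, by the
triangle inequality; the refined partition splits at m. *)
Lemma chord_sum_split a m b c s : a < m -> m < b -> itv_partition a b s ->
  exists s1 s2, [/\ itv_partition a m s1, itv_partition m b s2 &
    chord_sum c a s <= chord_sum c a s1 + chord_sum c m s2].
Proof.
elim: s a => [|x s IH] a am mb.
  by move/itv_partition_nil => ab; move: (lt_trans am mb); rewrite ab ltxx.
move=> abs; have xbs := itv_partition_cons abs.
have ax : a < x by case: abs => /= /andP[].
have [xm|mx|xm] := ltgtP x m.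
- have [s1 [s2 [p1 p2 le12]]] := IH x xm mb xbs.
  exists (x :: s1), s2; split => //=; last by lra.
  by case: p1 => p1 l1; split => //=; rewrite ax.
- exists [:: m], (x :: s); split => //=.
  + exact: itv_partition1.
  + by case: xbs => p l; split => //=; rewrite mx.
  + have := metric_triangle (c a) (c m) (c x); lra.
- exists [:: m], s; split => //=.
  + exact: itv_partition1.
  + by rewrite -xm.
  + by rewrite xm; lra.
Qed.

(** One inequality is [chord_sum_split]; for the other, partitions of the two
parts concatenate. *)
Lemma length_add a m b c : a <= m -> m <= b ->
  curve_length a b c = (curve_length a m c + curve_length m b c)%E.
Proof.
rewrite le_eqVlt => /predU1P[<-|am]; first by rewrite lengthxx add0e.
rewrite le_eqVlt => /predU1P[<-|mb]; first by rewrite lengthxx adde0.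
apply/eqP; rewrite eq_le; apply/andP; split.
  apply: length_le => s /(chord_sum_split c am mb)[s1 [s2 [p1 p2 le12]]].
  apply: (@le_trans _ _ ((chord_sum c a s1)%:E + (chord_sum c m s2)%:E)%E); first by rewrite -EFinD lee_fin.
  by rewrite leeD// chord_sum_le_length.
have [->|ny] := eqVneq (curve_length a b c) +oo%E; first by rewrite leey.
have key s1 s2 : itv_partition a m s1 -> itv_partition m b s2 ->
    ((chord_sum c a s1)%:E + (chord_sum c m s2)%:E <= curve_length a b c)%E.
  move=> p1 p2; rewrite -EFinD.
  have -> : chord_sum c a s1 + chord_sum c m s2 = chord_sum c a (s1 ++ s2).
    by rewrite chord_sum_cat; case: p1 => _ /eqP ->.
  by apply: chord_sum_le_length; exact: itv_partition_cat p1 p2.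
have : (curve_length a b c \is a fin_num).
  by rewrite ge0_fin_numE ?length_ge0 ?ltey// ltW// (lt_trans am).
move/fineK => <-.
rewrite -leeBrDr; last first.
  rewrite ge0_fin_numE ?(length_ge0 _ (ltW mb))//.
  apply: (@le_lt_trans _ _ (curve_length a b c)); last by rewrite ltey.
  apply: length_le => s2 p2; have := key [:: m] s2 (itv_partition1 am) p2.
  apply: le_trans; rewrite leeDr// lee_fin chord_sum_ge0//.
apply: length_le => s1 p1.
rewrite leeBrDr; last first.
  rewrite ge0_fin_numE ?(length_ge0 _ (ltW mb))//.
  apply: (@le_lt_trans _ _ (curve_length a b c)); last by rewrite ltey.
  apply: length_le => s2 p2; have := key [:: m] s2 (itv_partition1 am) p2.
  apply: le_trans; rewrite leeDr// lee_fin chord_sum_ge0//.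
rewrite addeC -leeBrDr//; apply: length_le => s2 p2.
rewrite leeBrDr// addeC fineK; first exact: key.
by rewrite ge0_fin_numE ?length_ge0 ?ltey// ltW// (lt_trans am).
Qed.

End CurveLength.

(** * Parametrization by arc length *)

Section ArcLength.
Context {R : realType} {Z : pmetricType R}.
Implicit Types (c : R -> Z) (a b m s t e d : R).

Lemma within_continuousP (A : set R) c : {within A, continuous c} <->
  forall t, A t -> forall e : R, 0 < e -> exists2 d : R, 0 < d &
    forall t', A t' -> `|t - t'| < d -> mdist (c t) (c t') < e.
Proof.
split.
  move=> /subspace_continuousP H t At e e0.
  have /metricType_numDomainType.cvgrPdist_lt/(_ e e0) := H t At.
  rewrite near_withinE => /nbhs_ballP[d /= d0 K].
  by exists d => // t' At' tt'; apply: K.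
move=> H; apply/subspace_continuousP => t At.
apply/metricType_numDomainType.cvgrPdist_lt => e e0.
have [d d0 K] := H t At e e0.
rewrite near_withinE; apply/nbhs_ballP; exists d => //= t' tt' At'.
exact: K.
Qed.

Section fixed_curve.
Variables (a b : R) (c : R -> Z).
Hypothesis rc : rectifiable a b c.
Local Notation len s t := (fine (curve_length s t c)).

Lemma rectifiable_le : a <= b. Proof. by case: rc => -[]. Qed.

Lemma sub_length_fin s t : a <= s -> s <= t -> t <= b ->
  curve_length s t c \is a fin_num.
Proof.
move=> as_ st tb; rewrite ge0_fin_numE ?length_ge0//.
apply: le_lt_trans (rc.2).
rewrite (length_add c as_ (le_trans st tb)) (length_add c st tb).
by rewrite addeCA leeDl// adde_ge0// length_ge0.
Qed.

Lemma lenD s m t : a <= s -> s <= m -> m <= t -> t <= b ->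
  len s t = len s m + len m t.
Proof.
move=> as_ sm mt tb; rewrite (length_add c sm mt) fineD//; apply: sub_length_fin => //.
- exact: le_trans mt tb.
- exact: le_trans as_ sm.
Qed.

Lemma len_ge0 s t : s <= t -> 0 <= len s t.
Proof. by move=> st; rewrite fine_ge0// length_ge0. Qed.

Lemma mdist_le_len s t : a <= s -> s <= t -> t <= b ->
  mdist (c s) (c t) <= len s t.
Proof.
by move=> *; rewrite -lee_fin fineK ?sub_length_fin// mdist_le_length.
Qed.

(** Left continuity of the length. If a partition of [a, t] has a sum within e/2
of the length, moving its last inner point p to a point t1 close to t loses
nothing, so that the length from t1 to t exceeds the last chord by at most e/2;
this chord is short by continuity of c. *)
Lemma len_left t e : a < t -> t <= b -> 0 < e ->
  exists t1, [/\ a <= t1, t1 < t & len t1 t <= e].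
Proof.
move=> a_t tb e0.
have fin := sub_length_fin (lexx a) (ltW a_t) tb.
have e20 : 0 < e / 2 by rewrite divr_gt0.
have : (curve_length a t c - (e/2)%:E < curve_length a t c)%E.
  by rewrite lteBlDr// lteDl ?lte_fin.
rewrite {2}curve_lengthE => /ereal_sup_gt[_ [s ps <-]] H.
have [p [ap pt vs]] : exists p, [/\ a <= p, p < t &
    ((chord_sum c a s)%:E <= curve_length a p c + (mdist (c p) (c t))%:E)%E].
  case/lastP: s ps {H} => [/itv_partition_nil ae|s x [px /eqP lx]].
    by move: a_t; rewrite ae ltxx.
  rewrite last_rcons in lx; rewrite rcons_path in px; case/andP: px => px lsx.
  exists (last a s); split.
  - by apply: (@itv_partition_le _ _ a _ s); split => //.
  - by rewrite -lx.
  - rewrite -cats1 chord_sum_cat EFinD leeD//=; last by rewrite addr0 lx.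
    by apply: chord_sum_le_length; split.
have [d d0 K] := (within_continuousP _ _).1 rc.1.2 t (ltac:(by rewrite /= in_itv/= tb ltW)) _ e20.
pose t1 := Num.max p (t - d/2).
have pt1 : p <= t1 by rewrite le_max lexx.
have t1t : t1 < t by rewrite gt_max pt/= ltrBlDr ltrDl divr_gt0.
have at1 : a <= t1 by exact: le_trans pt1.
have t1b : t1 <= b by rewrite (le_trans (ltW t1t)).
have dt1 : mdist (c t) (c t1) < e/2.
  apply: K; first by rewrite /= in_itv/= at1 t1b.
  have : t - d/2 <= t1 by rewrite le_max lexx orbT.
  by rewrite ger0_norm ?subr_ge0 ?(ltW t1t)//; lra.
exists t1; split => //.
have := lt_le_trans H vs.
have finp : curve_length a p c \is a fin_num.
  by apply: sub_length_fin => //; rewrite (le_trans (ltW pt)).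
rewrite -(fineK fin) -(fineK finp) -EFinN -!EFinD lte_fin.
have -> : fine (curve_length a t c) = len a t by [].
rewrite (lenD (lexx a) at1 (ltW t1t) tb) (lenD (lexx a) ap pt1 t1b).
have := mdist_le_len ap pt1 t1b.
have := metric_triangle (c p) (c t1) (c t).
have := metric_sym (c t1) (c t).
rewrite /=; lra.
Qed.

(** Right continuity of the length, in the same way, with the first inner point
of a partition of [t, b]. *)
Lemma len_right t e : a <= t -> t < b -> 0 < e ->
  exists t1, [/\ t < t1, t1 <= b & len t t1 <= e].
Proof.
move=> a_t tb e0.
have fin := sub_length_fin a_t (ltW tb) (lexx b).
have e20 : 0 < e / 2 by rewrite divr_gt0.
have : (curve_length t b c - (e/2)%:E < curve_length t b c)%E.
  by rewrite lteBlDr// lteDl ?lte_fin.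
rewrite {2}curve_lengthE => /ereal_sup_gt[_ [s ps <-]] H.
have [p [pb pt vs]] : exists p, [/\ p <= b, t < p &
    ((chord_sum c t s)%:E <= curve_length p b c + (mdist (c t) (c p))%:E)%E].
  case: s ps {H} => [/itv_partition_nil ae|x s ps].
    by move: tb; rewrite ae ltxx.
  have xs := itv_partition_cons ps.
  exists x; split.
  - exact: itv_partition_le xs.
  - by case: ps => /= /andP[].
  - by rewrite /= addrC EFinD leeD//; exact: chord_sum_le_length.
have [d d0 K] := (within_continuousP _ _).1 rc.1.2 t (ltac:(by rewrite /= in_itv/= a_t ltW)) _ e20.
pose t1 := Num.min p (t + d/2).
have pt1 : t1 <= p by rewrite ge_min lexx.
have t1t : t < t1 by rewrite lt_min pt/= ltrDl divr_gt0.
have t1b : t1 <= b by exact: le_trans pt1 _.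
have at1 : a <= t1 by rewrite (le_trans a_t)// ltW.
have dt1 : mdist (c t) (c t1) < e/2.
  apply: K; first by rewrite /= in_itv/= at1 t1b.
  have : t1 <= t + d/2 by rewrite ge_min lexx orbT.
  by rewrite ler0_norm ?subr_le0 ?(ltW t1t)//; lra.
exists t1; split => //.
have := lt_le_trans H vs.
have finp : curve_length p b c \is a fin_num.
  by apply: sub_length_fin => //; rewrite (le_trans a_t (ltW pt)).
rewrite -(fineK fin) -(fineK finp) -EFinN -!EFinD lte_fin.
have -> : fine (curve_length t b c) = len t b by [].
rewrite (lenD a_t (ltW t1t) t1b (lexx b)) (lenD at1 pt1 pb (lexx b)).
have := mdist_le_len at1 pt1 pb.
have := metric_triangle (c t) (c t1) (c p).
rewrite /=; lra.
Qed.

(** The length is nondecreasing and continuous in its endpoint; the supremum of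
the parameters with length at most s is one with length s. *)
Lemma len_surj s : 0 <= s <= len a b -> exists2 t, a <= t <= b & len a t = s.
Proof.
move=> /andP[s0 sL]; have ab := rectifiable_le.
pose S := [set t | a <= t <= b /\ len a t <= s].
have Sa : S a by split; rewrite ?lexx//= lengthxx.
have ubS : ubound S b by move=> t [/andP[]].
have supS : has_sup S by split; [exists a|exists b].
pose t := sup S.
have a_t : a <= t by exact: (ub_le_sup supS.2 Sa).
have tb : t <= b by apply: ge_sup => //; exists a.
exists t; first by rewrite a_t tb.
apply/eqP; rewrite eq_le; apply/andP; split.
  have /predU1P[<-|{}a_t] : (a == t) || (a < t) by rewrite -le_eqVlt.
    by rewrite lengthxx.
  apply/ler_addgt0Pr => e e0.
  have [t1 [at1 t1t le1]] := len_left a_t tb e0.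
  have [t2 [/andP[at2 t2b] St2] t12] := sup_gt supS.1 t1t.
  have t2t : t2 <= t by apply: (ub_le_sup supS.2); split; rewrite ?at2.
  rewrite (lenD (lexx a) at2 t2t tb).
  have := lenD at1 (ltW t12) t2t tb.
  have := len_ge0 (ltW t12).
  move: St2 le1 => /=; lra.
have /predU1P[->//|{}tb] : (t == b) || (t < b) by rewrite -le_eqVlt.
apply/ler_addgt0Pr => e e0.
have [t1 [tt1 t1b le1]] := len_right a_t tb e0.
have at1 : a <= t1 by rewrite (le_trans a_t)// ltW.
have : ~ S t1 by move=> /(ub_le_sup supS.2); rewrite leNgt tt1.
move=> nS; have : s < len a t1.
  rewrite ltNge; apply/negP => h; apply: nS; split => //.
  by rewrite at1 t1b.
rewrite (lenD (lexx a) a_t (ltW tt1) t1b).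
move: le1 => /=; lra.
Qed.

Definition arc_time s : R := xget a [set t | a <= t <= b /\ curve_length a t c = s%:E].

Lemma arc_paramE s : arc_param a b c s = c (arc_time s). Proof. by []. Qed.

Lemma arc_timeP s : 0 <= s <= len a b -> a <= arc_time s <= b /\ len a (arc_time s) = s.
Proof.
move=> /len_surj[t tab ts]; rewrite /arc_time; case: xgetP => [t' -> [t'ab H]|].
  by split => //=; rewrite H.
move=> /(_ t) /not_andP[]//; case/andP: tab => a_t tb; rewrite -ts fineK//.
exact: sub_length_fin.
Qed.

Lemma len_mono t t' : a <= t -> t <= t' -> t' <= b -> len a t <= len a t'.
Proof.
by move=> a_t tt' tb; rewrite (lenD (lexx a) a_t tt' tb) lerDl len_ge0.
Qed.

Lemma mdist_lenB t t' : a <= t <= b -> a <= t' <= b ->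
  mdist (c t) (c t') <= `|len a t - len a t'|.
Proof.
wlog tt' : t t' / t <= t'.
  move=> H /[dup] h /andP[a_t tb] /[dup] h' /andP[a_t' tb'].
  by have [tt'|/ltW tt'] := leP t t'; [exact: H|rewrite metric_sym distrC; exact: H].
move=> /andP[a_t tb] /andP[a_t' tb'].
rewrite (lenD (lexx a) a_t tt' tb') opprD addrA subrr sub0r normrN ger0_norm ?len_ge0//.
exact: mdist_le_len.
Qed.

(** Parameters with the same length have the same image, so the choice made in
[arc_param] does not matter. *)
Lemma arc_param_len t : a <= t <= b -> arc_param a b c (len a t) = c t.
Proof.
move=> /[dup] tab /andP[a_t tb].
have [] := @arc_timeP (len a t).
  by rewrite len_ge0//= len_mono.
move=> tt' E; rewrite arc_paramE; apply: mdist_positivity.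
apply/eqP; rewrite eq_le mdist_ge0 andbT.
by apply: le_trans (mdist_lenB tt' tab) _; rewrite E subrr normr0.
Qed.

Lemma arc_param_lip s s' : 0 <= s <= len a b -> 0 <= s' <= len a b ->
  mdist (arc_param a b c s) (arc_param a b c s') <= `|s - s'|.
Proof.
move=> /arc_timeP[h1 E1] /arc_timeP[h2 E2]; rewrite !arc_paramE.
by apply: le_trans (mdist_lenB h1 h2) _; rewrite E1 E2.
Qed.

(** Any path gam that agrees with c in terms of length may replace [arc_param],
for instance one that is defined and Lipschitz on all of R. *)
Lemma curve_integralE (g : Z -> \bar R) (gam : R -> Z) :
  (forall t, a <= t <= b -> gam (len a t) = c t) ->
  curve_integral a b c g =
  (\int[lebesgue_measure]_(s in `[0%R, len a b]) g (gam s))%E.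
Proof.
move=> H; rewrite /curve_integral.
have := sub_length_fin (lexx a) rectifiable_le (lexx b).
case E : (curve_length a b c) => [L| |]//= _.
apply: eq_integral => s; rewrite inE/= in_itv/= => sL; congr g.
have [tab {2}<-] := @arc_timeP s (ltac:(by rewrite E)).
by rewrite H.
Qed.

End fixed_curve.

End ArcLength.

(** * Measures with a density *)

Section MeasureWithDensity.
Local Open Scope ereal_scope.
Context d (T : measurableType d) (R : realType).
Variables (mu : {measure set T -> \bar R}) (w : T -> R).
Hypotheses (w0 : forall x, (0 <= w x)%R) (mw : measurable_fun setT w).

(** The hypotheses on w are arguments so that the structure of a measure can be
inferred from the set function. *)
Definition density_measure of (forall x, (0 <= w x)%R) & measurable_fun setT w :=
  fun A : set T => \int[mu]_(x in A) (w x)%:E.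

Local Notation m := (density_measure w0 mw).

Let density_measure0 : m set0 = 0. Proof. exact: integral_set0. Qed.

Let density_measure_ge0 A : 0 <= m A.
Proof. by apply: integral_ge0 => x _; rewrite lee_fin. Qed.

Let density_measure_additive : semi_sigma_additive m.
Proof.
apply: semi_sigma_additive_nng_induced.
- by apply/measurable_EFinP.
- by move=> x; rewrite lee_fin.
Qed.

HB.instance Definition _ := isMeasure.Build _ _ _ m density_measure0 density_measure_ge0 density_measure_additive.

Import HBNNSimple.

Let integral_nnsfun D (g : {nnsfun T >-> R}) : measurable D ->
  \int[m]_(x in D) (g x)%:E = \int[mu]_(x in D) ((g x)%:E * (w x)%:E).
Proof.
move=> mD; have mg r : measurable (g @^-1` [set r]) by [].
have gE x : (g x)%:E = \sum_(r \in range g) (r * \1_(g @^-1` [set r]) x)%:E.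
  by rewrite fsumEFin//= -fimfunE.
have mind r : measurable_fun D (fun x => (r * \1_(g @^-1` [set r]) x)%:E).
  by apply/measurable_EFinP; apply: measurable_funM.
have mwD : measurable_fun D (fun x => (w x)%:E).
  by apply/measurable_EFinP; exact: measurable_funTS.
rewrite [RHS](eq_integral (fun x => \sum_(r \in range g)
    ((r * \1_(g @^-1` [set r]) x)%:E * (w x)%:E))); last first.
  by move=> x _; rewrite gE ge0_mule_fsuml// => r; exact: nnfun_muleindic_ge0.
rewrite (eq_integral _ _ (fun x _ => gE x)).
rewrite !ge0_integral_fsum//; last 3 first.
- by move=> r; apply: emeasurable_funM.
- by move=> r x _; rewrite mule_ge0 ?lee_fin// -lee_fin nnfun_muleindic_ge0.
- by move=> r x _; exact: nnfun_muleindic_ge0.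
apply: eq_fsbigr => r /[!inE] -[x0 _ gx0].
have r0 : (0 <= r)%R by rewrite -gx0.
under eq_integral do rewrite EFinM.
under [RHS]eq_integral do rewrite EFinM -muleA.
rewrite !ge0_integralZl_EFin//; last 3 first.
- by move=> x _; rewrite mule_ge0 ?lee_fin.
- by apply: emeasurable_funM => //; apply/measurable_EFinP.
- by apply/measurable_EFinP.
congr (_ * _); rewrite integral_indic// setIC.
rewrite -[LHS]/(\int[mu]_(x in D `&` g @^-1` [set r]) (w x)%:E) integral_mkcondr.
by apply: eq_integral => x _; rewrite epatch_indic/= muleC.
Qed.

(** From simple functions by monotone convergence on both sides. *)
Lemma ge0_integral_density f D : measurable D -> measurable_fun D f ->
  (forall x, D x -> 0 <= f x) ->
  \int[m]_(x in D) f x = \int[mu]_(x in D) (f x * (w x)%:E).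
Proof.
move=> mD mf f0; pose h := nnsfun_approx mD mf.
have h_nd x : D x -> {homo (fun n => (h n x)%:E) : i j / (i <= j)%N >-> i <= j}.
  by move=> _ i j ij; rewrite lee_fin; exact/lefP/nd_nnsfun_approx.
have h_cvg x : D x -> (h n x)%:E @[n --> \oo] --> f x by move=> Dx; exact: cvg_nnsfun_approx.
have mh n : measurable_fun D (fun x => (h n x)%:E).
  by apply/measurable_EFinP; exact: measurable_funTS.
have mwD : measurable_fun D (fun x => (w x)%:E).
  by apply/measurable_EFinP; exact: measurable_funTS.
transitivity (lim (\int[m]_(x in D) (h n x)%:E @[n --> \oo])).
  rewrite -monotone_convergence//; last by move=> n x _; rewrite lee_fin.
  by apply: eq_integral => x /[!inE] Dx; apply/esym/cvg_lim => //; exact: h_cvg.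
under eq_fun do rewrite integral_nnsfun//.
rewrite -monotone_convergence//.
- apply: eq_integral => x /[!inE] Dx; apply/cvg_lim => //.
  by apply: cvgeZr => //; exact: h_cvg.
- by move=> n; exact: emeasurable_funM.
- by move=> n x _; rewrite mule_ge0 ?lee_fin.
- by move=> x Dx i j ij; rewrite lee_wpmul2r ?lee_fin//; exact: h_nd.
Qed.

End MeasureWithDensity.

(** * Lebesgue integrals under translation and reflection *)

Section LebesgueShift.
Context {R : realType}.
Local Notation mu := (@lebesgue_measure R).
Local Open Scope ereal_scope.

Lemma lebesgue_measure_shift (k : R) (A : set R) : measurable A ->
  pushforward mu ((fun s => k + s)%R : _ -> measurableTypeR R) A = mu A.
Proof.
move=> mA; apply/esym/lebesgue_measure_unique => //=.
  exact: measurable_funD.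
move=> ? _ [[a b]] _ <-.
rewrite /pushforward (_ : _ @^-1` _ = `](a - k)%R, (b - k)%R]%classic); last first.
  by apply/seteqP; split=> x /=; rewrite !in_itv/= ltrBlDl lerBrDl.
rewrite !lebesgue_measure_itv/= !lte_fin ltrD2r; case: ifP => // _.
by rewrite -!EFinB; congr EFin; ring.
Qed.

Lemma ge0_integral_shift (k a b : R) (f : R -> \bar R) :
  measurable_fun `[a, b] f -> (forall x, (a <= x <= b)%R -> 0 <= f x) ->
  \int[mu]_(s in `[(a - k)%R, (b - k)%R]) f (k + s)%R = \int[mu]_(s in `[a, b]) f s.
Proof.
move=> mf f0.
have mk : measurable_fun setT ((fun s => k + s)%R : measurableTypeR R -> measurableTypeR R).
  exact: measurable_funD.
rewrite (_ : `[_, _]%classic = ((fun s => k + s)%R : _ -> measurableTypeR R) @^-1` `[a, b]).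
  rewrite -(@ge0_integral_pushforward _ _ _ _ _ _ mk mu)//.
    by apply: eq_measure_integral => //= A mA _; exact: lebesgue_measure_shift.
  by move=> x; rewrite inE/= in_itv/= => /f0.
apply/seteqP; split=> x /=; rewrite !in_itv/=.
  by move=> /andP[h1 h2]; apply/andP; split; lra.
by move=> /andP[h1 h2]; apply/andP; split; lra.
Qed.

Lemma ge0_integral_reflect (b : R) (f : R -> \bar R) :
  measurable_fun `[0%R, b] f -> (forall x, (0 <= x <= b)%R -> 0 <= f x) ->
  \int[mu]_(s in `[0%R, b]) f (b - s)%R = \int[mu]_(s in `[0%R, b]) f s.
Proof.
move=> mf f0.
have mN : measurable_fun setT (-%R : measurableTypeR R -> measurableTypeR R) by [].
have mfb : measurable_fun `[(0 - b)%R, (b - b)%R] (fun s => f (b + s)%R).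
  apply: (measurable_comp (F := `[0%R, b]%classic)) => //.
    by move=> _ [x /= + <-]; rewrite !in_itv/= => /andP[h1 h2]; apply/andP; split; lra.
  exact: measurable_funD.
rewrite -[RHS](ge0_integral_shift b)//.
rewrite (_ : `[0%R, b]%classic = (-%R : _ -> measurableTypeR R) @^-1` `[(0 - b)%R, (b - b)%R]).
  rewrite -[LHS](@ge0_integral_pushforward _ _ _ _ _ _ mN mu _ (fun s => f (b + s)%R))//.
    by apply: eq_measure_integral => //= A mA _; exact: lebesgue_measureN.
  move=> x; rewrite inE/= in_itv/= => /andP[h1 h2]; apply: f0.
  by apply/andP; split; lra.
apply/seteqP; split=> x /=; rewrite !in_itv/=.
  by move=> /andP[h1 h2]; apply/andP; split; lra.
by move=> /andP[h1 h2]; apply/andP; split; lra.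
Qed.
End LebesgueShift.

(** * A change of variables inequality *)

Section OuterRegularity.
Local Open Scope ereal_scope.
Context {R : realType} (theta : {measure set (measurableTypeR R) -> \bar R}).

(** The restriction of theta to the semiring of half-open intervals, of which
theta is the only extension when it is finite on bounded intervals. *)
Definition ocitv_restr : set (ocitv_type R) -> \bar R := theta.

Let ocitv_restr0 : ocitv_restr set0 = 0. Proof. exact: measure0. Qed.

Let ocitv_restr_ge0 A : 0 <= ocitv_restr A. Proof. exact: measure_ge0. Qed.

Let ocitv_restr_additive : semi_sigma_additive ocitv_restr.
Proof.
move=> F mF tF mUF; apply: (@measure_semi_sigma_additive _ _ _ theta) => //.
- by move=> i; apply: sub_sigma_algebra; exact: mF.
- by apply: sub_sigma_algebra; exact: mUF.
Qed.

HB.instance Definition _ := isMeasure.Build _ _ _ ocitv_restr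
  ocitv_restr0 ocitv_restr_ge0 ocitv_restr_additive.

(** Outer regularity: theta is the Caratheodory extension of its restriction to
half-open intervals, hence theta A is the infimum of the sums over countable
covers of A by such intervals. *)
Lemma ge_ocitv_cover (l : \bar R) (A : set R) :
  (forall x : R, theta `](- x)%R, x]%classic < +oo) ->
  measurable A ->
  (forall F : nat -> set R, (forall n, ocitv (F n)) -> A `<=` \bigcup_n F n ->
    l <= \sum_(n <oo) theta (F n)) ->
  l <= theta A.
Proof.
move=> fin mA H.
have sf : sigma_finite [set: ocitv_type R] ocitv_restr.
  exists (fun k => `](- k%:R)%R, k%:R%R]%classic).
    apply/esym; rewrite -subTset => /= x _ /=.
    have := truncnS_gt `|x|%R; rewrite ltr_norml => /andP[h1 h2].
    by exists (Num.truncn `|x|%R).+1; rewrite //= in_itv/= h1 ltW.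
  by move=> k; split; [exact: is_ocitv|exact: fin].
have <- : measure_extension ocitv_restr A = theta A.
  exact: (@measure_extension_unique _ _ _ _ sf theta).
by apply: le_ereal_inf_tmp => _ [F [mF AF] <-]; exact: H.
Qed.
End OuterRegularity.

(** The increment of psi over [s, t] is at most the integral of rho, as if rho
bounded a derivative of psi; psi need not be differentiable, nor injective. *)
Section Reparametrization.
Context {R : realType}.
Local Notation leb := (@lebesgue_measure R).
Variables (L L' K : R) (psi rho : R -> R).
Hypotheses (rho0 : forall s, 0 <= rho s) (mrho : measurable_fun setT rho).
Hypotheses (rhoK : forall s, rho s <= K) (mpsi : measurable_fun setT psi).
Hypothesis psi_incr : forall s t : R, 0 <= s -> s <= t -> t <= L ->
  ((psi t - psi s)%:E <= \int[leb]_(x in `[s, t]) (rho x)%:E)%E.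
Hypothesis psi_nd : forall s t : R, 0 <= s -> s <= t -> t <= L -> psi s <= psi t.
Hypothesis psi_surj : forall y : R, 0 <= y <= L' -> exists2 s : R, 0 <= s <= L & psi s = y.

Let D := `[0, L]%classic : set (measurableTypeR R).
Let mD : measurable D. Proof. exact: measurable_itv. Qed.
Let rhoD := rho \_ D.
Let rhoD0 s : 0 <= rhoD s. Proof. by rewrite /rhoD patchE; case: ifP. Qed.
Let mrhoD : measurable_fun [set: measurableTypeR R] rhoD.
Proof.
by apply: (measurable_restrictT rho mD).1; exact: measurable_funTS.
Qed.
Let theta : {measure set (measurableTypeR R) -> \bar R} := density_measure leb rhoD0 mrhoD.

Let thetaE (A : set R) : measurable A -> theta A = (\int[leb]_(x in A `&` D) (rho x)%:E)%E.
Proof.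
move=> mA; rewrite /theta /density_measure [RHS]integral_mkcondr.
by apply: eq_integral => x _; rewrite /rhoD !patchE; case: ifP.
Qed.

(** A cover of the preimage of A by intervals is mapped by psi to a cover of the
part of A in [0, L'], by intervals whose lengths are bounded by theta of the
original ones. *)
Let leb_image_le (A : set R) : measurable (A : set (measurableTypeR R)) ->
  (leb (A `&` `[0%R, L']) <= theta (psi @^-1` A))%E.
Proof.
move=> mA; apply: ge_ocitv_cover.
- move=> x; rewrite thetaE//.
  apply: (@le_lt_trans _ _ (\int[leb]_(x in `](- x)%R, x]) (cst K%:E x))%E).
    apply: (@le_trans _ _ (\int[leb]_(x in `](- x)%R, x]) (rho x)%:E)%E).
      apply: ge0_subset_integral => //.
      + exact: measurableI.
      + by apply/measurable_EFinP; exact: measurable_funTS.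
      + by move=> s _; rewrite lee_fin.
    apply: ge0_le_integral => //.
    + by move=> s _; rewrite lee_fin.
    + by apply/measurable_EFinP; exact: measurable_funTS.
    + by move=> s _; rewrite lee_fin.
  have lfin : (leb `](- x)%R, x]%classic < +oo)%E.
    by rewrite lebesgue_measure_itv/=; case: ifP => _; rewrite ?ltry// -EFinB ltry.
  rewrite integral_cst//; apply: lte_mul_pinfty => //.
  by rewrite lee_fin (le_trans (rho0 0) (rhoK 0)).
- by rewrite -[X in measurable X]setTI; exact: mpsi.
move=> F oF AF.
have /choice[a_ aE] n : exists x : R * R, F n = `]x.1, x.2]%classic.
  by have [x _ <-] := oF n; exists x.
pose a n := Num.max (a_ n).1 0; pose b n := Num.min (a_ n).2 L.
pose J n := if a n <= b n then `[psi (a n), psi (b n)]%classic else set0.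
have mJ n : measurable (J n : set (measurableTypeR R)) by rewrite /J; case: ifP.
apply: (@le_trans _ _ (\sum_(n <oo) leb (J n))%E).
  apply: (@measure_sigma_subadditive _ _ _ leb) => //; first exact: measurableI.
  move=> y [Ay]; rewrite /= in_itv/= => /psi_surj[s /andP[s0 sL] sy].
  have [n _] := AF s (ltac:(by rewrite /= sy)).
  rewrite aE /= in_itv/= => /andP[as_ sb]; exists n => //; rewrite /J.
  have as' : a n <= s by rewrite ge_max s0 ltW.
  have sb' : s <= b n by rewrite le_min sb.
  rewrite (le_trans as' sb') /= in_itv/= -sy !psi_nd// ?ge_min ?lexx ?orbT//.
  by rewrite le_max lexx orbT.
apply: lee_nneseries => // n _; rewrite /J; case: ifPn => [ab|_]; last by rewrite measure0.
have a0 : 0 <= a n by rewrite le_max lexx orbT.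
have bL : b n <= L by rewrite ge_min lexx orbT.
rewrite lebesgue_measure_itv/=; case: ifPn => // _.
rewrite -EFinB; apply: le_trans (psi_incr a0 ab bL) _.
rewrite -integral_itv_obnd_cbnd; last by apply/measurable_EFinP; exact: measurable_funTS.
rewrite thetaE; last by rewrite aE.
apply: ge0_subset_integral => //.
- by apply: measurableI => //; rewrite aE.
- by apply/measurable_EFinP; exact: measurable_funTS.
- by move=> s _; rewrite lee_fin.
move=> x; rewrite aE /D /= !in_itv/= /a /b gt_max le_min.
by move=> /andP[/andP[-> x0] /andP[-> ->]]; rewrite (ltW x0).
Qed.

(** By [leb_image_le], Lebesgue measure on [0, L'] is at most the image under psi
of the measure with density rho on [0, L]. *)
Lemma le_integral_reparam (f : R -> \bar R) : measurable_fun setT f ->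
  (forall s, 0 <= f s)%E ->
  (\int[leb]_(y in `[0%R, L']) f y <=
   \int[leb]_(s in `[0%R, L]) (f (psi s) * (rho s)%:E))%E.
Proof.
move=> mf f0.
have mD' : measurable (`[0, L'] : set (measurableTypeR R)) by [].
rewrite -(@eq_measure_integral _ _ _ _ leb (mrestr leb mD')); last first.
  by move=> A mA AS; rewrite /mrestr; congr (leb _); apply/setIidPl.
have mpsi' : measurable_fun [set: measurableTypeR R] (psi : measurableTypeR R -> measurableTypeR R) by [].
apply: (@le_trans _ _ (\int[pushforward theta (psi : measurableTypeR R -> measurableTypeR R)]_(y in `[0%R, L']) f y)%E).
  by apply: (@ge0_le_measure_integral _ _ _ (mrestr leb mD') [the measure _ _ of pushforward theta (psi : measurableTypeR R -> measurableTypeR R)]).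
rewrite (@ge0_integral_pushforward _ _ _ _ _ _ mpsi')//; last exact: measurable_funTS.
set E := psi @^-1` _.
have mE : measurable (E : set (measurableTypeR R)).
  by rewrite -[X in measurable X]setTI; exact: mpsi.
have mfp : measurable_fun setT (f \o psi).
  exact: measurableT_comp.
rewrite ge0_integral_density//; [|exact: measurable_funTS|by move=> x _; exact: f0].
rewrite (eq_integral ((fun s => f (psi s) * (rho s)%:E)%E \_ D)); last first.
  by move=> x _; rewrite /rhoD !patchE; case: ifP => //; rewrite mule0.
rewrite -integral_mkcondr; apply: ge0_subset_integral => //.
- exact: measurableI.
- apply: emeasurable_funM; first exact: measurable_funTS.
  by apply/measurable_EFinP; exact: measurable_funTS.
- by move=> s _; rewrite mule_ge0 ?f0 ?lee_fin.
Qed.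

End Reparametrization.

(** * Lipschitz maps and Borel measurability *)

Section Borel.
Context {R : realType}.

Lemma continuous_borel d (T : measurableType d) (Z : pmetricType R) (f : T -> borel Z) :
  (forall U : set Z, open U -> measurable (f @^-1` U)) -> measurable_fun setT f.
Proof.
move=> H; apply: (@measurability _ _ T (borel Z) setT f (@open Z)) => // _ [U oU <-].
by rewrite setTI; exact: H.
Qed.

Lemma lipschitz_continuous_path (Z : pmetricType R) (f : R -> Z) (K : R) :
  (forall s t, mdist (f s) (f t) <= K * `|s - t|) -> continuous f.
Proof.
move=> H s; apply/metricType_numDomainType.cvgrPdist_lt => e e0.
apply/nbhs_ballP; exists (e / (`|K| + 1)) => /=; first by rewrite divr_gt0// ltr_wpDl.
move=> t; rewrite /ball/= ltr_pdivlMr ?ltr_wpDl// => st.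
apply: le_lt_trans st; apply: le_trans (H s t) _.
rewrite mulrC ler_wpM2l//; have := ler_norm K; lra.
Qed.

Lemma lipschitz_continuous_real (f : R -> R) (K : R) :
  (forall s t, `|f s - f t| <= K * `|s - t|) -> continuous f.
Proof.
move=> H s; apply/cvgrPdist_lt => e e0.
apply/nbhs_ballP; exists (e / (`|K| + 1)) => /=; first by rewrite divr_gt0// ltr_wpDl.
move=> t; rewrite /ball/= ltr_pdivlMr ?ltr_wpDl// => st.
apply: le_lt_trans st; apply: le_trans (H s t) _.
rewrite mulrC ler_wpM2l//; have := ler_norm K; lra.
Qed.

Lemma path_borel (Z : pmetricType R) (f : R -> Z) : continuous f ->
  measurable_fun setT (f : measurableTypeR R -> borel Z).
Proof.
move=> cf; apply: continuous_borel => U oU; apply: open_measurable.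
by move/continuousP: cf; apply.
Qed.

(** Composition with the clamping map extends a path on [0, L] to all of R with
the same Lipschitz constant, so that continuity and measurability need not be
considered relative to intervals. *)
Definition clamp (L s : R) := Num.max 0 (Num.min s L).

Lemma clamp_itv L s : 0 <= L -> 0 <= clamp L s <= L.
Proof. by move=> L0; rewrite /clamp le_max lexx/= ge_max L0 ge_min lexx orbT. Qed.

Lemma clamp_id L s : 0 <= s <= L -> clamp L s = s.
Proof. by move=> /andP[s0 sL]; rewrite /clamp (min_idPl sL) (max_idPr s0). Qed.

Lemma clamp_nd L s t : s <= t -> clamp L s <= clamp L t.
Proof.
move=> st; rewrite /clamp ge_max le_max lexx/= le_max; apply/orP; right.
by rewrite le_min !ge_min st lexx orbT.
Qed.

Lemma clamp_lip L s t : `|clamp L s - clamp L t| <= `|s - t|.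
Proof.
wlog st : s t / s <= t.
  by move=> H; have [|/ltW] := leP s t; [|rewrite distrC (distrC s)]; exact: H.
rewrite !ler0_norm ?subr_le0// ?clamp_nd//.
rewrite /clamp; case: (leP s L) => ?; case: (leP t L) => ?;
  case: (leP 0 s) => ?; case: (leP 0 t) => ?; case: (leP 0 L) => ?; lra.
Qed.

End Borel.

(** * Curve integrals in other parameters *)

Section ArcLengthExtended.
Context {R : realType} {Z : pmetricType R}.
Variables (a b : R) (c : R -> Z).
Hypothesis rc : rectifiable a b c.
Local Notation len s t := (fine (curve_length s t c)).
Local Notation leb := (@lebesgue_measure R).

Definition arc_path (s : R) : Z := arc_param a b c (clamp (len a b) s).

Let L0 : 0 <= len a b. Proof. exact/(len_ge0)/(rectifiable_le rc). Qed.

Lemma arc_path_lip s t : mdist (arc_path s) (arc_path t) <= `|s - t|.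
Proof.
apply: le_trans (clamp_lip (len a b) s t).
by apply: (arc_param_lip rc); exact: clamp_itv.
Qed.

Lemma arc_path_len t : a <= t <= b -> arc_path (len a t) = c t.
Proof.
move=> /[dup] tab /andP[a_t tb].
rewrite /arc_path clamp_id ?(arc_param_len rc)//.
by rewrite len_ge0//= (len_mono rc).
Qed.

Lemma arc_path0 : arc_path 0 = c a.
Proof.
by rewrite -(arc_path_len (t := a)) ?lengthxx// lexx (rectifiable_le rc).
Qed.

Lemma arc_pathL : arc_path (len a b) = c b.
Proof. by rewrite arc_path_len// lexx (rectifiable_le rc). Qed.

Lemma arc_pathE s : 0 <= s <= len a b -> exists2 t, a <= t <= b & arc_path s = c t.
Proof.
move=> sL; have [h1 h2] := arc_timeP rc sL; exists (arc_time a b c s) => //.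
by rewrite /arc_path clamp_id.
Qed.

Lemma curve_integral_arc_path (g : Z -> \bar R) :
  curve_integral a b c g = (\int[leb]_(s in `[0%R, len a b]) g (arc_path s))%E.
Proof. by apply: (curve_integralE rc) => t; exact: arc_path_len. Qed.

(** T s is a time of the curve c, and rho bounds the speed at which the length
of c up to the time T s grows with s. *)
Lemma curve_integral_reparam (L K : R) (T rho : R -> R) (g : Z -> \bar R) :
  0 <= L -> (forall s, 0 <= rho s) -> (forall s, rho s <= K) ->
  measurable_fun setT rho ->
  (forall s, 0 <= s <= L -> a <= T s <= b) ->
  (forall s t, 0 <= s -> s <= t -> t <= L -> len a (T s) <= len a (T t) /\
    ((len a (T t) - len a (T s))%:E <= \int[leb]_(x in `[s, t]) (rho x)%:E)%E) ->
  (forall y, 0 <= y <= len a b -> exists2 s, 0 <= s <= L & len a (T s) = y) ->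
  (forall x, 0 <= g x)%E ->
  measurable_fun [set: borel Z] (g : borel Z -> \bar R) ->
  (curve_integral a b c g <=
   \int[leb]_(s in `[0%R, L]) (g (c (T s)) * (rho s)%:E))%E.
Proof.
move=> L00 rho0 rhoK mrho Tab incr surj g0 mg.
rewrite curve_integral_arc_path.
pose psi s := len a (T (clamp L s)).
have psilip s t : s <= t -> `|psi s - psi t| <= K * `|s - t|.
  move=> st; have [c1 c2] := (clamp_itv s L00, clamp_itv t L00).
  case/andP: c1 => c10 c1L; case/andP: c2 => c20 c2L.
  have [h1 h2] := incr _ _ c10 (clamp_nd L st) c2L.
  rewrite /psi ler0_norm ?subr_le0// opprB.
  have K0 : 0 <= K by apply: le_trans (rho0 0) (rhoK 0).
  apply: (@le_trans _ _ (K * (clamp L t - clamp L s))).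
    rewrite -lee_fin; apply: le_trans h2 _.
    apply: (@le_trans _ _ (\int[leb]_(x in `[clamp L s, clamp L t]) (cst K%:E x))%E).
      apply: ge0_le_integral => //.
      - by move=> x _; rewrite lee_fin.
      - by apply/measurable_EFinP; exact: measurable_funTS.
      - by move=> x _; rewrite lee_fin.
    rewrite integral_cst//= lebesgue_measure_itv/= lte_fin.
    case: ifPn => _; first by rewrite -EFinB -EFinM.
    by rewrite mule0 lee_fin mulr_ge0// subr_ge0 clamp_nd.
  rewrite ler_wpM2l// distrC -[leLHS]ger0_norm ?subr_ge0 ?clamp_nd//.
  exact: clamp_lip.
have mpsi : measurable_fun setT psi.
  apply: continuous_measurable_fun; apply: (@lipschitz_continuous_real _ _ K) => s t.
  have [st|/ltW st] := leP s t; first exact: psilip.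
  by rewrite distrC (distrC s); exact: psilip.
have mgam : measurable_fun setT (arc_path : measurableTypeR R -> borel Z).
  apply: path_borel; apply: (@lipschitz_continuous_path _ _ _ 1) => s t.
  by rewrite mul1r arc_path_lip.
apply: le_trans (@le_integral_reparam _ L (len a b) K psi rho rho0 mrho rhoK mpsi
  _ _ _ (fun s => g (arc_path s)) _ _) _ => //.
- move=> s t s0 st tL; rewrite /psi !clamp_id ?s0 ?(le_trans s0 st) ?tL ?(le_trans st tL)//.
  by have [] := incr s t s0 st tL.
- move=> s t s0 st tL; rewrite /psi !clamp_id ?s0 ?(le_trans s0 st) ?tL ?(le_trans st tL)//.
  by have [] := incr s t s0 st tL.
- by move=> y /surj[s sL <-]; exists s => //; rewrite /psi clamp_id.
- exact: (measurable_comp (F := setT) (f := (g : borel Z -> \bar R)) _ _ mg mgam).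
rewrite le_eqVlt; apply/orP; left; apply/eqP.
apply: eq_integral => s; rewrite inE/= in_itv/= => sL; congr (g _ * _)%E.
by rewrite /psi clamp_id// arc_path_len// Tab.
Qed.

End ArcLengthExtended.

Section LipschitzPath.
Context {R : realType} {Z : pmetricType R}.
Local Notation leb := (@lebesgue_measure R).
Variables (gam : R -> Z) (L : R).
Hypotheses (L0 : 0 <= L) (lip : forall s t, mdist (gam s) (gam t) <= `|s - t|).

Lemma lip_curve s t : s <= t -> is_curve s t gam.
Proof.
move=> st; split => //; apply: continuous_subspaceT.
by apply: (@lipschitz_continuous_path _ _ _ 1) => ? ?; rewrite mul1r.
Qed.

Lemma lip_length s t : s <= t -> (curve_length s t gam <= (t - s)%:E)%E.
Proof.
move=> st; apply: length_le => p; rewrite lee_fin.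
elim: p s {st} => [|x p IH] s; first by move=> /itv_partition_nil ->; rewrite subrr.
move=> ps; have sx : s < x by case: ps => /= /andP[].
have /= := IH x (itv_partition_cons ps).
have := lip s x; rewrite ltr0_norm ?subr_lt0//; lra.
Qed.

Lemma lip_rectifiable : rectifiable 0 L gam.
Proof.
split; first exact: lip_curve.
by apply: le_lt_trans (lip_length L0) _; rewrite ltry.
Qed.

(** The length of a 1-Lipschitz path grows at speed at most 1. *)
Lemma curve_integral_lip_le (g : Z -> \bar R) : (forall x, 0 <= g x)%E ->
  measurable_fun [set: borel Z] (g : borel Z -> \bar R) ->
  (curve_integral 0 L gam g <= \int[leb]_(s in `[0%R, L]) g (gam s))%E.
Proof.
move=> g0 mg; have rc := lip_rectifiable.
have -> : (\int[leb]_(s in `[0%R, L]) g (gam s) =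
    \int[leb]_(s in `[0%R, L]) (g (gam (id s)) * (cst (1 : R) s)%:E))%E.
  by apply: eq_integral => s _; rewrite mule1.
apply: (curve_integral_reparam rc (K := 1)) => //; last exact: len_surj.
move=> s t s0 st tL; have tl := lenD rc (lexx 0) s0 st tL.
split; first by rewrite tl lerDl len_ge0.
rewrite tl addrAC subrr add0r fineK ?(sub_length_fin rc)//.
apply: le_trans (lip_length st) _.
rewrite -[X in (_ <= X)%E]/(\int[leb]_(x in `[s, t]) (cst (1 : R)%:E x))%E integral_cst//= mul1e lebesgue_measure_itv/=.
rewrite lte_fin; case: ifPn; first by rewrite EFinB.
by rewrite -leNgt lee_fin subr_le0.
Qed.

End LipschitzPath.

(** * The distance of the uniformization *)

Section UniformizedDistance.
Context {R : realType} {X : pmetricType R}.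
Local Notation leb := (@lebesgue_measure R).
Variables (eps : R) (b : X -> R).
Hypotheses (eps0 : 0 < eps) (b_lip : forall x y, `|b x - b y| <= mdist x y).
Hypothesis geoX : geodesic_space X.
Local Notation rho := (density eps b).
Local Notation de := (unif_dist eps b).
Implicit Types (x y z : X) (gam : R -> X).

Lemma rho_gt0 x : 0 < rho x. Proof. exact: expR_gt0. Qed.

Lemma rho_ge0 x : 0 <= rho x. Proof. exact: expR_ge0. Qed.

(** b is 1-Lipschitz. The lemmas derived from this are also applied to the
weight of the measure, with beta in place of eps. *)
Lemma rho_le x y : rho y <= rho x * expR (eps * mdist x y).
Proof.
rewrite /density -expRD ler_expR mulNr mulNr.
have := b_lip x y; rewrite ler_norml => /andP[_ h].
by have := ler_wpM2l (ltW eps0) h; rewrite mulrBr; lra.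
Qed.

Lemma rho_le_dist x y r : mdist x y <= r -> rho y <= rho x * expR (eps * r).
Proof.
move=> xyr; apply: le_trans (rho_le x y) _.
by rewrite ler_wpM2l ?rho_ge0// ler_expR ler_wpM2l// ltW.
Qed.

Lemma rho_ge_dist x y r : mdist x y <= r -> rho x * expR (- (eps * r)) <= rho y.
Proof.
move=> xyr; rewrite expRN ler_pdivrMr ?expR_gt0//.
by apply: rho_le_dist; rewrite metric_sym.
Qed.

Lemma rho_continuous : continuous (rho : X -> R).
Proof.
have cb : continuous (b : X -> R).
  move=> x; apply/cvgrPdist_lt => e e0; apply/nbhs_ballP; exists e => //= y.
  by rewrite ballEmdist/= => xy; apply: le_lt_trans (b_lip x y) xy.
move=> x; apply: continuous_comp; last exact: continuous_expR.
by apply: cvgM; [exact: cvg_cst|exact: cb].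
Qed.

Lemma rho_borel : measurable_fun setT (rho : borel X -> R).
Proof.
have /continuousP H := rho_continuous.
apply: measurability (RGenOpens.measurableE R) _ => _ [U [x [y ->]] <-].
rewrite setTI; apply: sub_sigma_algebra; apply: H; exact: interval_open.
Qed.

Definition lip1 gam := forall s t, mdist (gam s) (gam t) <= `|s - t|.

Definition path_weight (L : R) gam := (\int[leb]_(s in `[0%R, L]) (rho (gam s))%:E)%E.

Lemma rho_path_measurable gam (A : set R) : lip1 gam ->
  measurable_fun A (fun s => (rho (gam s))%:E).
Proof.
move=> lg; apply/measurable_EFinP; apply: measurable_funTS.
apply: continuous_measurable_fun => s; apply: continuous_comp; last exact: rho_continuous.
by apply: (@lipschitz_continuous_path _ _ _ 1) => ? ?; rewrite mul1r.
Qed.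

Lemma leb_itvE (s t : R) : s <= t -> leb `[s, t]%classic = (t - s)%:E.
Proof.
rewrite lebesgue_measure_itv/= lte_fin le_eqVlt => /predU1P[<-|->].
  by rewrite subrr; case: ifP; rewrite // ltxx.
by rewrite EFinB.
Qed.

Lemma path_weight_ge (m L : R) gam : lip1 gam -> 0 <= m -> 0 <= L ->
  (forall s, 0 <= s <= L -> m <= rho (gam s)) -> ((m * L)%:E <= path_weight L gam)%E.
Proof.
move=> lg m0 L0 H.
have -> : (m * L)%:E = (\int[leb]_(s in `[0%R, L]) (cst m%:E s))%E.
  by rewrite integral_cst//= leb_itvE// subr0 EFinM.
apply: ge0_le_integral => //.
exact: rho_path_measurable.
Qed.

Lemma path_weight_le (m L : R) gam : lip1 gam -> 0 <= L ->
  (forall s, 0 <= s <= L -> rho (gam s) <= m) -> (path_weight L gam <= (m * L)%:E)%E.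
Proof.
move=> lg L0 H.
have -> : (m * L)%:E = (\int[leb]_(s in `[0%R, L]) (cst m%:E s))%E.
  by rewrite integral_cst//= leb_itvE// subr0 EFinM.
apply: ge0_le_integral => //.
- by move=> s _; rewrite lee_fin rho_ge0.
- exact: rho_path_measurable.
Qed.

Lemma path_weight_upper (L : R) gam : lip1 gam -> 0 <= L ->
  (path_weight L gam <= (rho (gam 0) * expR (eps * L) * L)%:E)%E.
Proof.
move=> lg L0; apply: path_weight_le => // s /andP[s0 sL].
apply: rho_le_dist; apply: le_trans (lg 0 s) _.
by rewrite sub0r normrN ger0_norm.
Qed.

(** Up to time t the path stays in the ball of radius t about its start, where
rho is bounded from below. *)
Lemma path_weight_lower (L t : R) gam : lip1 gam -> 0 <= t -> t <= L ->
  ((rho (gam 0) * expR (- (eps * t)) * t)%:E <= path_weight L gam)%E.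
Proof.
move=> lg t0 tL; apply: (@le_trans _ _ (path_weight t gam)).
  apply: path_weight_ge; [exact: lg|exact: mulr_ge0 (rho_ge0 _) (expR_ge0 _)|exact: t0|].
  move=> s /andP[s0 st]; apply: rho_ge_dist; apply: le_trans (lg 0 s) _.
  by rewrite sub0r normrN ger0_norm.
apply: ge0_subset_integral => //.
- exact: rho_path_measurable.
- by move=> s _; rewrite lee_fin rho_ge0.
- by move=> s; rewrite /= !in_itv/= => /andP[-> st]; rewrite (le_trans st).
Qed.

(** A geodesic is only controlled on [u, v]; translated and clamped it becomes a
1-Lipschitz path on R that starts at time 0. *)
Lemma geodesic_path u v (c : R -> X) x y : geodesic_joins u v c x y ->
  [/\ mdist x y = v - u,
    lip1 (fun s => c (u + clamp (v - u) s)),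
    c (u + clamp (v - u) 0) = x & c (u + clamp (v - u) (v - u)) = y].
Proof.
move=> [uv gc <- <-]; have vu0 : 0 <= v - u by rewrite subr_ge0.
split.
- by rewrite gc/= ?in_itv/= ?lexx ?uv// ler0_norm ?subr_le0// opprB.
- move=> s t; have /andP[h1 h2] := clamp_itv s vu0; have /andP[h3 h4] := clamp_itv t vu0.
  rewrite gc/= ?in_itv/=; last 2 first.
    by apply/andP; split; lra.
    by apply/andP; split; lra.
  rewrite (_ : u + _ - _ = clamp (v - u) s - clamp (v - u) t); last by ring.
  exact: clamp_lip.
- by rewrite clamp_id ?lexx// addr0.
- by rewrite clamp_id ?lexx ?vu0// addrC subrK.
Qed.

Lemma weighted_length_rect u v (c : R -> X) (rc : rectifiable u v c) :
  weighted_length eps b u v c = path_weight (fine (curve_length u v c)) (arc_path u v c).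
Proof. by rewrite /weighted_length (curve_integral_arc_path rc). Qed.

Lemma weighted_length_fin u v (c : R -> X) : is_curve u v c ->
  (weighted_length eps b u v c < +oo)%E -> rectifiable u v c.
Proof.
move=> uvc; rewrite /weighted_length /curve_integral => H; split => //; move: H.
have := length_ge0 c uvc.1.
by case: (curve_length u v c) => // r; rewrite ltry.
Qed.

Lemma weighted_length_ge0 u v (c : R -> X) : (0 <= weighted_length eps b u v c)%E.
Proof.
rewrite /weighted_length /curve_integral; case: curve_length => // L.
by apply: integral_ge0 => s _; rewrite /= lee_fin rho_ge0.
Qed.

Lemma weighted_length_lip_le L gam : 0 <= L -> lip1 gam ->
  (weighted_length eps b 0 L gam <= path_weight L gam)%E.
Proof.
move=> L0 lg; apply: curve_integral_lip_le => //.
- by move=> x; rewrite /= lee_fin rho_ge0.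
- by apply/measurable_EFinP; exact: rho_borel.
Qed.

Let curves x y := [set l : \bar R | exists u v c,
    [/\ is_curve u v c, c u = x, c v = y & l = weighted_length eps b u v c]].

(** The infimum defining [unif_dist] is finite because geodesics have finite
weighted length. *)
Lemma unif_distE x y : ereal_inf (curves x y) = (de x y)%:E.
Proof.
rewrite /unif_dist fineK// ge0_fin_numE; last first.
  by apply: le_ereal_inf_tmp => _ [u [v [c [_ _ _ ->]]]]; exact: weighted_length_ge0.
have [u [v [c /geodesic_path[dxy lg g0 gL]]]] := geoX x y.
have L0 : 0 <= v - u by rewrite -dxy mdist_ge0.
apply: (@le_lt_trans _ _ (path_weight (v - u) (fun s => c (u + clamp (v - u) s)))).
  apply: le_trans (weighted_length_lip_le L0 lg).
  apply: ereal_inf_lbound; exists 0, (v - u), (fun s => c (u + clamp (v - u) s)).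
  by split => //; exact: lip_curve.
by apply: le_lt_trans (path_weight_upper lg L0) _; rewrite ltry.
Qed.

Lemma unif_dist_ge0 x y : 0 <= de x y.
Proof.
rewrite -lee_fin -unif_distE.
by apply: le_ereal_inf_tmp => _ [u [v [c [_ _ _ ->]]]]; exact: weighted_length_ge0.
Qed.

Lemma unif_dist_le_path L gam : 0 <= L -> lip1 gam ->
  ((de (gam 0) (gam L))%:E <= path_weight L gam)%E.
Proof.
move=> L0 lg; apply: le_trans (weighted_length_lip_le L0 lg).
rewrite -unif_distE; apply: ereal_inf_lbound; exists 0, L, gam.
by split => //; exact: lip_curve.
Qed.

(** An almost optimal curve has finite length and can be parametrized by arc
length. *)
Lemma unif_dist_path x y e : 0 < e -> exists L gam,
  [/\ 0 <= L, lip1 gam, gam 0 = x, gam L = y & (path_weight L gam < (de x y + e)%:E)%E].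
Proof.
move=> e0; have : (ereal_inf (curves x y) < (de x y + e)%:E)%E.
  by rewrite unif_distE lte_fin ltrDl.
move=> /ereal_inf_lt[_ [u [v [c [uvc cu cv ->]]]] H].
have rc : rectifiable u v c by apply: weighted_length_fin => //; apply: lt_trans H _; rewrite ltry.
exists (fine (curve_length u v c)), (arc_path u v c); split.
- by apply: (len_ge0); exact: (rectifiable_le rc).
- by move=> s t; exact: (arc_path_lip rc).
- by rewrite (arc_path0 rc).
- by rewrite (arc_pathL rc).
- by rewrite -weighted_length_rect.
Qed.

Lemma unif_dist_upper x y : de x y <= rho x * expR (eps * mdist x y) * mdist x y.
Proof.
have [u [v [c /geodesic_path[dxy lg g0 gL]]]] := geoX x y.
have L0 : 0 <= v - u by rewrite -dxy mdist_ge0.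
have := le_trans (unif_dist_le_path L0 lg) (path_weight_upper lg L0).
by rewrite g0 gL lee_fin dxy.
Qed.

Lemma unif_dist_upper_le x y r : mdist x y <= r ->
  de x y <= rho x * expR (eps * r) * r.
Proof.
move=> xyr; have r0 : 0 <= r := le_trans (mdist_ge0 _ _) xyr.
apply: le_trans (unif_dist_upper x y) _.
have h : expR (eps * mdist x y) <= expR (eps * r) by rewrite ler_expR ler_pM2l.
have h2 : rho x * expR (eps * mdist x y) <= rho x * expR (eps * r).
  by rewrite ler_pM2l ?rho_gt0.
apply: (@le_trans _ _ (rho x * expR (eps * r) * mdist x y)).
  by rewrite ler_wpM2r ?mdist_ge0.
by rewrite ler_pM2l//; exact: mulr_gt0 (rho_gt0 x) (expR_gt0 _).
Qed.

(** A path from x to y has length at least t. *)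
Lemma unif_dist_lower x y t : 0 <= t -> t <= mdist x y ->
  rho x * expR (- (eps * t)) * t <= de x y.
Proof.
move=> t0 txy; apply/ler_addgt0Pr => e e0.
have [L [gam [L0 lg g0 gL /ltW W]]] := unif_dist_path x y e0.
have tL : t <= L.
  apply: le_trans txy _; rewrite -g0 -gL; apply: le_trans (lg 0 L) _.
  by rewrite sub0r normrN ger0_norm.
by have := le_trans (path_weight_lower lg t0 tL) W; rewrite g0 lee_fin.
Qed.

Lemma unif_distxx x : de x x = 0.
Proof.
apply/eqP; rewrite eq_le unif_dist_ge0 andbT.
by have := unif_dist_upper x x; rewrite mdistxx mulr0.
Qed.

Lemma unif_dist_sym x y : de x y = de y x.
Proof.
suff H x' y' : de x' y' <= de y' x' by apply/eqP; rewrite eq_le !H.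
apply/ler_addgt0Pr => e e0.
have [L [gam [L0 lg g0 gL /ltW W]]] := unif_dist_path y' x' e0.
(* an almost optimal path run backwards *)
pose gam' s := gam (L - s).
have lg' : lip1 gam'.
  move=> s t; apply: le_trans (lg _ _) _; rewrite distrC.
  by rewrite (_ : L - t - (L - s) = s - t); last by ring.
rewrite -lee_fin; apply: le_trans W.
have := unif_dist_le_path L0 lg'; rewrite /gam' subr0 subrr gL g0 => /le_trans; apply.
rewrite /path_weight (@ge0_integral_reflect _ L (fun s => (rho (gam s))%:E))//.
- exact: rho_path_measurable.
- by move=> s _; rewrite lee_fin rho_ge0.
Qed.

Lemma unif_dist_triangle y x z : de x z <= de x y + de y z.
Proof.
apply/ler_addgt0Pr => e e0; have e20 : 0 < e / 2 by rewrite divr_gt0.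
have [L [gam [L0 lg g0 gL /ltW W]]] := unif_dist_path x y e20.
have [L' [gam' [L'0 lg' g'0 g'L /ltW W']]] := unif_dist_path y z e20.
(* concatenation of almost optimal paths *)
pose g s := if s <= L then gam s else gam' (s - L).
have lipg s t : s <= t -> mdist (g s) (g t) <= `|s - t|.
  move=> st; rewrite /g; case: (leP s L) => sL; case: (leP t L) => tL; first exact: lg.
  - apply: le_trans (metric_triangle _ (gam L) _) _.
    have h1 := lg s L; have h2 := lg' 0 (t - L); rewrite gL -g'0.
    rewrite gL -g'0 in h1; move: h1 h2.
    by rewrite !ler0_norm ?subr_le0//; lra.
  - lra.
  - apply: le_trans (lg' _ _) _; rewrite opprB addrA subrK//.
have lg2 : lip1 g.
  move=> s t; have [st|/ltW st] := leP s t; first exact: lipg.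
  by rewrite metric_sym distrC; exact: lipg.
have LL : 0 <= L + L' by rewrite addr_ge0.
rewrite -lee_fin.
have := unif_dist_le_path LL lg2.
have -> : g 0 = x by rewrite /g L0.
have -> : g (L + L') = z.
  rewrite /g gerDl; case: leP => [L'1|_]; last by rewrite addrC addKr g'L.
  have L'E : L' = 0 by lra.
  by rewrite L'E addr0 gL -g'L L'E.
move=> /le_trans; apply.
apply: (@le_trans _ _ (path_weight L gam + path_weight L' gam')%E); last first.
  by apply: le_trans (leeD W W') _; rewrite -EFinD lee_fin; lra.
rewrite /path_weight.
have -> : `[0, L + L']%classic = `[0, L]%classic `|` `]L, L + L']%classic :> set R.
  by rewrite -itv_bndbnd_setU// bnd_simp ?lerDl//; exact: L0.
rewrite ge0_integral_setU//; last 3 first.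
- exact: rho_path_measurable.
- by move=> s _; rewrite lee_fin rho_ge0.
- apply/disj_setPS => s [] /=; rewrite !in_itv/= => /andP[_ h1] /andP[h2 _]; lra.
apply: leeD.
  rewrite le_eqVlt; apply/orP; left; apply/eqP.
  by apply: eq_integral => s; rewrite inE/= in_itv/= /g => /andP[_ ->].
rewrite -[X in (_ <= X)%E](@ge0_integral_shift _ (- L) 0 L' (fun s => (rho (gam' s))%:E)); last 2 first.
- exact: rho_path_measurable.
- by move=> s _; rewrite lee_fin rho_ge0.
rewrite sub0r opprK addrC (addrC L').
rewrite -integral_itv_obnd_cbnd; last first.
  apply/measurable_EFinP; apply: measurable_funTS.
  apply: continuous_measurable_fun => s.
  apply: (@continuous_comp _ _ _ (fun s => - L + s) (fun s => rho (gam' s))).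
    by apply: cvgD; [exact: cvg_cst|exact: cvg_id].
  apply: continuous_comp; last exact: rho_continuous.
  by apply: (@lipschitz_continuous_path _ _ _ 1) => ? ?; rewrite mul1r.
rewrite le_eqVlt; apply/orP; left; apply/eqP.
apply: eq_integral => s; rewrite inE/= in_itv/= /g => /andP[Ls _].
by rewrite leNgt Ls/= addrC.
Qed.

Lemma unif_dist_is_metric : is_metric de.
Proof.
split.
- exact: unif_distxx.
- move=> x y xy; apply/eqP; rewrite -[_ == _]negbK -mdist_gt0; apply/negP => d0.
  have := unif_dist_lower (mdist_ge0 x y) (lexx _).
  by rewrite xy leNgt (mulr_gt0 (mulr_gt0 (rho_gt0 x) (expR_gt0 _)) d0).
- exact: unif_dist_sym.
- exact: unif_dist_triangle.
Qed.

End UniformizedDistance.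

Lemma ge0_integral_itv_add {R : realType} (f : R -> \bar R) (s m t : R) :
  measurable_fun `[s, t] f -> (forall x, 0 <= f x)%E -> s <= m -> m <= t ->
  (\int[lebesgue_measure]_(x in `[s, t]) f x =
   \int[lebesgue_measure]_(x in `[s, m]) f x +
   \int[lebesgue_measure]_(x in `[m, t]) f x)%E.
Proof.
move=> mf f0 sm mt.
have e : `[s, t]%classic = `[s, m]%classic `|` `]m, t]%classic :> set R.
  by rewrite -itv_bndbnd_setU// bnd_simp.
rewrite e ge0_integral_setU//; last 2 first.
- by rewrite -e.
- apply/disj_setPS => x [] /=; rewrite !in_itv/= => /andP[_ h1] /andP[h2 _]; lra.
rewrite integral_itv_obnd_cbnd//; apply: measurable_funS mf => //.
by move=> x; rewrite /= !in_itv/= => /andP[mx ->]; rewrite andbT ltW// (le_lt_trans sm).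
Qed.

(** * Upper gradients on the uniformization *)

(** The map h is the identity from X to its uniformization, or the embedding of X
into a completion of it. *)
Section UpperGradientTransfer.
Context {R : realType} {X Z : pmetricType R}.
Local Notation leb := (@lebesgue_measure R).
Variables (eps : R) (b : X -> R) (h : X -> Z).
Hypotheses (eps0 : 0 < eps) (b_lip : forall x y, `|b x - b y| <= mdist x y).
Hypothesis geoX : geodesic_space X.
Local Notation rho := (density eps b).
Hypothesis h_iso : forall x y, mdist (h x) (h y) = unif_dist eps b x y.

Lemma embed_continuous : continuous h.
Proof.
move=> x; apply/metricType_numDomainType.cvgrPdist_lt => e e0.
pose K := rho x * expR (eps * 1).
have K0 : 0 < K := mulr_gt0 (rho_gt0 eps b x) (expR_gt0 _).
apply/nbhs_ballP; exists (Num.min 1 (e / K)) => /=.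
  by rewrite lt_min ltr01 divr_gt0.
move=> y; rewrite ballEmdist/= lt_min => /andP[/ltW y1 ye].
rewrite h_iso; apply: le_lt_trans (unif_dist_upper eps0 b_lip geoX x y) _.
rewrite ltr_pdivlMr// mulrC in ye; apply: le_lt_trans ye.
apply: ler_wpM2r; first exact: mdist_ge0.
apply: ler_wpM2l; first exact: rho_ge0.
by rewrite ler_expR ler_pM2l.
Qed.

Lemma embed_borel : measurable_fun setT (h : borel X -> borel Z).
Proof.
apply: continuous_borel => U oU; apply: sub_sigma_algebra.
by have /continuousP := embed_continuous; apply.
Qed.

Section curve.
Variables (u v : R) (c : R -> X).
Hypothesis rc : rectifiable u v c.
Local Notation len s t := (fine (curve_length s t c)).
Local Notation gam := (arc_path u v c).
Local Notation I s t := (\int[leb]_(x in `[s%R, t%R]) (rho (gam x))%:E)%E.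

Let lip_gam : lip1 gam. Proof. by move=> s t; exact: (arc_path_lip rc). Qed.

Let K := rho (c u) * expR (eps * len u v).

Let rho_gam_le s : rho (gam s) <= K.
Proof.
have L0 : 0 <= len u v by apply: (len_ge0); exact: (rectifiable_le rc).
have /andP[s0 sL] := clamp_itv s L0.
have -> : gam s = gam (clamp (len u v) s).
  by rewrite /arc_path [in RHS]clamp_id// clamp_itv.
rewrite /K -(arc_path0 rc); apply: (rho_le_dist eps0 b_lip).
apply: le_trans (lip_gam _ _) _.
by rewrite sub0r normrN ger0_norm.
Qed.

Let embed_step s t : u <= s -> s <= t -> t <= v ->
  ((mdist (h (c s)) (h (c t)))%:E <= I (len u s) (len u t))%E.
Proof.
move=> us st tv; rewrite h_iso.
have lst := len_mono rc us st tv.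
have l0 : 0 <= len u t - len u s by rewrite subr_ge0.
have lg : lip1 (fun x => gam (len u s + x)).
  move=> x y; apply: le_trans (lip_gam _ _) _.
  by rewrite (_ : _ + x - _ = x - y)//; ring.
have := unif_dist_le_path eps0 b_lip geoX l0 lg.
have es : gam (len u s) = c s.
  by apply: (arc_path_len rc); rewrite us (le_trans st tv).
have et : gam (len u t) = c t.
  by apply: (arc_path_len rc); rewrite (le_trans us st) tv.
have -> : gam (len u s + 0) = c s by rewrite addr0.
have -> : gam (len u s + (len u t - len u s)) = c t by rewrite subrKC.
move=> /le_trans; apply.
rewrite /path_weight.
rewrite -(@ge0_integral_shift _ (len u s) (len u s) (len u t) (fun x => (rho (gam x))%:E)); last 2 first.
- exact: (rho_path_measurable eps b_lip).
- by move=> x _; rewrite lee_fin rho_ge0.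
by rewrite subrr.
Qed.

(** Each chord of h o c is at most the weight of the corresponding arc of c. *)
Let embed_length s t : u <= s -> s <= t -> t <= v ->
  (curve_length s t (h \o c) <= I (len u s) (len u t))%E.
Proof.
move=> us st tv; apply: length_le => p.
elim: p s us {st} => [|x p IH] s us.
  by move=> _; apply: integral_ge0 => y _; rewrite lee_fin rho_ge0.
move=> ps; have sx : s < x by case: ps => /= /andP[].
have xt : x <= t by exact: itv_partition_le (itv_partition_cons ps).
have ux : u <= x := le_trans us (ltW sx).
rewrite (ge0_integral_itv_add (m := len u x)); last 4 first.
- exact: (rho_path_measurable eps b_lip).
- by move=> y; rewrite lee_fin rho_ge0.
- exact: (len_mono rc us (ltW sx) (le_trans xt tv)).
- exact: (len_mono rc ux xt tv).
rewrite /= EFinD; apply: leeD; first exact: (embed_step us (ltW sx) (le_trans xt tv)).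
exact: (IH x ux (itv_partition_cons ps)).
Qed.

Lemma embed_rectifiable : rectifiable u v (h \o c).
Proof.
have uv := rectifiable_le rc; split.
  split => //.
  move=> x; apply: (@continuous_comp (subspace `[u, v]) X Z c h x).
    exact: rc.1.2.
  exact: embed_continuous.
apply: le_lt_trans (embed_length (lexx u) uv (lexx v)) _.
rewrite lengthxx /=.
apply: le_lt_trans (path_weight_upper eps0 b_lip lip_gam _) _; last by rewrite ltry.
exact: len_ge0.
Qed.

(** With respect to the arc length of c, the length of h o c grows at speed at
most rho by [embed_length], so [curve_integral_reparam] applies to h o c. *)
Lemma embed_curve_integral (g : Z -> \bar R) : (forall x, 0 <= g x)%E ->
  measurable_fun [set: borel Z] (g : borel Z -> \bar R) ->
  (curve_integral u v (h \o c) g <=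
   curve_integral u v c (fun x => g (h x) * (rho x)%:E))%E.
Proof.
move=> g0 mg; have uv := rectifiable_le rc; have rhc := embed_rectifiable.
rewrite (curve_integral_arc_path rc).
have L0 : 0 <= len u v by apply: len_ge0.
(* a time at which the length of c is s *)
pose T s := arc_time u v c (clamp (len u v) s).
have TP s : u <= T s <= v /\ len u (T s) = clamp (len u v) s.
  by apply: (arc_timeP rc); exact: clamp_itv.
have hc s t : u <= s -> s <= t -> t <= v ->
    fine (curve_length u s (h \o c)) <= fine (curve_length u t (h \o c)).
  by move=> *; exact: (len_mono rhc).
have lhc s t : u <= s -> s <= t -> t <= v ->
    ((fine (curve_length u t (h \o c)) - fine (curve_length u s (h \o c)))%:E
       <= I (len u s) (len u t))%E.
  move=> us st tv; rewrite (lenD rhc (lexx u) us st tv) addrAC subrr add0r.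
  by rewrite fineK ?(sub_length_fin rhc)//; exact: embed_length.
(* h o c does not move while c does not; hence the length of h o c up to the
   time T s does not depend on the choice of this time *)
have Z0 s t : u <= s -> s <= t -> t <= v -> len u s = len u t ->
    fine (curve_length u s (h \o c)) = fine (curve_length u t (h \o c)).
  move=> us st tv E; apply/eqP; rewrite eq_le hc//=.
  have := lhc s t us st tv; rewrite E.
  rewrite (@integral_Sset1 _ _ _ (len u t)); last first.
    by move=> x; rewrite /= in_itv/= => h'; apply/eqP; rewrite eq_le andbC.
  by rewrite lee_fin subr_le0.
have Z1 s t : u <= s <= v -> u <= t <= v -> len u s = len u t ->
    fine (curve_length u s (h \o c)) = fine (curve_length u t (h \o c)).
  move=> /andP[us sv] /andP[ut tv] E.
  by have [st|/ltW ts] := leP s t; [|apply/esym]; apply: Z0.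
rewrite (_ : (\int[_]_(s in _) _)%E =
    (\int[leb]_(s in `[0%R, len u v]) (g ((h \o c) (T s)) * (rho (gam s))%:E))%E); last first.
  apply: eq_integral => s; rewrite inE/= in_itv/= => sL.
  have [h1 h2] := TP s; have E : gam s = c (T s).
    by rewrite -(arc_path_len rc h1) h2 clamp_id.
  by rewrite /= -E.
apply: (curve_integral_reparam rhc (K := K)) => //.
- by move=> s; exact: rho_ge0.
- by apply/measurable_EFinP; exact: (rho_path_measurable eps b_lip).
- by move=> s _; have [] := TP s.
- move=> s t s0 st tL.
  have [/andP[us sv] Es] := TP s; have [/andP[ut tv] Et] := TP t.
  rewrite clamp_id ?s0 ?(le_trans st tL)// in Es.
  rewrite clamp_id ?(le_trans s0 st) ?tL// in Et.
  have [TT|/ltW TT] := leP (T s) (T t).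
    split; first exact: hc.
    by have := lhc _ _ us TT tv; rewrite Es Et.
  have ts : len u (T t) <= len u (T s) := len_mono rc ut TT sv.
  have E : len u (T s) = len u (T t).
    by apply/eqP; rewrite eq_le ts Es Et st.
  rewrite (Z1 (T s) (T t)) ?us ?ut//; split=> //; rewrite subrr.
  by apply: integral_ge0 => x _; rewrite lee_fin rho_ge0.
- move=> y /(len_surj rhc)[t tuv <-]; exists (len u t).
    by case/andP: tuv => ut tv; rewrite len_ge0//= (len_mono rc).
  have [h1 h2] := TP (len u t); apply: Z1 => //.
  rewrite h2 clamp_id//.
  by case/andP: tuv => ut tv; rewrite len_ge0//= (len_mono rc).
Qed.

End curve.

Lemma embed_upper_gradient (f : Z -> R) (g : Z -> \bar R) : upper_gradient f g ->
  upper_gradient (f \o h) (fun x => g (h x) * (rho x)%:E)%E.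
Proof.
move=> [g0 mg ug]; split.
- by move=> x; rewrite mule_ge0// lee_fin rho_ge0.
- apply: emeasurable_funM.
    exact: (measurable_comp (F := setT) (f := (g : borel Z -> \bar R)) _ _ mg embed_borel).
  by apply/measurable_EFinP; exact: (rho_borel eps b_lip).
- move=> u v c rc; apply: le_trans (embed_curve_integral rc g0 mg).
  exact: (ug u v (h \o c) (embed_rectifiable rc)).
Qed.

End UpperGradientTransfer.

(** * Busemann functions *)

Section Busemann.
Context {R : realType} {X : pmetricType R}.
Implicit Types (x y z q : X) (c : R -> X).

Section ray.
Variable c : R -> X.
Hypothesis rayc : geodesic_ray c.

Let f x t := mdist (c t) x - t.

Let f_nd x s t : 0 <= s -> s <= t -> f x t <= f x s.
Proof.
move=> s0 st; rewrite /f; have := metric_triangle (c t) (c s) x.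
rewrite (rayc (s := t) (t := s)) /= ?in_itv/= ?andbT// ?(le_trans s0 st)//.
rewrite ger0_norm ?subr_ge0//; lra.
Qed.

Let f_lb x t : 0 <= t -> - mdist (c 0) x <= f x t.
Proof.
move=> t0; rewrite /f; have := metric_triangle (c t) x (c 0).
rewrite (rayc (s := t) (t := 0)) /= ?in_itv/= ?andbT// subr0 ger0_norm//.
have := metric_sym x (c 0); lra.
Qed.

(** d(c(t), x) - t is nonincreasing in t, so the limit is an infimum. *)
Let busemannE x : busemann c x = inf [set f x t | t in `[0, +oo[].
Proof.
set S := [set _ | _ in _]; have S0 : S (f x 0) by exists 0 => //=; rewrite in_itv/= lexx.
have Slb : lbound S (- mdist (c 0) x).
  by move=> _ [t /= + <-]; rewrite in_itv/= andbT => /f_lb.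
have iS : has_inf S by split; [exists (f x 0)|exists (- mdist (c 0) x)].
apply/cvg_lim => //; apply/cvgrPdist_le => e e0.
have [_ [T /= + <-] fT] := inf_adherent e0 iS.
rewrite in_itv/= andbT => T0.
exists T; split; first exact: num_real.
move=> t /ltW Tt; have t0 := le_trans T0 Tt.
have h1 : inf S <= f x t by apply: (ge_inf iS.2); exists t => //=; rewrite in_itv/= t0.
have h2 := f_nd x T0 Tt.
by rewrite -/(f x t) ler0_norm ?subr_le0//; lra.
Qed.

Lemma busemann_le x t : 0 <= t -> busemann c x <= mdist (c t) x - t.
Proof.
move=> t0; rewrite busemannE; apply: ge_inf.
  by exists (- mdist (c 0) x) => _ [s /= + <-]; rewrite in_itv/= andbT => /f_lb.
by exists t => //=; rewrite in_itv/= t0.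
Qed.

Lemma busemann_approx x e : 0 < e -> exists2 T, 0 <= T &
  forall t, T <= t -> mdist (c t) x - t <= busemann c x + e.
Proof.
move=> e0; rewrite busemannE; set S := [set _ | _ in _].
have iS : has_inf S.
  split; first by exists (f x 0), 0 => //=; rewrite in_itv/= lexx.
  by exists (- mdist (c 0) x) => _ [s /= + <-]; rewrite in_itv/= andbT => /f_lb.
have [_ [T /= + <-] fT] := inf_adherent e0 iS.
rewrite in_itv/= andbT => T0; exists T => // t Tt.
by have := f_nd x T0 Tt; move: fT; rewrite /f; lra.
Qed.
End ray.

(** For an element b of D(X) one can take b = d(., z) + s itself; for a Busemann
function z is a point far out on the ray, and d(., z) + s is close to b at the
two given points only. This lets both kinds of functions be treated alike. *)
Definition horo_approx (b : X -> R) := forall e, 0 < e -> forall x y,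
  exists z s, [/\ forall q, b q <= mdist q z + s,
    mdist x z + s <= b x + e & mdist y z + s <= b y + e].

Lemma Bhat_horo_approx b w : is_Bhat b w -> horo_approx b.
Proof.
case: w => [z [s ->]|xi [c [s [rayc _ ->]]]] e e0 x y.
  by exists z, s; split => //; rewrite lerDl ltW.
have [T1 T10 H1] := busemann_approx rayc x e0.
have [T2 T20 H2] := busemann_approx rayc y e0.
pose T := Num.max T1 T2.
have T0 : 0 <= T by rewrite le_max T10.
exists (c T), (s - T); split.
- by move=> q; have := busemann_le rayc q T0; have := metric_sym q (c T); lra.
- have := H1 T; rewrite le_max lexx => /(_ isT); have := metric_sym x (c T); lra.
- have := H2 T; rewrite le_max lexx orbT => /(_ isT); have := metric_sym y (c T); lra.
Qed.

Section horo.
Variables (b : X -> R) (delta : R).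
Hypothesis hb : horo_approx b.
Hypothesis hypX : hyperbolic X delta.

Lemma horo_lip x y : `|b x - b y| <= mdist x y.
Proof.
suff H x' y' : b x' - b y' <= mdist x' y'.
  by rewrite ler_norml H andbT; have := H y x; have := metric_sym x y; lra.
apply/ler_addgt0Pr => e e0; have [z [s [H1 _ H2]]] := hb e0 x' y'.
by have := H1 x'; have := metric_triangle x' y' z; lra.
Qed.

(** For b = d(., z) + s: by thinness a point of [x, y] is delta-close to a point
of a geodesic from z to x or to y, where d(., z) is at most its value at the
respective endpoint. *)
Lemma horo_quasiconvex u v c x y t : geodesic_joins u v c x y -> u <= t <= v ->
  b (c t) <= Num.max (b x) (b y) + delta.
Proof.
move=> g utv; apply/ler_addgt0Pr => e e0; have [z [s [H1 H2 H3]]] := hb e0 x y.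
have [d0 geoX thin] := hypX.
have [u1 [v1 [c1 g1]]] := geoX y z; have [u2 [v2 [c2 g2]]] := geoX z x.
have [] := thin x y z (c @` `[u, v]) (c1 @` `[u1, v1]) (c2 @` `[u2, v2]) _ _ _ (c t).
- by exists u, v, c.
- by exists u1, v1, c1.
- by exists u2, v2, c2.
- by exists t.
move=> q' Hq' tq'.
have : mdist q' z <= Num.max (mdist x z) (mdist y z).
  rewrite le_max; case: Hq' => [[r /= + <-]|[r /= + <-]].
    rewrite in_itv/= => /andP[ur rv]; apply/orP; right.
    case: g1 => uv1 gc1 <- <-; rewrite !gc1/= ?in_itv/= ?ur ?rv ?lexx ?uv1//.
    by rewrite !ler0_norm; lra.
  rewrite in_itv/= => /andP[ur rv]; apply/orP; left.
  case: g2 => uv2 gc2 <- <-; rewrite !gc2/= ?in_itv/= ?ur ?rv ?lexx ?uv2//.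
  by rewrite !ger0_norm; lra.
have := H1 (c t); have := metric_triangle (c t) q' z.
rewrite !le_max => h1 h2 /orP[] h3.
  have : b x <= Num.max (b x) (b y) by rewrite le_max lexx.
  lra.
have : b y <= Num.max (b x) (b y) by rewrite le_max lexx orbT.
lra.
Qed.

(** If z is not within h of x, one moves from x towards z by h. Otherwise b grows
with slope 1 away from x, up to an error: x is almost the basepoint of an
element of D(X). *)
Lemma horo_descent h x : 0 < h ->
  (exists2 y, mdist x y <= h & b y <= b x - h / 2) \/
  (forall y, mdist x y <= b y - b x + 3 * h).
Proof.
move=> h0; have h20 : 0 < h / 2 by rewrite divr_gt0.
have [Hd|Hd] := pselect (exists2 y, mdist x y <= h & b y <= b x - h / 2); [by left|right].
move=> y; have [z [s [H1 H2 H3]]] := hb h20 x y.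
have xz : mdist x z < h.
  rewrite ltNge; apply/negP => hxz; apply: Hd.
  have [_ geoX _] := hypX; have [u [v [c [uv gc cu cv]]]] := geoX x z.
  have dxz : mdist x z = v - u.
    by rewrite -cu -cv gc/= ?in_itv/= ?lexx ?uv// ler0_norm ?subr_le0// opprB.
  have u1 : u <= u + h by lra.
  have u2 : u + h <= v by lra.
  exists (c (u + h)).
    by rewrite -cu gc/= ?in_itv/= ?lexx ?uv ?u1//; rewrite ler0_norm; lra.
  have := H1 (c (u + h)).
  rewrite -{1}cv gc/= ?in_itv/= ?lexx ?uv ?u1// ler0_norm ?subr_le0//.
  lra.
have := metric_triangle x z y; have := metric_sym y z; have := horo_lip x z.
have := H1 x; have := mdist_ge0 x z; lra.
Qed.

End horo.
End Busemann.

(** * John chains *)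

Section Chains.
Context {R : realType} {X : pmetricType R}.
Variables (eps delta M : R) (b : X -> R).
Hypotheses (eps0 : 0 < eps) (hb : horo_approx b) (hypX : hyperbolic X delta).
Hypothesis GH : GH_density eps b M.
Local Notation rho := (density eps b).
Local Notation de := (unif_dist eps b).
Implicit Types (x y z q : X).

Let b_lip := horo_lip hb.
Let geoX : geodesic_space X. Proof. by case: hypX. Qed.
Let d0 : 0 <= delta. Proof. by case: hypX. Qed.
Let M0 : 0 < M. Proof. by case: GH => M1 _; apply: lt_le_trans M1. Qed.

Lemma expR_le_rho x t : b x <= t -> expR (- eps * t) <= rho x.
Proof. by move=> bt; rewrite ler_expR !mulNr lerN2 ler_pM2l. Qed.

Lemma rho_le_expR x t : t <= b x -> rho x <= expR (- eps * t).
Proof. by move=> bt; rewrite ler_expR !mulNr lerN2 ler_pM2l. Qed.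

Lemma geodesic_curve u v (c : R -> X) x y : geodesic_joins u v c x y -> is_curve u v c.
Proof.
move=> [uv gc _ _]; split => //; apply/within_continuousP => t ht e e0.
by exists e => // t' ht' tt'; rewrite gc.
Qed.

(** By quasiconvexity of b, rho is at least m e^(-eps delta) on a geodesic from x
to y, which bounds its weighted length from below. *)
Lemma GH_separation x y m : m <= rho x -> m <= rho y -> 0 <= m ->
  m * expR (- (eps * delta)) * mdist x y <= M * de x y.
Proof.
move=> mx my m0; have [u [v [c g]]] := geoX x y.
have W := GH.2 x y u v c g.
have rc : rectifiable u v c.
  apply: (weighted_length_fin (geodesic_curve g)).
  by apply: le_lt_trans W _; rewrite ltry.
have uv := rectifiable_le rc.
have L0 := len_ge0 c uv.
have m'0 : 0 <= m * expR (- (eps * delta)) := mulr_ge0 m0 (expR_ge0 _).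
apply: (@le_trans _ _ (m * expR (- (eps * delta)) * fine (curve_length u v c))).
  rewrite ler_wpM2l//; have := mdist_le_len rc (lexx u) uv (lexx v).
  by case: g => _ _ -> ->.
rewrite -lee_fin; apply: le_trans W.
rewrite (weighted_length_rect _ _ rc); apply: (path_weight_ge b_lip (arc_path_lip rc)) => //.
move=> s /(arc_pathE rc)[t tuv ->].
have H := horo_quasiconvex hb hypX g tuv.
apply: (@le_trans _ _ (expR (- eps * Num.max (b x) (b y)) * expR (- (eps * delta)))).
  rewrite ler_wpM2r ?expR_ge0// /Num.max; case: ifP => _ //.
by rewrite -expRD ler_expR !mulNr -opprD -mulrDr lerN2 ler_pM2l.
Qed.

Definition step (h : R) : rel X := fun p q => mdist p q <= h.

Lemma geodesic_chain h x y : 0 < h -> exists s,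
  [/\ path (step h) x s, last x s = y & forall q, q \in s -> mdist x q <= mdist x y].
Proof.
move=> h0; have [u [v [c [uv gc cu cv]]]] := geoX x y.
have dxy : mdist x y = v - u.
  by rewrite -cu -cv gc/= ?in_itv/= ?lexx ?uv// ler0_norm ?subr_le0// opprB.
suff H n t : u <= t -> t <= v -> v - t <= n%:R * h -> exists s,
    [/\ path (step h) (c t) s, last (c t) s = y &
      forall q, q \in s -> exists2 t', u <= t' <= v & q = c t'].
  have [|s [p l Hs]] := H (Num.truncn ((v - u) / h)).+1 u (lexx u) uv.
    by rewrite -ler_pdivrMr// ltW// truncnS_gt.
  exists s; rewrite -{1 2}cu; split => // q /Hs[t' /andP[ut' tv'] ->].
  rewrite dxy -cu gc/= ?in_itv/= ?lexx ?uv ?ut'//.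
  by rewrite ler0_norm ?subr_le0//; lra.
elim: n t => [|n IH] t ut tv.
  rewrite mul0r subr_le0 => vt; exists [::]; split => //=.
  by rewrite -cv; congr c; apply/eqP; rewrite eq_le tv.
move=> Hn; have [tv'|tv'] := leP (t + h) v.
  have [|||s [p l Hs]] := IH (t + h); first lra.
  - exact: tv'.
  - by move: Hn; rewrite -natr1 mulrDl mul1r; lra.
  exists (c (t + h) :: s); split => //=.
    rewrite p andbT /step gc/= ?in_itv/= ?ut ?tv ?tv'//.
      by rewrite ler0_norm; lra.
    by apply/andP; split; lra.
  move=> q; rewrite inE => /predU1P[->|/Hs//].
  by exists (t + h) => //; apply/andP; split; lra.
exists [:: y]; split => //=.
  rewrite andbT /step -cv gc/= ?in_itv/= ?ut ?tv ?uv ?lexx//.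
  by rewrite ler0_norm ?subr_le0//; lra.
by move=> q; rewrite inE => /eqP ->; exists v => //; rewrite uv lexx.
Qed.

Section fixed_scale.
Variables (h A : R).
Hypotheses (h0 : 0 < h) (A0 : 0 < A).

Definition descent_const := 2 * expR (eps * h) / eps.

Let C10 : 0 < descent_const.
Proof. by rewrite /descent_const divr_gt0// mulr_gt0// expR_gt0. Qed.

(** The second alternative of [horo_descent] at y. *)
Definition terminal y := forall z, mdist y z <= b z - b y + 3 * h.

(** The step has [de]-length at most a multiple of rho x, and rho increases by a
definite factor, since e^(-eps b) does when b decreases by h / 2. *)
Lemma descent_step x y : mdist x y <= h -> b y <= b x - h / 2 ->
  de x y <= descent_const * (rho y - rho x).
Proof.
move=> xy bxy.
apply: le_trans (unif_dist_upper_le eps0 b_lip geoX xy) _.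
have H : rho x * (eps * h / 2) <= rho y - rho x.
  rewrite lerBrDl -{1}[rho x]mulr1 -mulrDr.
  have e2 : 1 + eps * h / 2 <= expR (eps * h / 2) by exact: expR_ge1Dx.
  apply: le_trans (ler_wpM2l (rho_ge0 _ _ _) e2) _.
  rewrite /density -expRD ler_expR; have := ler_wpM2l (ltW eps0) bxy.
  by rewrite mulrBr; lra.
apply: le_trans (ler_wpM2l (ltW C10) H).
rewrite /descent_const le_eqVlt; apply/orP; left; apply/eqP; field.
by rewrite gt_eqF.
Qed.

(** The bounds of [descent_step] telescope along the chain, so the distance from
x to each of its points q is at most a multiple of rho q. *)
Lemma descending_chain tau x : tau - h <= b x -> exists s,
  [/\ path (step h) x s,
      b (last x s) <= tau \/ terminal (last x s) &
      forall q, q \in x :: s -> tau - h <= b q /\ de x q <= descent_const * (rho q - rho x)].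
Proof.
move=> bx.
have base q : q \in x :: [::] -> tau - h <= b q /\ de x q <= descent_const * (rho q - rho x).
  by rewrite inE => /eqP ->; rewrite subrr mulr0 (unif_distxx eps0 b_lip geoX).
have : b x - tau <= (Num.truncn ((b x - tau) / (h / 2))).+1%:R * (h / 2).
  by rewrite -ler_pdivrMr ?divr_gt0// ltW// truncnS_gt.
move: (Num.truncn _).+1 => n.
elim: n x bx base => [|n IH] x bx base.
  by rewrite mul0r subr_le0 => bt; exists [::]; split => //; left.
move=> Hn; have [bt|bt] := leP (b x) tau; first by exists [::]; split => //; left.
have [[y xy bxy]|tx] := horo_descent hb hypX x h0; last by exists [::]; split => //; right.
have by_ : tau - h <= b y.
  by have := b_lip x y; rewrite ler_norml => /andP[]; lra.
have [||s [p l Hs]] := IH y by_.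
- by move=> q; rewrite inE => /eqP ->; rewrite subrr mulr0 (unif_distxx eps0 b_lip geoX).
- by move: Hn; rewrite -natr1 mulrDl mul1r; lra.
exists (y :: s); split => //=; first by rewrite p andbT.
move=> q; rewrite inE => /predU1P[->|qs]; first by apply: base; rewrite inE.
have [h1 h2] := Hs q qs; split => //.
have := descent_step xy bxy; have := unif_dist_triangle eps0 b_lip geoX y x q.
lra.
Qed.

(** A bound for the distance in X between the ends of two descending chains. *)
Definition end_gap := M * expR (eps * delta) * (2 * descent_const * expR (eps * h) + A^-1) + 4 * h.
Definition john_const := (descent_const + expR (eps * end_gap) * end_gap) * expR (eps * end_gap).
Definition john_height := expR (eps * end_gap) * expR (eps * h).

Let D0 : 0 <= end_gap.
Proof.
rewrite addr_ge0 ?mulr_ge0 ?expR_ge0 ?(ltW M0) ?(ltW h0)//.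
by rewrite addr_ge0 ?invr_ge0 ?(ltW A0)// mulr_ge0 ?expR_ge0// mulr_ge0 ?(ltW C10).
Qed.

(** If both ends have reached the level tau, where rho is comparable with r, their
[de]-distance is at most a multiple of r and [GH_separation] applies. If one of
them is terminal, its distance to the other is bounded by the difference of
their levels. *)
Lemma ends_close tau r x0 x y z : expR (- eps * tau) = A * r -> 0 < r -> de x0 x < r ->
  tau - h <= b y -> tau - h <= b z ->
  de x y <= descent_const * rho y -> de x0 z <= descent_const * rho z ->
  (b y <= tau \/ terminal y) -> (b z <= tau \/ terminal z) ->
  mdist y z <= end_gap.
Proof.
move=> Tr r0 x0x by_ bz dy dz Ey Ez.
have h4 : 4 * h <= end_gap.
  rewrite lerDr mulr_ge0 ?mulr_ge0 ?expR_ge0 ?(ltW M0)//.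
  by rewrite addr_ge0 ?invr_ge0 ?(ltW A0)// mulr_ge0 ?expR_ge0// mulr_ge0 ?(ltW C10).
have syz := metric_sym y z.
case: Ey => [ty|ty]; case: Ez => [tz|tz]; last 3 first.
- by have := tz y; lra.
- by have := ty z; lra.
- by have := ty z; have := tz y; have := h0; lra.
set T := A * r in Tr.
have T0 : 0 < T by rewrite mulr_gt0.
have := GH_separation (expR_le_rho ty) (expR_le_rho tz) (expR_ge0 _); rewrite Tr => sep.
have up q : tau - h <= b q -> rho q <= T * expR (eps * h).
  move=> /rho_le_expR /le_trans; apply; rewrite -Tr -expRD ler_expR.
  by rewrite le_eqVlt; apply/orP; left; apply/eqP; ring.
have dyz : de y z <= 2 * descent_const * expR (eps * h) * T + r.
  have t1 := unif_dist_triangle eps0 b_lip geoX x y z.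
  have t2 := unif_dist_triangle eps0 b_lip geoX x0 x z.
  have s1 := unif_dist_sym eps0 b_lip geoX x y.
  have s2 := unif_dist_sym eps0 b_lip geoX x x0.
  have u1 := ler_wpM2l (ltW C10) (up y by_).
  have u2 := ler_wpM2l (ltW C10) (up z bz).
  have -> : 2 * descent_const * expR (eps * h) * T =
    descent_const * (T * expR (eps * h)) + descent_const * (T * expR (eps * h)) by ring.
  lra.
have rE : r = A^-1 * T by rewrite /T mulrA mulVf ?mul1r// gt_eqF.
rewrite rE -mulrDl in dyz.
have {dyz} := le_trans sep (ler_wpM2l (ltW M0) dyz).
rewrite expRN => H; rewrite /end_gap.
have : mdist y z <= M * expR (eps * delta) * (2 * descent_const * expR (eps * h) + A^-1).
  have p0 : 0 < T * (expR (eps * delta))^-1 by rewrite mulr_gt0// invr_gt0 expR_gt0.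
  rewrite -(ler_pM2l p0); apply: le_trans H _.
  rewrite le_eqVlt; apply/orP; left; apply/eqP; field.
  by rewrite (gt_eqF (expR_gt0 _)) (gt_eqF A0).
have := h0; lra.
Qed.

(** The chain from x0 fixes z0; every other chain is continued by a geodesic from
its end to z0, on which all quantities change by bounded factors only. *)
Lemma john_chain tau r x0 : expR (- eps * tau) = A * r -> 0 < r ->
  (forall x, de x0 x < r -> tau <= b x) ->
  exists z0, forall x, de x0 x < r -> exists s,
    [/\ path (step h) x s, last x s = z0 &
      forall q, q \in x :: s -> de x q <= john_const * rho q /\ rho q <= john_height * (A * r)].
Proof.
move=> Tr r0 Hb.
have start x : de x0 x < r -> exists s,
  [/\ path (step h) x s,
      b (last x s) <= tau \/ terminal (last x s) &
      forall q, q \in x :: s -> tau - h <= b q /\ de x q <= descent_const * rho q].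
  move=> /Hb bx; have [|s [p l Hs]] := @descending_chain tau x; first by have := h0; lra.
  exists s; split => // q /Hs[h1 h2]; split => //; apply: le_trans h2 _.
  by rewrite ler_pM2l// gerBl rho_ge0.
have T0 : 0 < A * r by rewrite mulr_gt0.
have [s0 [_ E0 Hs0]] := start x0 (ltac:(by rewrite (unif_distxx eps0 b_lip geoX))).
exists (last x0 s0) => x x0x.
have [s [p E Hs]] := start x x0x.
have [hy dy] := Hs _ (mem_last x s); have [hz dz] := Hs0 _ (mem_last x0 s0).
have yz := ends_close Tr r0 x0x hy hz dy dz E E0.
have [s' [p' l' Hs']] := geodesic_chain (last x s) (last x0 s0) h0.
exists (s ++ s'); split.
- by rewrite cat_path p.
- by rewrite last_cat.
have eD1 : 1 <= expR (eps * end_gap).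
  by rewrite -expR0 ler_expR mulr_ge0// ltW.
have up q : tau - h <= b q -> rho q <= A * r * expR (eps * h).
  move=> /rho_le_expR /le_trans; apply; rewrite -Tr -expRD ler_expR.
  by rewrite le_eqVlt; apply/orP; left; apply/eqP; ring.
have C12 : descent_const <= descent_const + expR (eps * end_gap) * end_gap.
  by rewrite lerDl; apply: mulr_ge0 (expR_ge0 _) D0.
have C12' : descent_const <= john_const.
  apply: (le_trans C12); apply: ler_peMr => //; exact: (le_trans (ltW C10) C12).
have nearx q : mdist (last x s) q <= end_gap ->
    de x q <= john_const * rho q /\ rho q <= john_height * (A * r).
  move=> dq; split.
    have t1 := unif_dist_triangle eps0 b_lip geoX (last x s) x q.
    have t2 := unif_dist_upper_le eps0 b_lip geoX dq.
    have t3 : rho (last x s) <= rho q * expR (eps * end_gap).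
      by apply: (rho_le_dist eps0 b_lip); rewrite metric_sym.
    have C0 : 0 <= descent_const + expR (eps * end_gap) * end_gap by apply: le_trans (ltW C10) C12.
    have := ler_wpM2l C0 t3.
    rewrite /john_const => t4.
    have -> : (descent_const + expR (eps * end_gap) * end_gap) * expR (eps * end_gap) * rho q =
      (descent_const + expR (eps * end_gap) * end_gap) * (rho q * expR (eps * end_gap)) by ring.
    apply: le_trans t4; rewrite mulrDl; lra.
  have t3 := rho_le_dist eps0 b_lip dq.
  apply: le_trans t3 _; rewrite /john_height.
  have := ler_wpM2r (expR_ge0 (eps * end_gap)) (up _ hy).
  by move=> /le_trans; apply; rewrite le_eqVlt; apply/orP; left; apply/eqP; ring.
move=> q; rewrite -cat_cons mem_cat => /orP[/Hs[h1 h2]|/Hs' h1]; last first.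
  by apply: nearx; apply: le_trans h1 yz.
split; first by apply: le_trans h2 _; apply: ler_wpM2r C12'; exact: rho_ge0.
apply: le_trans (up _ h1) _; rewrite /john_height mulrC -mulrA.
by apply: ler_peMl => //; apply: mulr_ge0 (expR_ge0 _) (ltW T0).
Qed.

End fixed_scale.
End Chains.

(** * Nets and measurable cells *)

Section Net.
Context {R : realType} {X : pmetricType R}.
Implicit Types (x y : X) (h : R).

Lemma mball_open x (r : R) : open (ball x r).
Proof.
rewrite openE => y; rewrite ballEmdist /= => xy; apply/nbhs_ballP.
exists (r - mdist x y) => /=; first by rewrite subr_gt0.
move=> z; rewrite !ballEmdist /= => yz; have := metric_triangle x y z; lra.
Qed.

Lemma ball_borel x (r : R) : measurable (ball x r : set (borel X)).
Proof. by apply: sub_sigma_algebra; exact: mball_open. Qed.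

Lemma proper_countable_cover h : proper_space X -> 0 < h ->
  exists q : nat -> X, forall x, exists n, mdist x (q n) < h.
Proof.
move=> pX h0.
have H (k : nat) : exists s : seq X, forall x, mdist point x <= k%:R ->
    exists2 y, y \in s & mdist x y < h.
  have := pX point k%:R; rewrite compact_cover => /(_ X setT (fun y => ball y h)).
  case=> [y _|y _|D _ HD]; [exact: mball_open|by exists y => //; exact: ballxx|].
  exists (finmap.enum_fset D) => x /HD[y yD]; rewrite ballEmdist/= metric_sym => xy.
  by exists y.
have /choice[s Hs] := H.
exists (fun n => if unpickle n is Some (k, j) then nth point (s k) j else point).
move=> x; have [y ys xy] := Hs (Num.truncn (mdist point x)).+1 x (ltW (truncnS_gt _)).
exists (pickle ((Num.truncn (mdist point x)).+1, index y (s (Num.truncn (mdist point x)).+1))).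
by rewrite pickleK nth_index.
Qed.

Section greedy.
Variables (h : R) (q : nat -> X).

(** The indices below n selected by a greedy search for h-separated points. *)
Fixpoint greedy (n : nat) : seq nat :=
  if n is n'.+1 then
    if all (fun m => h <= mdist (q m) (q n')) (greedy n') then n' :: greedy n'
    else greedy n'
  else [::].

Definition selected n := n \in greedy n.+1.

Lemma greedy_lt n m : m \in greedy n -> (m < n)%N.
Proof.
elim: n => //= n IH; case: ifP => _; last by move/IH/leq_trans; apply.
by rewrite inE => /predU1P[->//|/IH/leq_trans]; apply.
Qed.

Lemma greedyP n m : m \in greedy n = (m < n)%N && selected m.
Proof.
elim: n => //= n IH; rewrite ltnS leq_eqVlt.
have [->|mn] /= := eqVneq m n.
  by rewrite /selected /=.
case: ifP => _; last by rewrite IH.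
by rewrite inE (negbTE mn) IH.
Qed.

Lemma selected_sep m n : selected m -> selected n -> m != n ->
  h <= mdist (q m) (q n).
Proof.
wlog mn : m n / (m < n)%N.
  move=> H sm sn mn; have [lt|lt|E] := ltngtP m n; [exact: H| |by rewrite E eqxx in mn].
  by rewrite metric_sym; apply: H => //; rewrite eq_sym.
move=> sm sn _; have mg : m \in greedy n by rewrite greedyP mn.
move: sn; rewrite /selected /=; case: ifP => [/allP/(_ m mg)//|_].
by move/greedy_lt; rewrite ltnn.
Qed.

Lemma selected_cover n : 0 < h -> exists2 m, selected m & mdist (q n) (q m) < h.
Proof.
move=> h0; have [|] := boolP (all (fun m => h <= mdist (q m) (q n)) (greedy n)).
  by move=> H; exists n; rewrite ?mdistxx// /selected /= H mem_head.
move=> /allPn[m]; rewrite greedyP => /andP[_ sm]; rewrite -ltNge metric_sym => ?.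
by exists m.
Qed.

End greedy.

Lemma separated_net h : proper_space X -> 0 < h ->
  exists (q : nat -> X) (N : pred nat),
    (forall m n, N m -> N n -> m != n -> h <= mdist (q m) (q n)) /\
    forall x, exists n, N n && (mdist x (q n) < 2 * h).
Proof.
move=> pX h0; have [q Hq] := proper_countable_cover pX h0.
exists q, (selected h q); split; first exact: selected_sep.
move=> x; have [n xn] := Hq x; have [m sm nm] := selected_cover q n h0.
exists m; rewrite sm/=; have := metric_triangle x (q n) (q m); lra.
Qed.

Section cells.
Variables (h : R) (q : nat -> X) (N : pred nat).
Hypothesis cov : forall x, exists n, N n && (mdist x (q n) < 2 * h).

(** Assigning to x the first net point within 2h partitions X into Borel cells. *)
Definition cell x : nat := ex_minn (cov x).

Lemma cellP x : N (cell x) /\ mdist x (q (cell x)) < 2 * h.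
Proof. by rewrite /cell; case: ex_minnP => n /andP[]. Qed.

Lemma cell_measurable (S : set nat) : measurable (cell @^-1` S : set (borel X)).
Proof.
have c1 n : measurable ([set x | (cell x <= n)%N] : set (borel X)).
  rewrite (_ : [set _ | _] = \bigcup_(m in [set m | (m <= n)%N && N m]) (ball (q m) (2 * h))).
    by apply: bigcup_measurable => m _; exact: ball_borel.
  apply/seteqP; split => x /=.
    move=> xn; exists (cell x); rewrite /= ?xn; first by have [] := cellP x.
    by rewrite ballEmdist/= metric_sym; have [] := cellP x.
  move=> [m /andP[mn Nm]]; rewrite ballEmdist/= metric_sym => xm.
  by rewrite /cell; case: ex_minnP => k _ /(_ m); rewrite Nm xm => /(_ isT)/leq_trans; apply.
rewrite (_ : _ @^-1` _ = \bigcup_(n in S) (cell @^-1` [set n])); last first.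
  by apply/seteqP; split => x /=; [move=> Sx; exists (cell x)|move=> [n Sn /= ->]].
apply: bigcup_measurable => -[|n] _.
  rewrite (_ : _ @^-1` _ = [set x | (cell x <= 0)%N])//.
  by apply/seteqP; split => x /=; rewrite leqn0 => /eqP.
rewrite (_ : _ @^-1` _ = [set x | (cell x <= n.+1)%N] `\` [set x | (cell x <= n)%N]).
  exact: measurableD.
apply/seteqP; split => x /=; first by move=> ->; split => //; rewrite ltnn.
by move=> [h1 /negP]; rewrite -ltnNge => h2; apply/eqP; rewrite eqn_leq h1.
Qed.

End cells.
End Net.

(** * Linearization of the exponent *)

Section Powers.
Context {R : realType}.
Local Open Scope ereal_scope.

(** The right-hand side is linear in a, so that it adds up over balls when a is an
integral of g^p. By homogeneity it reduces to t^(1/p) <= 1 + t. *)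
Lemma poweR_inv_le (p kap : R) (a : \bar R) : (1 <= p)%R -> (0 < kap)%R -> 0 <= a ->
  a `^ p^-1 <= kap%:E + (kap `^ (1 - p))%:E * a.
Proof.
move=> p1 k0; have p0 : (0 < p)%R by rewrite (lt_le_trans ltr01).
have kp0 : (0 < kap `^ (1 - p))%R by exact: powR_gt0.
case: a => [r r0|_|//]; last by rewrite gt0_muley ?lte_fin// addey// leey.
rewrite lee_fin in r0; rewrite poweR_EFin -EFinM -EFinD lee_fin.
pose t := (r / kap `^ p)%R.
have kpp : (0 < kap `^ p)%R by exact: powR_gt0.
have t0 : (0 <= t)%R by rewrite divr_ge0// ltW.
have rE : r = (kap `^ p * t)%R by rewrite /t mulrCA divff ?mulr1// gt_eqF.
have -> : (kap `^ (1 - p) * r = kap * t)%R.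
  rewrite powRB ?(gt_eqF k0) ?implybT// powRr1 ?(ltW k0)// /t; field.
  by rewrite gt_eqF.
rewrite {1}rE powRM ?powR_ge0// -powRrM divff ?gt_eqF// powRr1 ?(ltW k0)//.
rewrite -{2}[kap]mulr1 -mulrDr ler_pM2l//.
have t1 : (1 <= 1 + t)%R by rewrite lerDl.
have pV0 : (0 <= p^-1)%R by rewrite invr_ge0 ltW.
apply: (@le_trans _ _ ((1 + t) `^ p^-1)%R).
  by apply: ge0_ler_powR => //; rewrite ?nnegrE// ?lerDr// (le_trans ler01).
by apply: ler1_powR => //; rewrite invf_le1.
Qed.

(** For k = S^(1/p) both terms equal S^(1/p); if S = 0, k tends to 0. *)
Lemma poweR_optimize (p C : R) (a S : \bar R) : (1 <= p)%R -> (0 < C)%R -> 0 <= S ->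
  (forall k : R, (0 < k)%R -> a <= C%:E * (k%:E + (k `^ (1 - p))%:E * S)) ->
  a <= (2 * C)%:E * S `^ p^-1.
Proof.
move=> p1 C0; have p0 : (0 < p)%R by rewrite (lt_le_trans ltr01).
have pVneq0 : (p^-1 != 0)%R by rewrite gt_eqF ?invr_gt0.
case: S => [s|_ _|//]; last by rewrite poweRyr// gt0_muley ?leey// lte_fin mulr_gt0.
rewrite lee_fin le_eqVlt => /predU1P[<-|s0] H.
  rewrite poweR0r// mule0; apply/lee_addgt0Pr => e e0; rewrite add0e.
  have := H (e / C)%R; rewrite divr_gt0// => /(_ isT).
  by rewrite mule0 adde0 -EFinM mulrCA divff ?mulr1// gt_eqF.
rewrite poweR_EFin; set k := (s `^ p^-1)%R.
have k0 : (0 < k)%R by exact: powR_gt0.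
apply: le_trans (H k k0) _.
rewrite -[leLHS]/((C * (k + k `^ (1 - p) * s))%R%:E) -EFinM lee_fin.
have -> : s = (k `^ p)%R by rewrite /k -powRrM mulVf ?gt_eqF// powRr1// ltW.
rewrite -powRD; last by rewrite (gt_eqF k0) implybT.
rewrite subrK powRr1 ?(ltW k0)// le_eqVlt; apply/orP; left; apply/eqP; ring.
Qed.
End Powers.

Lemma diam_ball_le {R : realType} {Z : pmetricType R} (x : Z) (r : R) : 0 < r ->
  diam (ball x r) <= 2 * r.
Proof.
move=> r0; apply: ge_sup.
  by exists (mdist x x), x; [exact: ballxx|exists x => //; exact: ballxx].
move=> _ [y xy [z xz <-]]; move: xy xz; rewrite !ballEmdist/=.
by have := metric_triangle y x z; have := metric_sym y x; lra.
Qed.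

Lemma diam_ge0 {R : realType} {Z : pmetricType R} (A : set Z) : 0 <= diam A.
Proof.
rewrite /diam; set S := [set _ | _ in _ & _ in _].
have [hs|/sup_out ->//] := pselect (has_sup S).
have [[d Sd] ub] := hs; apply: le_trans (ub_le_sup ub Sd).
by case: Sd => x _ [y _ <-]; exact: mdist_ge0.
Qed.

(** * The linear Poincare inequality on balls of X *)

Section LocalPoincare.
Context {R : realType} {X : pmetricType R}.
Variables (mu : {measure set (borel X) -> \bar R}).
Variables (eps beta : R) (b : X -> R).
Hypotheses (eps0 : 0 < eps) (beta0 : 0 < beta).
Hypothesis b_lip : forall x y, `|b x - b y| <= mdist x y.
Local Notation rho := (density eps b).
Local Notation w := (density beta b).

Let w0 x : 0 <= w x := rho_ge0 beta b x.
Let mw : measurable_fun setT (w : borel X -> R) := rho_borel beta b_lip.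

Definition weighted : {measure set (borel X) -> \bar R} := density_measure mu w0 mw.

Lemma ge0_integral_weighted (f : X -> \bar R) (A : set X) :
  measurable (A : set (borel X)) -> measurable_fun (A : set (borel X)) (f : borel X -> \bar R) ->
  (forall x, 0 <= f x)%E ->
  (\int[weighted]_(x in (A : set (borel X))) f x =
   \int[mu]_(x in (A : set (borel X))) (f x * (w x)%:E))%E.
Proof. by move=> mA mf f0; rewrite /weighted ge0_integral_density. Qed.

Section one_ball.
Variables (p RPI CPI lambda : R).
Hypotheses (p1 : 1 <= p) (PI : locally_poincare mu p RPI lambda CPI).
Variables (f : X -> R) (g : X -> \bar R).
Hypotheses (intf : integrable_on_balls mu f) (g0 : forall x, (0 <= g x)%E).
Hypothesis mg : measurable_fun [set: borel X] (g : borel X -> \bar R).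
Hypothesis ug : upper_gradient f (fun x => g x * (rho x)%:E)%E.
Local Notation G := (fun x => g x * (rho x)%:E)%E.

Let lam1 : 1 <= lambda. Proof. by case: PI => _ []. Qed.
Let CPI0 : 0 < CPI. Proof. by case: PI => _ []. Qed.
Let R0 : 0 < RPI. Proof. by case: PI. Qed.
Let p0 : 0 < p. Proof. by rewrite (lt_le_trans ltr01). Qed.

Let mG : measurable_fun [set: borel X] (G : borel X -> \bar R).
Proof. by case: ug. Qed.
Let G0 x : (0 <= G x)%E. Proof. by case: ug. Qed.

Let mpow (F : X -> \bar R) : measurable_fun [set: borel X] (F : borel X -> \bar R) ->
  measurable_fun [set: borel X] (fun x : borel X => F x `^ p)%E.
Proof. by move=> mF; apply: (measurableT_comp (measurable_poweR p)). Qed.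

Let mlin (k : R) (F : X -> \bar R) : measurable_fun [set: borel X] (F : borel X -> \bar R) ->
  measurable_fun [set: borel X] (fun x : borel X => k%:E + (k `^ (1 - p))%:E * F x `^ p)%E.
Proof.
move=> mF; apply: emeasurable_funD => //; apply: emeasurable_funM => //.
exact: mpow.
Qed.

Let lin_ge0 (k : R) (F : X -> \bar R) x : 0 < k ->
  (0 <= k%:E + (k `^ (1 - p))%:E * F x `^ p)%E.
Proof.
move=> k0; rewrite adde_ge0 ?lee_fin ?(ltW k0)// mule_ge0 ?lee_fin ?powR_ge0//.
exact: poweR_ge0.
Qed.

Local Notation c y s := (fine (average mu (ball y s) (EFin \o f))).

Let mfc y s : measurable_fun [set: borel X] (fun x : borel X => `|f x - c y s|%:E).
Proof.
apply/measurable_EFinP; apply: (measurableT_comp (@normr_measurable _ _)).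
by apply: measurable_funB => //; exact: intf.1.
Qed.

(** The local Poincare inequality combined with [poweR_inv_le] and multiplied by
the mass of the ball, which is at most that of the dilated ball. *)
Lemma unweighted_linear_poincare (y : X) (s kap : R) : 0 < s -> s <= RPI -> 0 < kap ->
  (\int[mu]_(x in (ball y s : set (borel X))) `|f x - c y s|%:E <=
   (2 * s * CPI)%:E *
     \int[mu]_(x in (ball y (lambda * s) : set (borel X))) (kap%:E + (kap `^ (1 - p))%:E * G x `^ p))%E.
Proof.
move=> s0 sR k0; have [_ [mupos _ _ H]] := PI.
have := H y s f G s0 _ intf ug; rewrite lee_fin => /(_ sR) /=.
have ls0 : 0 < lambda * s by rewrite mulr_gt0// (lt_le_trans ltr01).
have /andP[m0 moo] := mupos y s s0; have /andP[m'0 m'oo] := mupos y (lambda * s) ls0.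
have sls : s <= lambda * s by rewrite ler_peMl// ltW.
have mm' : (mu (ball y s : set (borel X)) <= mu (ball y (lambda * s) : set (borel X)))%E.
  by apply: le_measure; rewrite ?inE; [exact: ball_borel|exact: ball_borel|exact: le_ball].
rewrite /average.
set I1 := (X in (_%:E * X <= _)%E); set I2 := (X in (_ <= _ * (_ * X) `^ _)%E).
have I20 : (0 <= I2)%E by apply: integral_ge0 => x _; exact: poweR_ge0.
set m := fine (mu (ball y s)); set m' := fine (mu (ball y (lambda * s))).
have mE : mu (ball y s) = m%:E by rewrite fineK// ge0_fin_numE.
have m'E : mu (ball y (lambda * s)) = m'%:E by rewrite fineK// ge0_fin_numE.
have {}m0 : 0 < m by rewrite -lte_fin -mE.
have {}m'0 : 0 < m' by rewrite -lte_fin -m'E.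
have {}mm' : m <= m' by rewrite -lee_fin -mE -m'E.
move=> H1.
have kp0 : 0 < kap `^ (1 - p) by exact: powR_gt0.
rewrite ge0_integralD//=; last 4 first.
- exact: ball_borel.
- by move=> x _; rewrite lee_fin ltW.
- by move=> x _; rewrite mule_ge0 ?lee_fin ?poweR_ge0// ltW.
- by apply: measurable_funTS; apply: emeasurable_funM => //; exact: mpow.
rewrite integral_cst; last exact: ball_borel.
rewrite ge0_integralZl_EFin; last 4 first.
- exact: ball_borel.
- by move=> x _; exact: poweR_ge0.
- by apply: measurable_funTS; exact: mpow.
- exact: ltW.
rewrite m'E -EFinM -/I2.
have pos : 0 < 2 * s * CPI by rewrite !mulr_gt0.
have H2 : (m^-1%:E * I1 <= (2 * s * CPI)%:E *
    (kap%:E + (kap `^ (1 - p))%:E * (m'^-1%:E * I2)))%E.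
  apply: le_trans H1 _.
  have a0 : (0 <= m'^-1%:E * I2)%E by rewrite mule_ge0// lee_fin invr_ge0 ltW.
  apply: lee_pmul.
  - by rewrite -EFinM lee_fin mulr_ge0 ?diam_ge0// ltW.
  - exact: poweR_ge0.
  - rewrite -EFinM lee_fin mulrC ler_pM2r//; exact: diam_ball_le.
  - exact: poweR_inv_le.
move: I20 H2; case: (I2) => [i2||]//; last first.
  move=> _ _; rewrite [X in (_ <= _ * (_ + X))%E]gt0_muley ?lte_fin// addey//.
  by rewrite gt0_muley ?leey// lte_fin.
rewrite lee_fin => i20; rewrite lee_pdivrMl//.
move=> /le_trans; apply.
rewrite -[leLHS]/((m * (2 * s * CPI * (kap + kap `^ (1 - p) * (m'^-1 * i2))))%:E).
rewrite -[leRHS]/((2 * s * CPI * (kap * m' + kap `^ (1 - p) * i2))%:E) lee_fin.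
rewrite mulrCA ler_pM2l// mulrDr; apply: lerD.
  by rewrite mulrC ler_pM2l.
rewrite mulrCA ler_pM2l// mulrA ler_piMl// ler_pdivrMr ?mul1r//.
Qed.

Definition local_const :=
  2 * CPI * expR (p * (eps * (lambda * RPI))) * expR (beta * (lambda * RPI)) * expR (beta * RPI).

Lemma local_const_gt0 : 0 < local_const.
Proof. by rewrite /local_const !mulr_gt0// expR_gt0. Qed.

(** On the dilated ball rho and w are within bounded factors of their values at
the center. In the unweighted inequality for g rho, the parameter k rho(y)
produces (k rho(y))^(1-p) rho^p, which is comparable with k^(1-p) rho(y); hence
the factor rho y comes out linearly. *)
Lemma weighted_linear_poincare (y : X) (s k : R) : 0 < s -> s <= RPI -> 0 < k ->
  (\int[weighted]_(x in (ball y s : set (borel X))) `|f x - c y s|%:E <=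
   (local_const * s * rho y)%:E *
     \int[weighted]_(x in (ball y (lambda * s) : set (borel X)))
        (k%:E + (k `^ (1 - p))%:E * g x `^ p))%E.
Proof.
move=> s0 sR k0.
have ls0 : 0 < lambda * s by rewrite mulr_gt0// (lt_le_trans ltr01).
have r0 := rho_gt0 eps b y; have wy0 := rho_gt0 beta b y.
have lsR : lambda * s <= lambda * RPI by rewrite ler_pM2l// (lt_le_trans ltr01).
have mB1 := ball_borel y s; have mB2 := ball_borel y (lambda * s).
rewrite ge0_integral_weighted//; last exact: measurable_funTS.
rewrite ge0_integral_weighted//; last 2 first.
- by apply: measurable_funTS; exact: mlin.
- by move=> x; exact: lin_ge0.
have mwE A : measurable_fun (A : set (borel X)) (fun x : borel X => (w x)%:E).
  by apply/measurable_EFinP; exact: measurable_funTS.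
apply: (@le_trans _ _ ((w y * expR (beta * RPI))%:E *
    \int[mu]_(x in (ball y s : set (borel X))) `|f x - c y s|%:E)%E).
  rewrite -ge0_integralZl_EFin//; last 2 first.
  - by apply: measurable_funTS; exact: mfc.
  - by apply: mulr_ge0 (w0 y) (expR_ge0 _).
  apply: ge0_le_integral => //.
  - by move=> x _; rewrite mule_ge0// lee_fin.
  - by apply: emeasurable_funM => //; apply: measurable_funTS; exact: mfc.
  - by apply: emeasurable_funM => //; apply: measurable_funTS; exact: mfc.
  move=> x; rewrite ballEmdist/= => yx; rewrite muleC lee_wpmul2r// lee_fin.
  by apply: (rho_le_dist beta0 b_lip); rewrite ltW// (lt_le_trans yx).
have kap0 : 0 < k * rho y by exact: mulr_gt0.
apply: (@le_trans _ _ ((w y * expR (beta * RPI))%:E * ((2 * s * CPI)%:E *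
   \int[mu]_(x in (ball y (lambda * s) : set (borel X)))
     ((k * rho y)%:E + ((k * rho y) `^ (1 - p))%:E * G x `^ p)))%E).
  rewrite lee_wpmul2l//; first by rewrite lee_fin; apply: mulr_ge0 (w0 y) (expR_ge0 _).
  exact: unweighted_linear_poincare.
pose E1 := expR (p * (eps * (lambda * RPI))).
pose E2 := expR (beta * (lambda * RPI)).
have E10 : 0 < E1 by exact: expR_gt0.
have E20 : 0 < E2 by exact: expR_gt0.
have Q0 : 0 < rho y * E1 * E2 / w y by rewrite divr_gt0// !mulr_gt0.
apply: (@le_trans _ _ ((w y * expR (beta * RPI))%:E * ((2 * s * CPI)%:E *
   ((rho y * E1 * E2 / w y)%:E * \int[mu]_(x in (ball y (lambda * s) : set (borel X)))
     ((k%:E + (k `^ (1 - p))%:E * g x `^ p) * (w x)%:E))))%E); last first.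
  rewrite !muleA -!EFinM le_eqVlt; apply/orP; left; apply/eqP; congr (_%:E * _)%E.
  rewrite /local_const -/E1 -/E2; field.
  by rewrite gt_eqF.
rewrite lee_wpmul2l//; first by rewrite lee_fin; apply: mulr_ge0 (w0 y) (expR_ge0 _).
rewrite lee_wpmul2l//; first by rewrite lee_fin !mulr_ge0// ltW.
rewrite -ge0_integralZl_EFin//; last 3 first.
- by move=> x _; rewrite mule_ge0 ?lin_ge0// lee_fin.
- by apply: emeasurable_funM => //; apply: measurable_funTS; exact: mlin.
- exact: ltW.
apply: ge0_le_integral => //.
- by move=> x _; exact: (lin_ge0 G x kap0).
- by apply: measurable_funTS; exact: (mlin (k * rho y) mG).
- by apply: emeasurable_funM => //; apply: emeasurable_funM => //; apply: measurable_funTS; exact: mlin.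
move=> x; rewrite ballEmdist/= => yx.
have yx' : mdist y x <= lambda * RPI by rewrite ltW// (lt_le_trans yx).
have rx : rho x <= rho y * expR (eps * (lambda * RPI)) := rho_le_dist eps0 b_lip yx'.
have wx : w y / E2 <= w x.
  by have := rho_ge_dist beta0 b_lip yx'; rewrite expRN.
have gp0 : (0 <= g x `^ p)%E by exact: poweR_ge0.
have kp0 : 0 < k `^ (1 - p) by exact: powR_gt0.
apply: (@le_trans _ _ ((rho y * E1)%:E * (k%:E + (k `^ (1 - p))%:E * g x `^ p))%E).
  rewrite ge0_muleDr ?lee_fin ?(ltW k0)//; last by rewrite mule_ge0// lee_fin ltW.
  apply: leeD.
    rewrite -EFinM lee_fin -mulrA mulrC ler_pM2l// ler_peMl ?(ltW k0)//.
    by rewrite -expR0 ler_expR !mulr_ge0// ltW// (lt_le_trans ltr01).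
  rewrite poweRM ?lee_fin ?(rho_ge0 eps b x)// poweR_EFin muleA [X in (X <= _)%E]muleAC -EFinM.
  rewrite [X in (_ <= X)%E]muleA lee_wpmul2r// -EFinM lee_fin.
  have h1 : rho x `^ p <= (rho y * expR (eps * (lambda * RPI))) `^ p.
    by apply: ge0_ler_powR => //; rewrite ?nnegrE ?(ltW p0) ?(rho_ge0 eps b x)//;
      apply: mulr_ge0 (rho_ge0 eps b y) (expR_ge0 _).
  apply: le_trans (ler_wpM2l (powR_ge0 _ _) h1) _.
  rewrite powRM ?(ltW k0) ?(ltW r0)// powRM ?(ltW r0) ?expR_ge0//.
  have -> : expR (eps * (lambda * RPI)) `^ p = E1.
    by rewrite /powR gt_eqF ?expR_gt0// expRK.
  have r1 : rho y `^ (1 - p) * rho y `^ p = rho y.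
    by rewrite -powRD ?(gt_eqF r0) ?implybT// subrK powRr1// ltW.
  rewrite -[X in _ <= X * _ * _]r1 le_eqVlt; apply/orP; left; apply/eqP; ring.
rewrite muleC [X in (_ <= X)%E]muleCA lee_wpmul2l ?lin_ge0// -EFinM lee_fin.
have h2 : 1 <= E2 / w y * w x.
  have := ler_wpM2l (ltW (divr_gt0 E20 wy0)) wx.
  by rewrite (_ : E2 / w y * (w y / E2) = 1)//; field; rewrite !gt_eqF.
have -> : rho y * E1 * E2 / w y * w x = rho y * E1 * (E2 / w y * w x) by ring.
by rewrite ler_peMr// ltW// mulr_gt0.
Qed.

End one_ball.
End LocalPoincare.

(** * Doubling at the scale of X *)

Section Doubling.
Context {R : realType}.
Variable Cd : R.
Hypothesis Cd1 : 1 <= Cd.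

(** 2^n >= K for n = truncn K + 1, so n doublings reach the scale K. *)
Definition dbl_const (K : R) := Cd ^+ (Num.truncn K).+1.

Lemma dbl_const_ge1 K : 1 <= dbl_const K. Proof. exact: exprn_ege1. Qed.

Lemma dbl_const_gt0 K : 0 < dbl_const K.
Proof. exact: lt_le_trans ltr01 (dbl_const_ge1 K). Qed.

Lemma doubling_scale (V : R -> \bar R) : (forall r s : R, r <= s -> (V r <= V s)%E) ->
  (forall r : R, 0 < r -> (V (2 * r)%R <= Cd%:E * V r)%E) ->
  forall K r : R, 0 < r -> (V (K * r)%R <= (dbl_const K)%:E * V r)%E.
Proof.
move=> V_nd V_dbl K r r0.
have iter n : (V (2 ^+ n * r)%R <= (Cd ^+ n)%:E * V r)%E.
  elim: n => [|n IH]; first by rewrite !expr0 mul1r mul1e.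
  rewrite !exprS -mulrA; apply: le_trans (V_dbl _ _) _; first by rewrite mulr_gt0// exprn_gt0.
  by rewrite EFinM -muleA lee_wpmul2l// lee_fin (le_trans ler01).
apply: le_trans (iter (Num.truncn K).+1); apply: V_nd.
rewrite ler_pM2r//; apply: ltW; apply: lt_le_trans (truncnS_gt K) _.
by rewrite -natrX ler_nat ltnW// ltn_expl.
Qed.

End Doubling.

Section DoublingScales.
Context {R : realType} {X : pmetricType R}.
Variables (eps : R) (b : X -> R).
Hypotheses (eps0 : 0 < eps) (b_lip : forall x y, `|b x - b y| <= mdist x y).
Hypothesis geoX : geodesic_space X.
Local Notation rho := (density eps b).
Local Notation de := (unif_dist eps b).
Variables (mb : {measure set (borel X) -> \bar R}) (Cd : R).

(** Balls of the uniformization, as subsets of X. *)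
Definition uball (x : X) (r : R) : set X := [set y | de x y < r].

Hypothesis Cd1 : 1 <= Cd.
Hypothesis mb_dbl : forall x r, 0 < r -> (mb (uball x (2 * r)) <= Cd%:E * mb (uball x r))%E.

Lemma uball_borel x r : measurable (uball x r : set (borel X)).
Proof.
have H (Z : pmetricType R) (h : X -> Z) :
    (forall x y, mdist (h x) (h y) = de x y) -> measurable (uball x r : set (borel X)).
  move=> h_iso; apply: sub_sigma_algebra.
  have -> : uball x r = h @^-1` (ball (h x) r).
    by apply/seteqP; split => y; rewrite /= ballEmdist/= h_iso.
  by have /continuousP := embed_continuous eps0 b_lip geoX h_iso; apply; exact: mball_open.
apply: (H (uniformized eps b) id) => x' y'.
exact: (mdist_metrized _ _ (unif_dist_is_metric eps0 b_lip geoX)).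
Qed.

Lemma le_uball x r s : r <= s -> uball x r `<=` uball x s.
Proof. by move=> rs y /= /lt_le_trans; apply. Qed.

Lemma ball_sub_uball y s : 0 < s -> ball y s `<=` uball y (rho y * (2 * s * expR (eps * s))).
Proof.
move=> s0 z; rewrite ballEmdist/= => /ltW yz.
apply: le_lt_trans (unif_dist_upper_le eps0 b_lip geoX yz) _.
have p0 : 0 < rho y * expR (eps * s) * s.
  by apply: mulr_gt0 s0; exact: mulr_gt0 (rho_gt0 eps b y) (expR_gt0 _).
have -> : rho y * (2 * s * expR (eps * s)) = 2 * (rho y * expR (eps * s) * s) by ring.
by rewrite ltr_pMl// ltr1n.
Qed.

Lemma uball_sub_ball y s : 0 < s -> uball y (rho y * (s * expR (- (eps * s)))) `<=` ball y s.
Proof.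
move=> s0 z /= yz; rewrite ballEmdist/= ltNge; apply/negP => syz.
have := unif_dist_lower eps0 b_lip geoX (ltW s0) syz.
by rewrite -mulrA [_ * s]mulrC leNgt yz.
Qed.

Lemma uball_scale x r K : 0 < r -> (mb (uball x (K * r)) <= (dbl_const Cd K)%:E * mb (uball x r))%E.
Proof.
apply: (doubling_scale Cd1 (V := fun r => mb (uball x r))) => // [s t st|s s0]; last exact: mb_dbl.
by apply: le_measure; rewrite ?inE; [exact: uball_borel..|exact: le_uball].
Qed.

(** A ball of radius s contains the uniformized ball whose radius is
s e^(-eps s) times rho at the center ([uball_sub_ball]). *)
Definition scale_const (K s : R) := dbl_const Cd (K / (s * expR (- (eps * s)))).

Lemma uball_le_ball y s K : 0 < s ->
  (mb (uball y (K * rho y)) <= (scale_const K s)%:E * mb (ball y s : set (borel X)))%E.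
Proof.
move=> s0; have e0 : 0 < s * expR (- (eps * s)) := mulr_gt0 s0 (expR_gt0 _).
have r0 : 0 < rho y * (s * expR (- (eps * s))) := mulr_gt0 (rho_gt0 eps b y) e0.
have -> : K * rho y = K / (s * expR (- (eps * s))) * (rho y * (s * expR (- (eps * s)))).
  field; by rewrite (gt_eqF s0) (gt_eqF (expR_gt0 _)).
apply: le_trans (uball_scale _ _ r0) _; rewrite lee_wpmul2l//.
  by rewrite lee_fin ltW// dbl_const_gt0.
by apply: le_measure; rewrite ?inE; [exact: uball_borel|exact: ball_borel|exact: uball_sub_ball].
Qed.

Definition cmp_const (s1 s2 : R) := scale_const (2 * (2 * s1) * expR (eps * (2 * s1))) s2.

Lemma cmp_const_ge1 s1 s2 : 1 <= cmp_const s1 s2. Proof. exact: dbl_const_ge1. Qed.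

Lemma ball_le_ball x y s1 s2 : 0 < s1 -> 0 < s2 -> mdist x y <= s1 ->
  (mb (ball x s1 : set (borel X)) <= (cmp_const s1 s2)%:E * mb (ball y s2 : set (borel X)))%E.
Proof.
move=> s10 s20 xy; apply: le_trans (uball_le_ball _ _ s20).
apply: le_measure; rewrite ?inE; [exact: ball_borel|exact: uball_borel|].
apply: (@subset_trans _ (ball y (2 * s1))).
  move=> z; rewrite !ballEmdist/= => xz; have := metric_triangle y x z.
  have := metric_sym x y; lra.
by rewrite [_ * rho y]mulrC; apply: ball_sub_uball; rewrite mulr_gt0.
Qed.

End DoublingScales.

(** * John chains in a net *)

Section NetChains.
Context {R : realType} {X : pmetricType R}.
Variables (eps delta M : R) (b : X -> R).
Hypotheses (eps0 : 0 < eps) (hb : horo_approx b) (hypX : hyperbolic X delta).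
Hypothesis GH : GH_density eps b M.
Local Notation rho := (density eps b).
Local Notation de := (unif_dist eps b).
Let b_lip := horo_lip hb.
Let geoX : geodesic_space X. Proof. by case: hypX. Qed.

Variables (h A : R) (q : nat -> X) (N : pred nat).
Hypotheses (h0 : 0 < h) (A0 : 0 < A).
Hypothesis cov : forall x, exists n, N n && (mdist x (q n) < 2 * h).

(** Points at distance at least 1 in X are at [de]-distance at least a multiple of
rho x; for closer points rho is comparable anyway. *)
Lemma rho_le_unif x y C : 0 <= C -> de x y <= C * rho y ->
  rho x <= expR eps * (1 + C) * rho y.
Proof.
move=> C0 xy; have r0 := rho_gt0 eps b y.
have [d1|/ltW d1] := leP (mdist x y) 1.
  apply: (@le_trans _ _ (rho y * expR (eps * 1))).
    by apply: (rho_le_dist eps0 b_lip); rewrite metric_sym.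
  rewrite mulr1 mulrC ler_wpM2r ?(ltW r0)// ler_peMr ?expR_ge0//; lra.
have := unif_dist_lower eps0 b_lip geoX ler01 d1.
rewrite !mulr1 expRN => H; have {}H := le_trans H xy.
rewrite ler_pdivrMr ?expR_gt0// in H; apply: le_trans H _.
rewrite mulrC -mulrA; apply: ler_wpM2l; first exact: expR_ge0.
by apply: ler_wpM2r; [exact: ltW|lra].
Qed.

Local Notation C2 := (john_const eps delta M h A).
Local Notation C3 := (john_height eps delta M h A).

Definition chain_const := (expR eps * (1 + C2) * (4 * h * expR (eps * (4 * h))) + C2
  + 2 * h * expR (eps * (2 * h))) * expR (eps * (2 * h)).
Definition chain_height := expR (eps * (2 * h)) * (C3 * A).

Lemma john_const_ge0 : 0 <= C2.
Proof.
have M0 : 0 <= M by case: GH => M1 _; rewrite (le_trans ler01).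
have e0 (t : R) : 0 <= expR t by exact: expR_ge0.
have c1 : 0 <= descent_const eps h by rewrite /descent_const divr_ge0 ?mulr_ge0// ltW.
have d0 : 0 <= end_gap eps delta M h A.
  rewrite /end_gap; apply: addr_ge0; last by rewrite mulr_ge0// ltW.
  apply: mulr_ge0; first exact: mulr_ge0.
  by apply: addr_ge0; [exact: mulr_ge0 (mulr_ge0 (ler0n _ 2) c1) (e0 _)|rewrite invr_ge0 ltW].
by rewrite /john_const; apply: mulr_ge0 (e0 _); apply: addr_ge0 c1 _; exact: mulr_ge0.
Qed.

(** The chains of [john_chain], projected to the net by the cell map and with
loops removed: without repetitions, a sum over a chain is at most a sum over the
net. All points of a cell use the same chain, so the distance bound holds for
each of them. *)
Lemma net_chain x0 r : 0 < r -> (forall x, de x0 x < r -> rho x <= A * r) ->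
  exists n0, forall n, (exists2 x, de x0 x < r & cell cov x = n) ->
  exists p, [/\ path (fun m m' => mdist (q m) (q m') <= 5 * h) n p, last n p = n0,
    uniq (n :: p) &
    forall m, m \in n :: p -> [/\ N m, rho (q m) <= chain_height * r &
      forall x', de x0 x' < r -> cell cov x' = n -> de (q m) x' <= chain_const * rho (q m)]].
Proof.
move=> r0 Hr; have T0 : 0 < A * r by rewrite mulr_gt0.
pose tau := - ln (A * r) / eps.
have tauE : expR (- eps * tau) = A * r.
  rewrite /tau (_ : - eps * (- ln (A * r) / eps) = ln (A * r)) ?lnK ?posrE//.
  by field; rewrite gt_eqF.
have Hb x : de x0 x < r -> tau <= b x.
  move=> /Hr; rewrite -tauE /density ler_expR !mulNr lerN2 ler_pM2l//.
have [z0 Hz] := john_chain eps0 hb hypX GH h0 A0 tauE r0 Hb.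
exists (cell cov z0) => n [x x0x <-].
have [s [ps ls Hs]] := Hz x x0x.
have pp : path (fun m m' => mdist (q m) (q m') <= 5 * h) (cell cov x) (map (cell cov) s).
  elim: s x ps {Hs ls x0x} => //= y s IH x /andP[xy /IH ->]; rewrite andbT.
  have [_ h1] := cellP cov x; have [_ h2] := cellP cov y.
  have := metric_triangle (q (cell cov x)) x (q (cell cov y)).
  have := metric_triangle x y (q (cell cov y)).
  have := metric_sym x (q (cell cov x)); rewrite /step in xy; lra.
move: (last_map (cell cov) s x); rewrite ls => lm.
have memm m : m \in map (cell cov) (x :: s) -> [/\ N m, rho (q m) <= chain_height * r &
      forall x', de x0 x' < r -> cell cov x' = cell cov x -> de (q m) x' <= chain_const * rho (q m)].
  move=> /mapP[y ys ->]; have [Ny dy] := cellP cov y; set m' := cell cov y in Ny dy *.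
  have [xy ry] := Hs y ys.
  have e2 : 0 < expR (eps * (2 * h)) by exact: expR_gt0.
  have rq : rho (q m') <= rho y * expR (eps * (2 * h)) := rho_le_dist eps0 b_lip (ltW dy).
  have ryq : rho y <= rho (q m') * expR (eps * (2 * h)).
    by apply: (rho_le_dist eps0 b_lip); rewrite metric_sym ltW.
  split => //.
    apply: le_trans rq _; rewrite /chain_height mulrC -mulrA ler_pM2l//.
    by apply: le_trans ry _; rewrite mulrA.
  move=> x' x0x' cx'; have [_ dx] := cellP cov x; have [_ dx'] := cellP cov x'.
  rewrite cx' in dx'.
  have xx' : mdist x x' <= 4 * h.
    have := metric_triangle x (q (cell cov x)) x'.
    have := metric_sym x' (q (cell cov x)); lra.
  have t1 := unif_dist_upper_le eps0 b_lip geoX xx'.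
  have t2 := rho_le_unif john_const_ge0 xy.
  have t3 := unif_dist_upper_le eps0 b_lip geoX (ltW dy).
  have s1 := unif_dist_triangle eps0 b_lip geoX y (q m') x'.
  have s2 := unif_dist_triangle eps0 b_lip geoX x y x'.
  have s3 := unif_dist_sym eps0 b_lip geoX x y.
  have s4 := unif_dist_sym eps0 b_lip geoX y (q m').
  have e4 : 0 <= 4 * h * expR (eps * (4 * h)).
    by apply: mulr_ge0 (expR_ge0 _); rewrite mulr_ge0// ltW.
  have t1' : rho x * expR (eps * (4 * h)) * (4 * h) <=
      expR eps * (1 + C2) * (4 * h * expR (eps * (4 * h))) * rho y.
    have := ler_wpM2r e4 t2; rewrite !mulrA; lra.
  have c0 : 0 <= expR eps * (1 + C2) * (4 * h * expR (eps * (4 * h))) + C2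
      + 2 * h * expR (eps * (2 * h)).
    apply: addr_ge0; last by apply: mulr_ge0 (expR_ge0 _); rewrite mulr_ge0// ltW.
    apply: addr_ge0 john_const_ge0; apply: mulr_ge0 e4; apply: mulr_ge0 (expR_ge0 _) _.
    by have := john_const_ge0; lra.
  have := ler_wpM2l c0 ryq; rewrite /chain_const.
  have -> : (expR eps * (1 + C2) * (4 * h * expR (eps * (4 * h))) + C2
      + 2 * h * expR (eps * (2 * h))) * expR (eps * (2 * h)) * rho (q m') =
    (expR eps * (1 + C2) * (4 * h * expR (eps * (4 * h))) + C2
      + 2 * h * expR (eps * (2 * h))) * (rho (q m') * expR (eps * (2 * h))) by ring.
  apply: le_trans; rewrite 2!mulrDl.
  have -> : 2 * h * expR (eps * (2 * h)) * rho y = rho y * expR (eps * (2 * h)) * (2 * h) by ring.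
  lra.
case: (shortenP pp) lm memm => p' pp' up' sub lm memm.
exists p'; split => // m; rewrite inE => /predU1P[->|/sub mp].
  by apply: memm; rewrite mem_head.
by apply: memm; rewrite inE mp orbT.
Qed.

End NetChains.

Lemma sum_uniq_le_nneseries {R : realType} (l : seq nat) (u : nat -> \bar R) : uniq l ->
  (forall m, 0 <= u m)%E -> (\sum_(m <- l) u m <= \sum_(m <oo) u m)%E.
Proof.
move=> ul u0; pose K := (\max_(m <- l) m).+1.
have lK m : m \in l -> (m < K)%N by move=> ml; rewrite ltnS; exact: leq_bigmax_seq.
apply: (@le_trans _ _ (\sum_(0 <= m < K) u m)%E); last exact: nneseries_lim_ge.
have -> : (\sum_(m <- l) u m = \sum_(0 <= m < K | m \in l) u m)%E.
  rewrite -[RHS]big_filter; apply: perm_big; apply: uniq_perm => //.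
    by rewrite filter_uniq// iota_uniq.
  move=> m; rewrite mem_filter mem_index_iota/=.
  by case: (boolP (m \in l)) => //= /lK ->.
by rewrite [leRHS](bigID (mem l))/= leeDl// sume_ge0.
Qed.

(** * Summation over chains *)

Section NetSums.
Context {R : realType} {X : pmetricType R}.
Variables (eps delta M : R) (b : X -> R).
Hypotheses (eps0 : 0 < eps) (hb : horo_approx b) (hypX : hyperbolic X delta).
Hypothesis GH : GH_density eps b M.
Local Notation rho := (density eps b).
Local Notation de := (unif_dist eps b).
Let b_lip := horo_lip hb.
Let geoX : geodesic_space X. Proof. by case: hypX. Qed.

Variables (mb : {measure set (borel X) -> \bar R}) (Cd : R).
Hypothesis Cd1 : 1 <= Cd.
Hypothesis mb_dbl : forall x r, 0 < r ->
  (mb (uball eps b x (2 * r)) <= Cd%:E * mb (uball eps b x r))%E.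
Hypothesis mb_pos : forall x r, 0 < r -> (0 < mb (ball x r : set (borel X)) < +oo)%E.

Variables (h T : R) (q : nat -> X) (N : pred nat).
Hypotheses (h0 : 0 < h) (hT : h <= T).
Hypothesis sep : forall m n, N m -> N n -> m != n -> h <= mdist (q m) (q n).
Hypothesis cov : forall x, exists n, N n && (mdist x (q n) < 2 * h).

Local Notation cmp := (cmp_const eps Cd).

Let T0 : 0 < T. Proof. exact: lt_le_trans hT. Qed.

(** The balls of radius h / 2 about the net points near x are disjoint, lie in one
ball about x, and have measure comparable with it. *)
Lemma bounded_overlap x :
  (\sum_(m <oo) (if N m && (mdist (q m) x < T)%R then 1 else 0 : \bar R) <=
   (cmp (2 * T) (h / 2))%:E)%E.
Proof.
pose C := cmp (2 * T) (h / 2).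
pose S m := N m && (mdist (q m) x < T)%R.
pose F m : set (borel X) := if S m then ball (q m) (h / 2) else set0.
have mF m : measurable (F m) by rewrite /F; case: ifP => // _; exact: ball_borel.
have T20 : 0 < 2 * T by rewrite mulr_gt0.
have h20 : 0 < h / 2 by rewrite divr_gt0.
have tF : trivIset setT F.
  apply/trivIsetP => i j _ _ ij; rewrite /F.
  case: ifPn => Si; last by rewrite set0I.
  case: ifPn => Sj; last by rewrite setI0.
  apply/seteqP; split => // y []; rewrite !ballEmdist/= => yi yj.
  have /andP[Ni _] := Si; have /andP[Nj _] := Sj.
  have := sep Ni Nj ij; have := metric_triangle (q i) y (q j).
  have := metric_sym y (q j); lra.
have sub : \bigcup_m F m `<=` ball x (2 * T).
  move=> y [m _]; rewrite /F; case: ifP => // /andP[_ xm]; rewrite !ballEmdist/= => my.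
  have := metric_triangle x (q m) y; have := metric_sym x (q m); have := h0; have := hT; lra.
have /andP[V0 Voo] := mb_pos x T20.
have VE : mb (ball x (2 * T)) = (fine (mb (ball x (2 * T))))%:E by rewrite fineK// ge0_fin_numE.
set V := fine _ in VE; rewrite VE lte_fin in V0.
have C0 : 0 < C by exact: lt_le_trans ltr01 (cmp_const_ge1 _ _ _ _).
have H : (\sum_(m <oo) (V%:E * (if S m then 1 else 0)) <= \sum_(m <oo) (C%:E * mb (F m)))%E.
  apply: lee_nneseries => m _; rewrite /F; case: ifPn => Sm.
  - by rewrite mule1 lee_fin ltW.
  - by rewrite mule0.
  - have /andP[_ xm] := Sm; rewrite mule1 -VE.
    apply: (ball_le_ball eps0 b_lip geoX Cd1 mb_dbl) => //.
    by rewrite metric_sym; have := T0; lra.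
  - by rewrite mule0 measure0 mule0.
rewrite nneseriesZl in H; last by move=> i _; case: ifP.
rewrite nneseriesZl in H; last by [].
have H2 : (\sum_(m <oo) mb (F m) <= V%:E)%E.
  have -> : (\sum_(m <oo) mb (F m) = mb (\bigcup_m F m))%E.
    by rewrite measure_bigcup//; apply: eq_eseriesl => i; rewrite in_setT.
  rewrite -VE; apply: le_measure; rewrite ?inE; [|exact: ball_borel|exact: sub].
  exact: bigcup_measurable.
rewrite -(@lee_pmul2l _ V%:E)//; apply: le_trans H _.
by rewrite muleC lee_wpmul2r// lee_fin ltW.
Qed.

Variables (f : X -> R) (F : X -> \bar R) (c : X -> R) (CL : R).
Hypotheses (mf : measurable_fun [set: borel X] (f : borel X -> R)).
Hypotheses (mF : measurable_fun [set: borel X] (F : borel X -> \bar R)).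
Hypotheses (F0 : forall x, (0 <= F x)%E) (CL0 : 0 < CL).
Hypothesis LPI : forall y,
  (\int[mb]_(x in (ball y (8 * h) : set (borel X))) `|f x - c y|%:E <=
   (CL * rho y)%:E * \int[mb]_(x in (ball y T : set (borel X))) F x)%E.

(** [net_osc m] bounds the oscillation of f near the net point q m, and
[net_mean_osc m] is the corresponding mean. *)
Definition net_osc m := ((CL * rho (q m))%:E * \int[mb]_(x in (ball (q m) T : set (borel X))) F x)%E.
Definition net_mass m := fine (mb (ball (q m) (2 * h))).
Definition net_mean_osc m := ((net_mass m)^-1%:E * net_osc m)%E.

Let net_massE m : mb (ball (q m) (2 * h)) = (net_mass m)%:E.
Proof.
by rewrite fineK// ge0_fin_numE//; case/andP: (mb_pos (q m) (mulr_gt0 (ltr0n _ 2) h0)).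
Qed.

Let net_mass0 m : 0 < net_mass m.
Proof. by rewrite -lte_fin -net_massE; case/andP: (mb_pos (q m) (mulr_gt0 (ltr0n _ 2) h0)). Qed.

Let net_osc0 m : (0 <= net_osc m)%E.
Proof.
rewrite mule_ge0 ?integral_ge0// lee_fin mulr_ge0 ?(ltW CL0)//; exact: rho_ge0.
Qed.

Let net_mean_osc0 m : (0 <= net_mean_osc m)%E.
Proof. by rewrite mule_ge0// lee_fin invr_ge0 ltW. Qed.

Let mfc y : measurable_fun [set: borel X] (fun x : borel X => `|f x - y|%:E).
Proof.
apply/measurable_EFinP; apply: (measurableT_comp (@normr_measurable _ _)).
exact: measurable_funB.
Qed.

Local Notation CV := (cmp (5 * h) (2 * h)).

Let CV1 : 1 <= CV. Proof. exact: cmp_const_ge1. Qed.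

(** Both averages are compared with f on the ball of radius 2h about q m, which is
contained in the balls of radius 8h about q m and q m'. *)
Lemma adjacent_averages m m' : mdist (q m) (q m') <= 5 * h ->
  (`|c (q m) - c (q m')|%:E <= CV%:E * (net_mean_osc m + net_mean_osc m'))%E.
Proof.
move=> mm'; have h20 : 0 < 2 * h by rewrite mulr_gt0.
have mB : measurable (ball (q m) (2 * h) : set (borel X)) by exact: ball_borel.
have H : (`|c (q m) - c (q m')|%:E * (net_mass m)%:E <= net_osc m + net_osc m')%E.
  rewrite -net_massE -integral_cst//.
  apply: (@le_trans _ _ (\int[mb]_(x in (ball (q m) (2 * h) : set (borel X)))
     (`|f x - c (q m)|%:E + `|f x - c (q m')|%:E))%E).
    apply: ge0_le_integral => //.
    - by move=> x _; rewrite lee_fin.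
    - by apply: emeasurable_funD; apply: measurable_funTS; exact: mfc.
    - move=> x _; rewrite -EFinD lee_fin.
      rewrite (_ : c (q m) - c (q m') = (f x - c (q m')) - (f x - c (q m))); last by ring.
      by apply: le_trans (ler_normB _ _) _; rewrite addrC.
  rewrite ge0_integralD//; last 2 first.
  - by apply: measurable_funTS; exact: mfc.
  - by apply: measurable_funTS; exact: mfc.
  have sub y : ball (q m) (2 * h) `<=` ball y (8 * h) ->
     (\int[mb]_(x in (ball (q m) (2 * h) : set (borel X))) `|f x - c y|%:E <=
      \int[mb]_(x in (ball y (8 * h) : set (borel X))) `|f x - c y|%:E)%E.
    move=> s; apply: ge0_subset_integral => //; first exact: ball_borel.
    by apply: measurable_funTS; exact: mfc.
  apply: leeD; apply: le_trans (sub _ _) (LPI _).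
  - by move=> x; rewrite !ballEmdist/=; have := h0; lra.
  - move=> x; rewrite !ballEmdist/=; have := metric_triangle (q m') (q m) x.
    by have := metric_sym (q m) (q m'); have := h0; lra.
have V' : net_mass m' <= CV * net_mass m.
  rewrite -lee_fin EFinM -!net_massE.
  apply: (@le_trans _ _ (mb (ball (q m') (5 * h) : set (borel X)))).
    apply: le_measure; rewrite ?inE; [exact: ball_borel..|].
    by move=> x; rewrite !ballEmdist/=; have := h0; lra.
  apply: (ball_le_ball eps0 b_lip geoX Cd1 mb_dbl) => //; first by rewrite mulr_gt0.
  by rewrite metric_sym.
have Vi : (net_mass m)^-1 <= CV / net_mass m'.
  rewrite -[leLHS]mul1r ler_pdivlMr// mulrAC mul1r ler_pdivrMr//.
have C0 : 0 < CV by exact: lt_le_trans ltr01 CV1.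
apply: (@le_trans _ _ ((net_mass m)^-1%:E * (net_osc m + net_osc m'))%E).
  by rewrite lee_pdivlMl// muleC.
rewrite ge0_muleDr// [leRHS]ge0_muleDr//; apply: leeD.
  rewrite -/(net_mean_osc m) -{1}[net_mean_osc m]mul1e lee_wpmul2r// lee_fin//.
by rewrite /net_mean_osc [leRHS]muleA -EFinM lee_wpmul2r// lee_fin.
Qed.

Lemma chain_averages n p : path (fun m m' => mdist (q m) (q m') <= 5 * h) n p ->
  (`|c (q n) - c (q (last n p))|%:E <= (2 * CV)%:E * \sum_(m <- n :: p) net_mean_osc m)%E.
Proof.
have C0 : 0 < CV by exact: lt_le_trans ltr01 CV1.
move=> pp; apply: (@le_trans _ _ (CV%:E * (net_mean_osc n + 2%:E * \sum_(m <- p) net_mean_osc m))%E); last first.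
  rewrite big_cons EFinM -[leRHS]muleA [leRHS]muleCA lee_wpmul2l ?lee_fin ?(ltW C0)//.
  rewrite ge0_muleDr ?sume_ge0// leeD2r//.
  by rewrite -{1}[net_mean_osc n]mul1e lee_wpmul2r// lee_fin ler1n.
elim: p n pp => [|m p IH] n /=.
  by move=> _; rewrite subrr normr0 mule_ge0 ?lee_fin ?(ltW C0)// adde_ge0// mule_ge0// sume_ge0.
move=> /andP[/adjacent_averages nm /IH H].
apply: (@le_trans _ _ (`|c (q n) - c (q m)|%:E + `|c (q m) - c (q (last m p))|%:E)%E).
  rewrite -EFinD lee_fin (_ : c (q n) - _ = (c (q n) - c (q m)) + (c (q m) - c (q (last m p)))).
    exact: ler_normD.
  by ring.
apply: le_trans (leeD nm H) _.
rewrite -ge0_muleDr; last 2 first.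
- by rewrite adde_ge0.
- by rewrite adde_ge0// mule_ge0// sume_ge0.
rewrite lee_wpmul2l ?lee_fin ?(ltW C0)//.
rewrite big_cons ge0_muleDr ?sume_ge0//.
by rewrite -!addeA leeD2l// addeA leeD2r// -[(2%:E)%E]/((1 + 1)%:E) EFinD ge0_muleDl// mul1e.
Qed.

Variable A : R.
Hypothesis A0 : 0 < A.
Local Notation C4 := (chain_const eps delta M h A).
Local Notation C5 := (chain_height eps delta M h A).
Definition shadow_const := scale_const eps Cd (C4 + 1) (2 * h).
Definition net_Lam := 2 + (C4 + 2 * T * expR (eps * T)) * C5.
Definition net_C := (1 + 2 * CV * shadow_const) * CL * C5 * cmp (2 * T) (h / 2).

Lemma chain_height_gt0 : 0 < C5.
Proof. by rewrite /chain_height; apply: mulr_gt0 (expR_gt0 _) (mulr_gt0 _ A0); exact: mulr_gt0 (expR_gt0 _) (expR_gt0 _). Qed.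

Lemma chain_const_ge0 : 0 <= C4.
Proof.
have c2 := john_const_ge0 delta eps0 GH h0 A0.
rewrite /chain_const; apply: mulr_ge0 (expR_ge0 _).
have t1 : 0 <= 2 * h * expR (eps * (2 * h)).
  by apply: mulr_ge0 (expR_ge0 _); rewrite mulr_ge0// ltW.
have t2 : 0 <= 4 * h * expR (eps * (4 * h)).
  by apply: mulr_ge0 (expR_ge0 _); rewrite mulr_ge0// ltW.
apply: addr_ge0 t1; apply: (addr_ge0 _ c2); apply: mulr_ge0 t2; apply: mulr_ge0 (expR_ge0 _) _.
by rewrite addr_ge0.
Qed.

Lemma net_C_gt0 : 0 < net_C.
Proof.
have g0 s t : 0 < cmp s t by exact: lt_le_trans ltr01 (cmp_const_ge1 _ _ _ _).
have g1 : 0 < shadow_const by exact: dbl_const_gt0.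
rewrite /net_C; apply: mulr_gt0 (g0 _ _); apply: mulr_gt0 chain_height_gt0; apply: mulr_gt0 (CL0).
by have := mulr_gt0 (mulr_gt0 (ltr0n R 2) (g0 (5 * h) (2 * h))) g1; lra.
Qed.

(** |f(x) - c0| is at most the oscillation on the cell of x plus the sum of the
means [net_mean_osc m] over the chain of this cell. After integration over x and
exchange with the sum, the mean of the net point q m is multiplied by the
measure of its shadow, the set of x whose chain visits q m. The shadow lies in a
uniformized ball of radius comparable with rho (q m) about q m, so that its
measure is at most a multiple of the mass by which the mean was normalized. *)
Lemma net_poincare x0 r : 0 < r -> (forall x, de x0 x < r -> rho x <= A * r) ->
  exists c0 : R,
  (\int[mb]_(x in (uball eps b x0 r : set (borel X))) `|f x - c0|%:E <=
   (net_C * r)%:E * \int[mb]_(x in (uball eps b x0 (net_Lam * r) : set (borel X))) F x)%E.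
Proof.
move=> r0 Hr; have [n0 Hn] := net_chain eps0 hb hypX GH h0 A0 cov r0 Hr.
set B := uball eps b x0 r; set cl := cell cov.
have mB : measurable (B : set (borel X)) by exact: (uball_borel eps0 b_lip geoX).
have H n : exists l : seq nat, (exists2 x, B x & cl x = n) ->
   [/\ n \in l, uniq l,
     (`|c (q n) - c (q n0)|%:E <= (2 * CV)%:E * \sum_(m <- l) net_mean_osc m)%E &
     forall m, m \in l -> [/\ N m, rho (q m) <= C5 * r &
      forall x', B x' -> cl x' = n -> de (q m) x' <= C4 * rho (q m)]].
  have [ex|nex] := pselect (exists2 x, B x & cl x = n); last by exists [::].
  have [p [pp <- up Hp]] := Hn n ex; exists (n :: p) => _; split => //.
    by rewrite mem_head.
  exact: chain_averages.
have {H}/choice[P HP] := H.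
(* q m is visited by the chain of a point of B *)
pose J m := `[< exists2 x, B x & m \in P (cl x) >].
exists (c (q n0)).
pose K := 2 * CV.
have K0 : 0 <= K by rewrite mulr_ge0// (le_trans ler01).
(* the contribution of the cell of x, and that of the rest of its chain *)
pose u m x : \bar R := (if m == cl x then `|f x - c (q m)|%:E else 0)%E.
pose v m x : \bar R := (if m \in P (cl x) then K%:E * net_mean_osc m else 0)%E.
have u0 m x : (0 <= u m x)%E by rewrite /u; case: ifP.
have v0 m x : (0 <= v m x)%E.
  by rewrite /v; case: ifP => // _; rewrite mule_ge0// lee_fin.
have mu_ m : measurable_fun [set: borel X] (u m : borel X -> \bar R).
  rewrite (_ : u m = (fun x : borel X => `|f x - c (q m)|%:E) \_ (cl @^-1` [set m])).
    apply/(measurable_restrictT _ _).1; first exact: cell_measurable.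
    by apply: measurable_funTS; exact: mfc.
  apply/funext => x; rewrite /u patchE; case: ifPn => [/eqP E|nE]; first by rewrite mem_set.
  by rewrite memNset//= => E; rewrite E eqxx in nE.
have mv_ m : measurable_fun [set: borel X] (v m : borel X -> \bar R).
  rewrite (_ : v m = (fun x : borel X => K%:E * net_mean_osc m)%E \_ (cl @^-1` [set n | m \in P n])).
    apply/(measurable_restrictT _ _).1; first exact: cell_measurable.
    exact: measurable_cst.
  apply/funext => x; rewrite /v patchE; case: ifPn => [E|nE]; first by rewrite mem_set.
  by rewrite memNset//= => E; rewrite E in nE.
have pointwise x : B x -> (`|f x - c (q n0)|%:E <= \sum_(m <oo) (u m x + v m x))%E.
  move=> Bx; have [inP uP chP _] := HP (cl x) (ex_intro2 _ _ x Bx erefl).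
  rewrite nneseriesD//.
  apply: (@le_trans _ _ (`|f x - c (q (cl x))|%:E + `|c (q (cl x)) - c (q n0)|%:E)%E).
    rewrite -EFinD lee_fin (_ : f x - _ = (f x - c (q (cl x))) + (c (q (cl x)) - c (q n0))).
      exact: ler_normD.
    by ring.
  apply: leeD.
    have := @sum_uniq_le_nneseries _ [:: cl x] (fun m => u m x) isT (fun m => u0 m x).
    by rewrite big_seq1 /u eqxx.
  apply: le_trans chP _.
  have := @sum_uniq_le_nneseries _ (P (cl x)) (fun m => v m x) uP (fun m => v0 m x).
  apply: le_trans; rewrite ge0_sume_distrr//.
  rewrite big_seq [leRHS]big_seq; apply: lee_sum => m ml.
  by rewrite /v ml.
have C60 : 0 < shadow_const by exact: dbl_const_gt0.
pose Q := (1 + K * shadow_const) * CL * C5 * r.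
have Q0 : 0 <= Q.
  rewrite /Q; apply: mulr_ge0 (ltW r0); apply: mulr_ge0 (ltW chain_height_gt0).
  by apply: (mulr_ge0 _ (ltW CL0)); rewrite addr_ge0// mulr_ge0// ltW.
have term m : (\int[mb]_(x in (B : set (borel X))) (u m x + v m x) <=
    Q%:E * (if J m then \int[mb]_(x in (ball (q m) T : set (borel X))) F x else 0))%E.
  rewrite /J; case: asboolP => [[x Bx mP]|nJ]; last first.
    rewrite mule0 integral0_eq// => x Bx.
    have [inP _ _ _] := HP (cl x) (ex_intro2 _ _ x Bx erefl).
    rewrite /u /v; case: ifPn => [/eqP E|_].
      by exfalso; apply: nJ; exists x => //; rewrite E.
    case: ifPn => [E|_]; last by rewrite adde0.
    by exfalso; apply: nJ; exists x.
  have [Nm r5 _] : [/\ N m, rho (q m) <= C5 * r & True].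
    by have [_ _ _ /(_ m mP)[]] := HP (cl x) (ex_intro2 _ _ x Bx erefl).
  rewrite ge0_integralD//; last 2 first.
  - by apply: measurable_funTS; exact: mu_.
  - by apply: measurable_funTS; exact: mv_.
  apply: (@le_trans _ _ (net_osc m + (K * shadow_const)%:E * net_osc m)%E).
    apply: leeD.
      apply: le_trans (LPI (q m)).
      rewrite [leRHS]integral_mkcond; apply: (@le_trans _ _ (\int[mb]_(x in (B : set (borel X)))
         ((fun x : borel X => `|f x - c (q m)|%:E) \_ (ball (q m) (8 * h) : set (borel X))) x)%E).
        apply: ge0_le_integral => //.
        - by apply: measurable_funTS; exact: mu_.
        - apply: measurable_funTS; apply/(measurable_restrictT _ _).1; first exact: ball_borel.
          by apply: measurable_funTS; exact: mfc.
        move=> y _; rewrite /u patchE; case: ifPn => [/eqP E|_].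
          rewrite mem_set// ballEmdist/= E metric_sym; have [_ h1] := cellP cov y.
          by apply: lt_trans h1 _; rewrite ltr_pM2r// ltr_nat.
        by case: ifP.
      apply: ge0_subset_integral => //.
      - apply/(measurable_restrictT _ _).1; first exact: ball_borel.
        by apply: measurable_funTS; exact: mfc.
      - by move=> y _; rewrite patchE; case: ifP.
    rewrite (eq_integral (T := borel X) ((cst (K%:E * net_mean_osc m)%E : borel X -> \bar R) \_ (cl @^-1` [set n | m \in P n] : set (borel X)) : borel X -> \bar R)); last first.
      move=> y _; rewrite /v patchE; case: ifPn => [E|nE]; first by rewrite mem_set.
      by rewrite memNset//= => E; rewrite E in nE.
    rewrite -integral_mkcondr integral_cst; last by apply: measurableI => //; exact: cell_measurable.
    have shadow : (mb (B `&` cl @^-1` [set n | m \in P n]) <= shadow_const%:E * (net_mass m)%:E)%E.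
      rewrite -net_massE; apply: le_trans (uball_le_ball eps0 b_lip geoX Cd1 mb_dbl _ _ _); last first.
        by rewrite mulr_gt0.
      apply: le_measure; rewrite ?inE.
      - by apply: measurableI => //; exact: cell_measurable.
      - exact: (uball_borel eps0 b_lip geoX).
      move=> y [By /= my]; rewrite /uball/=.
      have [_ _ _ /(_ m my)[_ _ /(_ y By erefl) h1]] := HP (cl y) (ex_intro2 _ _ y By erefl).
      apply: le_lt_trans h1 _; rewrite ltr_pM2r; last exact: rho_gt0.
      by rewrite ltrDl.
    apply: le_trans (lee_wpmul2l _ shadow) _.
      by rewrite mule_ge0// lee_fin.
    rewrite /net_mean_osc muleACA -EFinM (muleAC (net_mass m)^-1%:E) -EFinM mulVf ?gt_eqF//.
    by rewrite mul1e.
  rewrite -{1}[net_osc m]mul1e -ge0_muleDl ?lee_fin ?(mulr_ge0 K0 (ltW C60))//.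
  rewrite -EFinD /net_osc muleA -EFinM lee_wpmul2r ?integral_ge0// lee_fin /Q.
  rewrite -[leRHS]mulrA -[leRHS]mulrA; apply: ler_wpM2l; last by rewrite ler_pM2l.
  by rewrite addr_ge0// mulr_ge0// ltW.
have IJ : (\sum_(m <oo) (if J m then \int[mb]_(x in (ball (q m) T : set (borel X))) F x else 0) <=
   (cmp (2 * T) (h / 2))%:E * \int[mb]_(x in (uball eps b x0 (net_Lam * r) : set (borel X))) F x)%E.
  set BL := uball eps b x0 (net_Lam * r).
  have mBL : measurable (BL : set (borel X)) by exact: (uball_borel eps0 b_lip geoX).
  pose t m (x : borel X) : \bar R := (F x * (if N m && (mdist (q m) x < T)%R then 1 else 0))%E.
  have tE m : t m = (if N m then F \_ (ball (q m) T : set (borel X)) else cst 0%E).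
    apply/funext => x; rewrite /t; case: (N m) => /=; last by rewrite mule0.
    rewrite patchE.
    case: ifPn => xm; first by rewrite mem_set ?mule1// ballEmdist.
    by rewrite memNset ?mule0//; rewrite ballEmdist/=; exact/negP.
  have t0 m x : (0 <= t m x)%E by rewrite /t mule_ge0//; case: ifP.
  have mt m : measurable_fun [set: borel X] (t m).
    rewrite tE; case: ifP => _; last exact: measurable_cst.
    apply/(measurable_restrictT _ _).1; first exact: ball_borel.
    exact: measurable_funTS.
  apply: (@le_trans _ _ (\sum_(m <oo) \int[mb]_(x in (BL : set (borel X))) t m x)%E).
    apply: lee_nneseries => m _.
      by move=> _; case: ifP => // _; exact: integral_ge0.
    case: ifPn => [/asboolP[x Bx mP]|_]; last exact: integral_ge0.
    have [_ _ _ /(_ m mP)[Nm r5 /(_ x Bx erefl) d4]] := HP (cl x) (ex_intro2 _ _ x Bx erefl).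
    have sub : ball (q m) T `<=` BL.
      move=> y my; have := ball_sub_uball eps0 b_lip geoX T0 my; rewrite /uball/= /BL/=.
      have := unif_dist_triangle eps0 b_lip geoX x x0 y.
      have := unif_dist_triangle eps0 b_lip geoX (q m) x y.
      have := unif_dist_sym eps0 b_lip geoX x (q m).
      have D0 : 0 <= C4 + 2 * T * expR (eps * T).
        apply: addr_ge0 chain_const_ge0 _; apply: mulr_ge0 (expR_ge0 _).
        by rewrite mulr_ge0// ltW.
      have := ler_wpM2l D0 r5; rewrite /net_Lam.
      have E : (C4 + 2 * T * expR (eps * T)) * rho (q m) =
        C4 * rho (q m) + rho (q m) * (2 * T * expR (eps * T)) by ring.
      rewrite E.
      have -> : (2 + (C4 + 2 * T * expR (eps * T)) * C5) * r =
        r + r + (C4 + 2 * T * expR (eps * T)) * (C5 * r) by ring.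
      move: Bx; rewrite /B /uball/=; have := r0; lra.
    rewrite tE Nm -integral_mkcondr (setIidr sub)//.
  rewrite -integral_nneseries//; last first.
    by move=> m; apply: measurable_funTS; exact: mt.
  rewrite -ge0_integralZl_EFin//; last 2 first.
  - exact: measurable_funTS.
  - by rewrite ltW// (lt_le_trans ltr01 (cmp_const_ge1 _ _ _ _)).
  apply: ge0_le_integral => //.
  - by move=> x _; apply: nneseries_ge0.
  - by apply: ge0_emeasurable_sum => // m _; apply: measurable_funTS; exact: mt.
  - by apply: emeasurable_funM => //; exact: measurable_funTS.
  move=> x _; rewrite /t.
  case: (F x) (F0 x) => [s s0||//]; last first.
    move=> _; rewrite gt0_muley ?leey// lte_fin.
    exact: lt_le_trans ltr01 (cmp_const_ge1 _ _ _ _).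
  rewrite nneseriesZl; last by move=> m _; case: ifP.
  rewrite muleC lee_wpmul2r//; exact: bounded_overlap.
apply: (@le_trans _ _ (\int[mb]_(x in (B : set (borel X))) \sum_(m <oo) (u m x + v m x))%E).
  apply: ge0_le_integral => //.
  - by apply: measurable_funTS; exact: mfc.
  - apply: ge0_emeasurable_sum => //.
      by move=> m x _ _; rewrite adde_ge0.
    by move=> m _; apply: measurable_funTS; exact: emeasurable_funD.
rewrite integral_nneseries//; last 2 first.
- by move=> m; apply: measurable_funTS; exact: emeasurable_funD.
- by move=> m x _; rewrite adde_ge0.
apply: (@le_trans _ _ (\sum_(m <oo) (Q%:E * (if J m then \int[mb]_(x in (ball (q m) T : set (borel X))) F x else 0)))%E).
  by apply: lee_nneseries => m _; [move=> _; apply: integral_ge0 => x _; rewrite adde_ge0|exact: term].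
rewrite nneseriesZl; last by move=> m _; case: ifP => // _; exact: integral_ge0.
apply: le_trans (lee_wpmul2l _ IJ) _; first by rewrite lee_fin.
rewrite muleA -EFinM /Q /net_C /K le_eqVlt; apply/orP; left; apply/eqP; congr (_%:E * _)%E.
ring.
Qed.

End NetSums.

(** * The linear Poincare inequality on uniformized balls *)

Section UniformizedLinearPoincare.
Context {R : realType} {X : pmetricType R}.
Variables (mu : {measure set (borel X) -> \bar R}).
Variables (delta eps M beta Cd p RPI CPI lambda : R) (b : X -> R).
Hypotheses (eps0 : 0 < eps) (beta0 : 0 < beta) (p1 : 1 <= p).
Hypotheses (hb : horo_approx b) (hypX : hyperbolic X delta) (properX : proper_space X).
Hypothesis GH : GH_density eps b M.
Hypothesis PI : locally_poincare mu p RPI lambda CPI.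
Local Notation rho := (density eps b).
Local Notation w := (density beta b).
Local Notation de := (unif_dist eps b).
Local Notation b_lip := (horo_lip hb).
Local Notation mb := (weighted mu beta b_lip).
Hypothesis Cd1 : 1 <= Cd.
Hypothesis mb_dbl : forall x r, 0 < r ->
  (mb (uball eps b x (2 * r)) <= Cd%:E * mb (uball eps b x r))%E.
Let geoX : geodesic_space X. Proof. by case: hypX. Qed.
Let R0 : 0 < RPI. Proof. by case: PI. Qed.
Let lam1 : 1 <= lambda. Proof. by case: PI => _ []. Qed.

Lemma weighted_ball_bounds x r (f : X -> \bar R) : 0 < r -> (forall y, 0 <= f y)%E ->
  measurable_fun [set: borel X] (f : borel X -> \bar R) ->
  ((w x * expR (- (beta * r)))%:E * \int[mu]_(y in (ball x r : set (borel X))) f y <=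
    \int[mb]_(y in (ball x r : set (borel X))) f y)%E /\
  (\int[mb]_(y in (ball x r : set (borel X))) f y <=
    (w x * expR (beta * r))%:E * \int[mu]_(y in (ball x r : set (borel X))) f y)%E.
Proof.
move=> r0 f0 mf; have mB := ball_borel x r.
have mfB : measurable_fun (ball x r : set (borel X)) (f : borel X -> \bar R) by exact: measurable_funTS.
have mw : measurable_fun (ball x r : set (borel X)) (fun y : borel X => (w y)%:E).
  by apply/measurable_EFinP; apply: measurable_funTS; exact: (rho_borel beta b_lip).
rewrite ge0_integral_weighted//; split.
  rewrite -ge0_integralZl_EFin//; last first.
    exact: mulr_ge0 (rho_ge0 beta b x) (expR_ge0 _).
  apply: ge0_le_integral => //.
  - by move=> y _; rewrite mule_ge0// lee_fin; exact: mulr_ge0 (rho_ge0 beta b x) (expR_ge0 _).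
  - exact: emeasurable_funM.
  - exact: emeasurable_funM.
  move=> y; rewrite ballEmdist/= => /ltW xy; rewrite muleC lee_wpmul2l// lee_fin.
  exact: (rho_ge_dist beta0 b_lip).
rewrite -ge0_integralZl_EFin//; last first.
  exact: mulr_ge0 (rho_ge0 beta b x) (expR_ge0 _).
apply: ge0_le_integral => //.
- by move=> y _; rewrite mule_ge0// lee_fin rho_ge0.
- exact: emeasurable_funM.
- exact: emeasurable_funM.
move=> y; rewrite ballEmdist/= => /ltW xy; rewrite muleC lee_wpmul2r// lee_fin.
exact: (rho_le_dist beta0 b_lip).
Qed.

Lemma weighted_ball_pos x r : 0 < r -> (0 < mb (ball x r : set (borel X)) < +oo)%E.
Proof.
move=> r0; have [_ [mupos _ _ _]] := PI; have /andP[m0 moo] := mupos x r r0.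
have e1 : (\int[mb]_(y in (ball x r : set (borel X))) cst 1%E y = mb (ball x r : set (borel X)))%E.
  by rewrite integral_cst ?mul1e//; exact: ball_borel.
have e2 : (\int[mu]_(y in (ball x r : set (borel X))) cst 1%E y = mu (ball x r : set (borel X)))%E.
  by rewrite integral_cst ?mul1e//; exact: ball_borel.
have [h1 h2] := @weighted_ball_bounds x r (cst 1%E) r0 (fun _ => lee01) (@measurable_cst _ _ _ _ _ _).
rewrite e1 e2 in h1 h2; apply/andP; split.
  apply: lt_le_trans h1; rewrite mule_gt0// lte_fin.
  exact: mulr_gt0 (rho_gt0 beta b x) (expR_gt0 _).
apply: le_lt_trans h2 _; apply: lte_mul_pinfty => //.
by rewrite lee_fin; exact: mulr_ge0 (rho_ge0 beta b x) (expR_ge0 _).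
Qed.

(** A uniformized ball of radius at most rho x * small_scale about x is contained
in the ball of radius RPI, and on a larger one rho is at most [height_const]
times the radius. *)
Definition small_scale := RPI * expR (- (eps * RPI)).
Definition height_const := expR eps * (small_scale^-1 + 1).
Definition small_Lam := 2 * lambda * expR (eps * RPI) * expR (eps * (lambda * RPI)).
Local Notation hn := (RPI / 8).
Local Notation Tn := (lambda * RPI).
Local Notation CL := (local_const eps beta p RPI CPI lambda).
Definition lin_Lam := Num.max small_Lam (net_Lam eps delta M hn Tn height_const).
Definition lin_C := Num.max (CL * expR (eps * RPI)) (net_C eps delta M Cd hn Tn (CL * RPI) height_const).

Let CL0 : 0 < CL. Proof. exact: (local_const_gt0 eps beta PI). Qed.

Lemma small_Lam_gt0 : 0 < small_Lam.
Proof.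
have l0 : 0 < lambda by exact: lt_le_trans ltr01 lam1.
by rewrite /small_Lam; apply: mulr_gt0 (expR_gt0 _); apply: mulr_gt0 (expR_gt0 _); rewrite mulr_gt0.
Qed.

Lemma lin_Lam_gt0 : 0 < lin_Lam.
Proof. by rewrite lt_max small_Lam_gt0. Qed.

Lemma lin_C_gt0 : 0 < lin_C.
Proof. by rewrite lt_max (mulr_gt0 CL0 (expR_gt0 _)). Qed.

Variables (f : X -> R) (g : X -> \bar R).
Hypotheses (intf : integrable_on_balls mu f) (g0 : forall x, (0 <= g x)%E).
Hypothesis mg : measurable_fun [set: borel X] (g : borel X -> \bar R).
Hypothesis ug : upper_gradient f (fun x => g x * (rho x)%:E)%E.
Local Notation F k := (fun x => k%:E + (k `^ (1 - p))%:E * g x `^ p)%E.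

Lemma lin_measurable k : measurable_fun [set: borel X] (F k : borel X -> \bar R).
Proof.
apply: emeasurable_funD => //; apply: emeasurable_funM => //.
exact: (measurableT_comp (measurable_poweR p)).
Qed.

Lemma lin_ge0 k x : 0 < k -> (0 <= F k x)%E.
Proof.
by move=> k0; rewrite adde_ge0 ?lee_fin ?(ltW k0)// mule_ge0 ?lee_fin ?powR_ge0// poweR_ge0.
Qed.

(** Small balls are handled by the local inequality, large ones by chaining with
a net whose mesh is fixed by the radius of the local inequality. *)
Lemma uball_linear_poincare x0 r k : 0 < r -> 0 < k -> exists c0 : R,
  (\int[mb]_(x in (uball eps b x0 r : set (borel X))) `|f x - c0|%:E <=
   (lin_C * r)%:E * \int[mb]_(x in (uball eps b x0 (lin_Lam * r) : set (borel X))) F k x)%E.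
Proof.
move=> r0 k0; have rx := rho_gt0 eps b x0.
have eR : 0 < expR (eps * RPI) := expR_gt0 _.
have l0 : 0 < lambda by exact: lt_le_trans ltr01 lam1.
have mub x s : measurable (uball eps b x s : set (borel X)) by exact: (uball_borel eps0 b_lip geoX).
have mfc c : measurable_fun [set: borel X] (fun x : borel X => `|f x - c|%:E).
  apply/measurable_EFinP; apply: (measurableT_comp (@normr_measurable _ _)).
  by apply: measurable_funB => //; exact: intf.1.
have widen s C : s <= lin_Lam * r -> 0 <= C -> C <= lin_C * r ->
   (C%:E * \int[mb]_(x in (uball eps b x0 s : set (borel X))) F k x <=
    (lin_C * r)%:E * \int[mb]_(x in (uball eps b x0 (lin_Lam * r) : set (borel X))) F k x)%E.
  move=> sL C0 CC; apply: lee_pmul; rewrite ?lee_fin//.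
    by apply: integral_ge0 => x _; exact: lin_ge0.
  apply: ge0_subset_integral => //.
  - by apply: measurable_funTS; exact: lin_measurable.
  - by move=> x _; exact: lin_ge0.
  - exact: le_uball.
have [rs|rs] := leP r (rho x0 * small_scale).
  pose s := r * expR (eps * RPI) / rho x0.
  have s0 : 0 < s by rewrite divr_gt0// mulr_gt0.
  have sR : s <= RPI.
    rewrite /s ler_pdivrMr// -ler_pdivlMr//; apply: le_trans rs _.
    by rewrite /small_scale expRN mulrA (mulrC RPI).
  (* s rho(x0) is comparable with r, and the ball of radius s about x0 contains
     the uniformized ball *)
  exists (fine (average mu (ball x0 s) (EFin \o f))).
  have sub : uball eps b x0 r `<=` ball x0 s.
    move=> x /= xr; rewrite ballEmdist/= ltNge; apply/negP => sx.
    have := unif_dist_lower eps0 b_lip geoX (ltW s0) sx.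
    rewrite leNgt => /negP; apply; apply: lt_le_trans xr _.
    have -> : r = rho x0 * expR (- (eps * RPI)) * s.
      rewrite /s expRN; field; by rewrite (gt_eqF rx) (gt_eqF eR).
    rewrite ler_pM2r// ler_pM2l// ler_expR lerN2 ler_pM2l//.
  have H := weighted_linear_poincare eps0 beta0 b_lip p1 PI intf g0 mg ug x0 s0 sR k0.
  apply: (@le_trans _ _ (\int[mb]_(x in (ball x0 s : set (borel X)))
      `|f x - fine (average mu (ball x0 s) (EFin \o f))|%:E)%E).
    apply: ge0_subset_integral => //; first exact: ball_borel.
    by apply: measurable_funTS; exact: mfc.
  apply: le_trans H _.
  have ls0 : 0 < lambda * s by rewrite mulr_gt0.
  have sE : rho x0 * s = r * expR (eps * RPI).
    by rewrite /s mulrCA divff ?mulr1// gt_eqF.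
  apply: (@le_trans _ _ ((CL * s * rho x0)%:E *
      \int[mb]_(x in (uball eps b x0 (small_Lam * r) : set (borel X))) F k x)%E).
    apply: lee_wpmul2l; first by rewrite lee_fin ltW// mulr_gt0// mulr_gt0.
    apply: ge0_subset_integral => //.
    - exact: ball_borel.
    - by apply: measurable_funTS; exact: lin_measurable.
    - by move=> x _; exact: lin_ge0.
    apply: subset_trans (ball_sub_uball eps0 b_lip geoX ls0) _; apply: le_uball.
    have -> : rho x0 * (2 * (lambda * s) * expR (eps * (lambda * s))) =
      2 * lambda * (rho x0 * s) * expR (eps * (lambda * s)) by ring.
    rewrite sE; have -> : small_Lam * r =
      2 * lambda * (r * expR (eps * RPI)) * expR (eps * (lambda * RPI)).
      by rewrite /small_Lam; ring.
    apply: ler_wpM2l; first by rewrite ltW// !mulr_gt0.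
    by rewrite ler_expR ler_pM2l// ler_pM2l.
  apply: widen.
  - by rewrite ler_pM2r// le_max lexx.
  - by rewrite ltW// mulr_gt0// mulr_gt0.
  - rewrite -mulrA (mulrC s) sE (mulrC r) mulrA ler_pM2r// le_max lexx//.
have a0 : 0 < small_scale by exact: mulr_gt0 R0 (expR_gt0 _).
have Hr x : de x0 x < r -> rho x <= height_const * r.
  move=> xr; have h1 : de x x0 <= r / rho x0 * rho x0.
    by rewrite divfK ?gt_eqF// (unif_dist_sym eps0 b_lip geoX) ltW.
  have := rho_le_unif eps0 hb hypX (divr_ge0 (ltW r0) (ltW rx)) h1.
  move=> /le_trans; apply; rewrite /height_const -!mulrA ler_pM2l ?expR_gt0//.
  rewrite mulrDl mul1r divfK ?gt_eqF// mulrDl mul1r lerD2r.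
  by rewrite mulrC ler_pdivlMr// ltW.
have h0 : 0 < hn by rewrite divr_gt0.
have A0 : 0 < height_const.
  by apply: mulr_gt0 (expR_gt0 _) _; rewrite addr_gt0// invr_gt0.
have hT : hn <= Tn.
  by have := ler_wpM2r (ltW R0) lam1; rewrite mul1r; have := R0; lra.
have [q [N [sep cov]]] := separated_net properX h0.
pose c y := fine (average mu (ball y (8 * hn)) (EFin \o f)).
have h8 : 8 * hn = RPI by field.
have LPI y : (\int[mb]_(x in (ball y (8 * hn) : set (borel X))) `|f x - c y|%:E <=
   (CL * RPI * rho y)%:E * \int[mb]_(x in (ball y Tn : set (borel X))) F k x)%E.
  rewrite /c h8.
  exact: (weighted_linear_poincare eps0 beta0 b_lip p1 PI intf g0 mg ug y R0 (lexx _) k0).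
have [c0 H] := net_poincare eps0 hb hypX GH Cd1 mb_dbl weighted_ball_pos h0 hT sep cov
  intf.1 (lin_measurable k) (fun x => lin_ge0 x k0) (mulr_gt0 CL0 R0) LPI A0 r0 Hr.
exists c0; apply: le_trans H _; apply: widen.
- by rewrite ler_pM2r// le_max lexx orbT.
- rewrite mulr_ge0 ?(ltW r0)//; apply: ltW.
  exact: (net_C_gt0 eps delta M Cd1 hn Tn (mulr_gt0 CL0 R0) A0).
- by rewrite ler_pM2r// le_max lexx orbT.
Qed.

End UniformizedLinearPoincare.

(** * From the linear to the Poincare inequality *)

Section MeanOscillation.
Local Open Scope ereal_scope.
Context {R : realType} {Z : pmetricType R} (nu : {measure set (borel Z) -> \bar R}).

(** Replacing a constant c0 by the mean at most doubles the oscillation. *)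
Lemma mean_oscillation_le (B : set Z) (u : Z -> R) (c0 : R) :
  measurable (B : set (borel Z)) -> 0 < nu B < +oo ->
  nu.-integrable (B : set (borel Z)) (EFin \o u) ->
  average nu B (fun y => `|u y - fine (average nu B (EFin \o u))|%:E) <=
  (2 * (fine (nu B))^-1)%:E * \int[nu]_(x in (B : set (borel Z))) `|u x - c0|%:E.
Proof.
move=> mB /andP[n0 noo] iu.
have nE : nu B = (fine (nu B))%:E by rewrite fineK// ge0_fin_numE// ltW.
set n := fine (nu B) in nE *; rewrite nE lte_fin in n0.
have mu_ : measurable_fun (B : set (borel Z)) (u : borel Z -> R).
  by apply/measurable_EFinP; exact: measurable_int iu.
have mabs c : measurable_fun (B : set (borel Z)) (fun x : borel Z => `|u x - c|%:E).
  apply/measurable_EFinP; apply: (measurableT_comp (@normr_measurable _ _)).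
  by apply: measurable_funB.
have fin : \int[nu]_(x in (B : set (borel Z))) (EFin \o u) x \is a fin_num.
  by apply: integrable_fin_num.
have uBE : fine (average nu B (EFin \o u)) =
    (n^-1 * fine (\int[nu]_(x in (B : set (borel Z))) (EFin \o u) x))%R.
  by rewrite /average -/n -{1}(fineK fin).
set uB := fine _ in uBE *.
set I := \int[nu]_(x in _) `|u x - c0|%:E.
have ic c : nu.-integrable (B : set (borel Z)) (cst c%:E).
  apply/integrableP; split => //.
  rewrite (_ : (fun x : borel Z => `|cst c%:E x|) = cst `|c|%:E)//.
  by rewrite integral_cst// nE -EFinM ltry.
have key : (`|c0 - uB| * n)%:E <= I.
  have -> : (`|c0 - uB| * n)%:E = `| \int[nu]_(x in (B : set (borel Z))) ((u x)%:E - (cst c0 x)%:E) |.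
    rewrite integralB_EFin//; last exact: ic.
    rewrite (_ : \int[nu]_(x in _) (cst c0 x)%:E = (c0 * n)%:E); last first.
      by rewrite EFinM -nE -integral_cst.
    rewrite -[X in `|X - _|](fineK fin) -EFinB abse_EFin.
    congr EFin; transitivity (`|c0 - uB| * `|n|)%R; first by rewrite (gtr0_norm n0).
    rewrite -normrM -normrN uBE; congr (`| _ |)%R.
    by field; rewrite gt_eqF.
  apply: le_trans (le_abse_integral _ _ _) _ => //.
  by apply/measurable_EFinP; exact: measurable_funB.
rewrite /average -/n.
have H : \int[nu]_(x in (B : set (borel Z))) `|u x - uB|%:E <= I + I.
  apply: (@le_trans _ _ (\int[nu]_(x in (B : set (borel Z))) (`|u x - c0|%:E + cst `|c0 - uB|%:E x))).
    apply: ge0_le_integral => //.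
    - exact: emeasurable_funD.
    - move=> x _; rewrite /= -EFinD lee_fin (_ : u x - uB = (u x - c0) + (c0 - uB))%R; last by ring.
      exact: ler_normD.
  rewrite ge0_integralD//; last by move=> x _; rewrite /= lee_fin.
  by rewrite leeD2l// integral_cst// nE -EFinM.
apply: le_trans (lee_wpmul2l _ H) _; first by rewrite lee_fin invr_ge0 ltW.
have I0 : 0 <= I by exact: integral_ge0.
have -> : I + I = 2%:E * I.
  by rewrite -[2%:E]/((1 + 1)%R%:E) EFinD ge0_muleDl// mul1e.
by rewrite muleA -EFinM (mulrC 2%R).
Qed.

Lemma ge0_integral_affine (B : set Z) (g : Z -> \bar R) (k c : R) :
  measurable (B : set (borel Z)) -> 0 < nu B < +oo ->
  measurable_fun (B : set (borel Z)) (g : borel Z -> \bar R) ->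
  (forall x, 0 <= g x) -> (0 <= k)%R -> (0 <= c)%R ->
  \int[nu]_(x in (B : set (borel Z))) (k%:E + c%:E * g x) =
  (fine (nu B))%:E * (k%:E + c%:E * average nu B g).
Proof.
move=> mB /andP[n0 noo] mg g0 k0 c0.
have nE : nu B = (fine (nu B))%:E by rewrite fineK// ge0_fin_numE// ltW.
set n := fine (nu B) in nE *; rewrite nE lte_fin in n0.
have I0 : 0 <= \int[nu]_(x in (B : set (borel Z))) g x by exact: integral_ge0.
have -> : \int[nu]_(x in (B : set (borel Z))) (k%:E + c%:E * g x) =
    (k * n)%:E + c%:E * \int[nu]_(x in (B : set (borel Z))) g x.
  have cg0 x : B x -> 0 <= c%:E * g x by move=> _; rewrite mule_ge0// lee_fin.
  rewrite ge0_integralD//; last by apply: emeasurable_funM.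
  by rewrite ge0_integralZl_EFin// EFinM -nE -integral_cst.
rewrite /average -/n; move: (integral _ _ _) I0 => I I0.
have nI0 : 0 <= c%:E * (n^-1%:E * I) by rewrite !mule_ge0// lee_fin// invr_ge0 ltW.
rewrite ge0_muleDr ?lee_fin// mulrC EFinM; congr (_ + _).
by rewrite [RHS]muleCA (muleA n%:E (n^-1)%:E I) -EFinM divff ?gt_eqF// mul1e.
Qed.

End MeanOscillation.

(** Z is the uniformization of X or a completion of it, with the image of the
weighted measure under h. *)
Section Transfer.
Context {R : realType} {X Z : pmetricType R}.
Variables (mu : {measure set (borel X) -> \bar R}).
Variables (delta eps M beta Cd p RPI CPI lambda : R) (b : X -> R) (h : X -> Z).
Hypotheses (eps0 : 0 < eps) (beta0 : 0 < beta) (p1 : 1 <= p).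
Hypotheses (hb : horo_approx b) (hypX : hyperbolic X delta) (properX : proper_space X).
Hypothesis GH : GH_density eps b M.
Hypothesis PI : locally_poincare mu p RPI lambda CPI.
Hypothesis h_iso : forall x y, mdist (h x) (h y) = unif_dist eps b x y.
Hypothesis h_dense : dense (range h).
Hypothesis two_points : exists x y : X, x != y.
Local Notation rho := (density eps b).
Local Notation w := (density beta b).
Local Notation de := (unif_dist eps b).
Local Notation b_lip := (horo_lip hb).
Local Notation mb := (weighted mu beta b_lip).
Let geoX : geodesic_space X. Proof. by case: hypX. Qed.

Let mh : measurable_fun setT (h : borel X -> borel Z) := embed_borel eps0 b_lip geoX h_iso.

Let nu : {measure set (borel Z) -> \bar R} :=
  measure_function_pushforward__canonical__measure_function_Measure mb mh.

Hypothesis dbl : doubling (fun A : set Z => weighted_measure mu beta b (h @^-1` A)) Cd.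

Let Cd1 : 1 <= Cd. Proof. by case: dbl. Qed.

Let preimage_ball x r : h @^-1` (ball (h x) r) = uball eps b x r.
Proof. by apply/seteqP; split => y; rewrite /= ballEmdist/= h_iso. Qed.

Let nu_ball x r : nu (ball (h x) r) = mb (uball eps b x r).
Proof. by rewrite -preimage_ball. Qed.

Let mb_dbl x r : 0 < r -> (mb (uball eps b x (2 * r)) <= Cd%:E * mb (uball eps b x r))%E.
Proof. by move=> r0; rewrite -!nu_ball; apply: dbl.2 => //; rewrite leey. Qed.

Lemma dense_point (z : Z) (e : R) : 0 < e -> exists x, mdist z (h x) < e.
Proof.
move=> e0; have [|y [ze [x _ hx]]] := h_dense (O := ball z e) _ (mball_open z e).
  by exists z; exact: ballxx.
by exists x; move: ze; rewrite -hx ballEmdist.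
Qed.

Let nu_scale (z : Z) (r K : R) : 0 < r -> (nu (ball z (K * r)) <= (dbl_const Cd K)%:E * nu (ball z r))%E.
Proof.
apply: (doubling_scale Cd1 (V := fun r => nu (ball z r))) => [s t st|s s0].
  by apply: le_measure; rewrite ?inE; [exact: ball_borel..|exact: le_ball].
by apply: dbl.2 => //; rewrite leey.
Qed.

Lemma uball_fin (x : X) (r : R) : 0 < r -> (mb (uball eps b x r) < +oo)%E.
Proof.
move=> r0; have rx := rho_gt0 eps b x.
have := uball_le_ball eps0 b_lip geoX Cd1 mb_dbl x (r / rho x) ltr01.
rewrite divfK ?gt_eqF// => /le_lt_trans; apply.
have /andP[_ fin] := weighted_ball_pos beta0 hb PI x ltr01.
by apply: lte_mul_pinfty => //; rewrite lee_fin ltW// dbl_const_gt0.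
Qed.

(** A ball of Z contains a ball and is contained in one about a point of h(X). *)
Lemma nu_pos (z : Z) (r : R) : 0 < r -> (0 < nu (ball z r) < +oo)%E.
Proof.
move=> r0; have r20 : 0 < r / 2 by rewrite divr_gt0.
have [x zx] := dense_point z r20; apply/andP; split.
  have rx := rho_gt0 eps b x.
  apply: (@lt_le_trans _ _ (mb (uball eps b x (r / 2)))); last first.
    rewrite -nu_ball; apply: le_measure; rewrite ?inE; [exact: ball_borel..|].
    move=> y; rewrite !ballEmdist/=; have := metric_triangle z (h x) y; lra.
  pose s := Num.min 1 (r / 2 / (rho x * (2 * expR eps))).
  have D0 : 0 < rho x * (2 * expR eps) by rewrite mulr_gt0// mulr_gt0// expR_gt0.
  have s0 : 0 < s by rewrite lt_min ltr01 divr_gt0.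
  have /andP[pos _] := weighted_ball_pos beta0 hb PI x s0.
  apply: lt_le_trans pos _; apply: le_measure; rewrite ?inE.
  - exact: ball_borel.
  - exact: (uball_borel eps0 b_lip geoX).
  apply: subset_trans (ball_sub_uball eps0 b_lip geoX s0) _; apply: le_uball.
  have s1 : s <= 1 by rewrite ge_min lexx.
  have s2 : s * (rho x * (2 * expR eps)) <= r / 2.
    by rewrite -ler_pdivlMr// ge_min lexx orbT.
  apply: le_trans s2.
  have -> : rho x * (2 * s * expR (eps * s)) = rho x * (2 * s) * expR (eps * s) by ring.
  have -> : s * (rho x * (2 * expR eps)) = rho x * (2 * s) * expR eps by ring.
  rewrite ler_pM2l ?mulr_gt0//.
  by rewrite ler_expR -{2}[eps]mulr1 ler_pM2l.
apply: (@le_lt_trans _ _ (nu (ball (h x) (2 * r)))).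
  apply: le_measure; rewrite ?inE; [exact: ball_borel..|].
  move=> y; rewrite !ballEmdist/=; have := metric_triangle (h x) z y.
  have := metric_sym z (h x); lra.
by rewrite nu_ball uball_fin// mulr_gt0.
Qed.

Lemma ge0_integral_nu (A : set Z) (f : Z -> \bar R) : measurable (A : set (borel Z)) ->
  measurable_fun [set: borel Z] (f : borel Z -> \bar R) -> (forall z, 0 <= f z)%E ->
  (\int[nu]_(z in (A : set (borel Z))) f z =
   \int[mb]_(x in (h @^-1` A : set (borel X))) f (h x))%E.
Proof.
move=> mA mf f0; rewrite (@ge0_integral_pushforward _ _ _ _ _ _ mh mb)//.
exact: measurable_funTS.
Qed.

(** On a ball of X the weight is bounded from below, and the ball is contained in
a ball of the uniformization. *)
Lemma integrable_transfer (u : Z -> R) : integrable_on_balls nu u -> integrable_on_balls mu (u \o h).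
Proof.
move=> [mu_ iu]; split; first exact: (measurableT_comp mu_ mh).
move=> x r r0.
have mB := ball_borel x r.
have mau : measurable_fun [set: borel Z] (fun z : borel Z => `|u z|%:E).
  by apply/measurable_EFinP; apply: (measurableT_comp (@normr_measurable _ _)).
have mauh : measurable_fun [set: borel X] (fun y : borel X => `|u (h y)|%:E).
  exact: (measurable_comp (F := setT) (f := (fun z : borel Z => `|u z|%:E)) _ _ mau mh).
apply/integrableP; split.
  by apply/measurable_EFinP; apply: measurable_funTS; exact: (measurableT_comp mu_ mh).
have [lo _] := weighted_ball_bounds mu beta0 hb x r0 (f := fun y => `|u (h y)|%:E) (fun=> ltac:(by rewrite lee_fin)) mauh.
pose s := rho x * (2 * r * expR (eps * r)).
have s0 : 0 < s.
  by apply: mulr_gt0 (rho_gt0 eps b x) _; apply: mulr_gt0 (expR_gt0 _); rewrite mulr_gt0.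
have /integrableP[_ fin] := iu (h x) s s0.
have k0 : 0 < w x * expR (- (beta * r)) := mulr_gt0 (rho_gt0 beta b x) (expR_gt0 _).
have {lo} := le_lt_trans lo (_ : (_ < +oo)%E).
have H : (\int[mb]_(y in (ball x r : set (borel X))) `|u (h y)|%:E < +oo)%E.
  apply: le_lt_trans fin.
  rewrite (ge0_integral_nu (f := fun z => `|u z|%:E))//; last exact: ball_borel.
  apply: ge0_subset_integral => //.
  - by rewrite preimage_ball; exact: (uball_borel eps0 b_lip geoX).
  - exact: measurable_funTS.
  - by rewrite preimage_ball; exact: (ball_sub_uball eps0 b_lip geoX r0).
move=> /(_ H); have : (0 <= \int[mu]_(y in (ball x r : set (borel X))) `|u (h y)|%:E)%E.
  exact: integral_ge0.
rewrite /=; case: (\int[mu]_(y in _) _)%E => [t _ _||]//; first by rewrite ltry.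
by rewrite gt0_muley// lte_fin.
Qed.

(** The Poincare inequality has diam B in place of the radius, which may be much
smaller if B is the whole space. This is the only case: if r > 4 diam B and some
point were at distance at least r / 2 from z, the distance from z would take the
value 3r / 8 on a geodesic of X between two points close to z and to this point,
against the bound on the diameter. When B is the whole space, the radius can be
lowered to 4 diam B. *)
Lemma small_radius (z : Z) (r : R) : 0 < r -> exists r1,
  [/\ 0 < r1, r1 <= 4 * diam (ball z r), ball z r1 = ball z r &
    forall L, 1 <= L -> ball z (L * r1) = ball z (L * r)].
Proof.
move=> r0; set D := diam _.
have [rD|Dr] := leP r (4 * D); first by exists r; split.
have supB : has_ubound [set mdist x y | x in ball z r & y in ball z r].
  exists (2 * r) => _ [x + [y + <-]]; rewrite !ballEmdist/= => zx zy.
  by have := metric_triangle x z y; have := metric_sym x z; lra.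
have leD x y : ball z r x -> ball z r y -> mdist x y <= D.
  by move=> xB yB; apply: (ub_le_sup supB); exists x => //; exists y.
have near y : mdist z y < r / 2.
  rewrite ltNge; apply/negP => zy.
  have e0 : 0 < r / 8 by rewrite divr_gt0.
  have [x zx] := dense_point z e0; have [x' yx'] := dense_point y e0.
  have [a [a' [c /geodesic_path[dxx' lg g0 gL]]]] := geoX x x'.
  set L := a' - a in lg g0 gL dxx'; set gam := (fun s => c (a + clamp L s)) in lg.
  have L0 : 0 <= L by rewrite -dxx' mdist_ge0.
  pose phi s := mdist z (h (gam s)).
  have cphi : continuous phi.
    move=> s; apply/cvgrPdist_lt => e e0'.
    have ch : continuous (h \o gam).
      move=> t; apply: (@continuous_comp R X Z gam h t).
        by apply: (@lipschitz_continuous_path _ _ _ 1) => ? ?; rewrite mul1r.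
      exact: (embed_continuous eps0 b_lip geoX h_iso).
    have /metricType_numDomainType.cvgrPdist_lt/(_ e e0') := ch s.
    apply: filterS => t; apply: le_lt_trans; rewrite /phi /= ler_norml.
    have := metric_triangle z (h (gam s)) (h (gam t)).
    have := metric_triangle z (h (gam t)) (h (gam s)).
    have := metric_sym (h (gam s)) (h (gam t)).
    by move=> ? ? ?; apply/andP; split; lra.
  have phi0 : phi 0 < r / 8 by rewrite /phi /gam g0.
  have phiL : 3 * r / 8 <= phi L.
    rewrite /phi /gam gL; have := metric_triangle z (h x') y.
    have := metric_sym y (h x'); lra.
  have [|t _ tE] := @IVT R phi 0 L (3 * r / 8) L0 (continuous_subspaceT cphi).
    by rewrite ge_min le_max phiL orbT andbT; apply/orP; left; lra.
  have zB : ball z r z by exact: ballxx.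
  have tB : ball z r (h (gam t)) by rewrite ballEmdist/= -/(phi t) tE; lra.
  have := leD _ _ zB tB; rewrite -/(phi t) tE; lra.
have all y : ball z r y by rewrite ballEmdist/=; have := near y; lra.
have D0 : 0 < D.
  have [x [y xy]] := two_points.
  apply: lt_le_trans (leD (h x) (h y) (all _) (all _)).
  rewrite mdist_gt0; apply: contra xy => /eqP hxy; apply/eqP.
  have [_ pos _ _] := unif_dist_is_metric eps0 b_lip geoX.
  by apply: pos; rewrite -h_iso hxy mdistxx.
have full s : D < s -> ball z s = setT.
  move=> Ds; apply/seteqP; split => // y _; rewrite ballEmdist/=.
  by apply: le_lt_trans Ds; apply: leD => //; exact: all.
exists (4 * D); split => //.
- by rewrite mulr_gt0.
- by rewrite full; [apply/seteqP; split => // y _; exact: all|lra].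
- move=> L L1; rewrite full; last first.
    by apply: (@lt_le_trans _ _ (1 * (4 * D))); [lra|rewrite ler_pM2r// mulr_gt0].
  rewrite full//; apply: lt_le_trans (_ : 1 * r <= _); first by rewrite mul1r; lra.
  by rewrite ler_pM2r.
Qed.

Local Notation Lam := (lin_Lam delta eps M RPI lambda).
Local Notation C := (lin_C delta eps M beta Cd p RPI CPI lambda).
Definition global_Lam := 2 * Lam + 1.
Definition global_C := 4 * (2 * (2 * C * (2 * dbl_const Cd global_Lam))).

(** The ball about z is contained in one of twice the radius about a point of
h(X), where [uball_linear_poincare] applies; its constants do not depend on k,
which is then optimized for the mean of g^p. *)
Lemma global_poincare :
  poincare (fun A : set Z => weighted_measure mu beta b (h @^-1` A)) p global_Lam global_C.
Proof.
change (poincare nu p global_Lam global_C).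
have Lam0 : 0 < Lam by exact: (lin_Lam_gt0 delta eps M PI).
have C0 : 0 < C by exact: (lin_C_gt0 delta eps M beta Cd PI).
have GL1 : 1 <= global_Lam by rewrite /global_Lam lerDr mulr_ge0// ltW.
have dc0 : 0 < dbl_const Cd global_Lam by exact: dbl_const_gt0.
split; [exact: nu_pos|exact: GL1|by rewrite /global_C !mulr_gt0|].
move=> z r u g r0 _ iu ug /=.
set B := ball z r; set uB := fine (average nu B (EFin \o u)).
have [r1 [r10 r1D Br1 Lr1]] := small_radius z r0.
have [g0 mg _] := ug.
have mgh : measurable_fun [set: borel X] (g \o h : borel X -> \bar R).
  exact: (measurable_comp (F := setT) (f := (g : borel Z -> \bar R)) _ _ mg mh).
have ugX := embed_upper_gradient eps0 b_lip geoX h_iso ug.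
have iuX := integrable_transfer iu.
pose BL := ball z (global_Lam * r1).
have mBL : measurable (BL : set (borel Z)) by exact: ball_borel.
have BLE : ball z (global_Lam * r) = BL by rewrite /BL Lr1.
rewrite BLE.
have Lr10 : 0 < global_Lam * r1 by rewrite mulr_gt0// (lt_le_trans ltr01).
have /andP[n0 noo] := nu_pos z r10; have /andP[N0 Noo] := nu_pos z Lr10.
have nE : nu B = (fine (nu B))%:E by rewrite /B -Br1 fineK// ge0_fin_numE// ltW.
have NE : nu BL = (fine (nu BL))%:E by rewrite fineK// ge0_fin_numE// ltW.
set n := fine (nu B) in nE; set N := fine (nu BL) in NE.
rewrite Br1 -/B nE lte_fin in n0; rewrite -/BL NE lte_fin in N0.
have Nn : N <= dbl_const Cd global_Lam * n.
  by rewrite -lee_fin EFinM -NE -nE /B -Br1; exact: nu_scale.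
pose S := average nu BL (fun y => g y `^ p)%E.
have mgp : measurable_fun [set: borel Z] (fun y : borel Z => g y `^ p)%E.
  exact: (measurableT_comp (measurable_poweR p)).
have S0 : (0 <= S)%E.
  rewrite /S /average mule_ge0 ?lee_fin ?invr_ge0 ?fine_ge0//.
  by apply: integral_ge0 => y _; exact: poweR_ge0.
pose K := 2 * C * (2 * dbl_const Cd global_Lam) * r1.
have K0 : 0 < K by rewrite /K !mulr_gt0.
have lin k : 0 < k -> (average nu B (fun y => `|u y - uB|%:E) <=
    K%:E * (k%:E + (k `^ (1 - p))%:E * S))%E.
  move=> k0; have [x zx] := dense_point z r10.
  have r20 : 0 < 2 * r1 by rewrite mulr_gt0.
  have [c0 H] := uball_linear_poincare eps0 beta0 p1 hypX properX GH PI Cd1 mb_dbl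
    iuX (fun y => g0 (h y)) mgh ugX x r20 k0.
  pose F y := (k%:E + (k `^ (1 - p))%:E * g y `^ p)%E.
  have F0 y : (0 <= F y)%E.
    by rewrite /F adde_ge0 ?lee_fin ?(ltW k0)// mule_ge0 ?lee_fin ?powR_ge0// poweR_ge0.
  have mF : measurable_fun [set: borel Z] (F : borel Z -> \bar R).
    by apply: emeasurable_funD => //; apply: emeasurable_funM.
  have mabs : measurable_fun [set: borel Z] (fun y : borel Z => `|u y - c0|%:E).
    apply/measurable_EFinP; apply: (measurableT_comp (@normr_measurable _ _)).
    by apply: measurable_funB => //; exact: iu.1.
  have Hosc : (\int[nu]_(y in (B : set (borel Z))) `|u y - c0|%:E <=
      (C * (2 * r1))%:E * \int[nu]_(y in (BL : set (borel Z))) F y)%E.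
    apply: (@le_trans _ _ (\int[nu]_(y in (ball (h x) (2 * r1) : set (borel Z))) `|u y - c0|%:E)%E).
      apply: ge0_subset_integral => //; [exact: ball_borel|exact: ball_borel| |].
        exact: measurable_funTS.
      rewrite /B -Br1 => y; rewrite !ballEmdist/=; have := metric_triangle (h x) z y.
      have := metric_sym z (h x); lra.
    rewrite ge0_integral_nu//; last exact: ball_borel.
    rewrite preimage_ball; apply: le_trans H _.
    apply: lee_wpmul2l; first by rewrite lee_fin ltW// mulr_gt0.
    rewrite ge0_integral_nu//; apply: ge0_subset_integral => //.
    - exact: (uball_borel eps0 b_lip geoX).
    - by rewrite -[X in measurable X]setTI; exact: mh.
    - apply: measurable_funTS.
      exact: (measurable_comp (F := setT) (f := (F : borel Z -> \bar R)) _ _ mF mh).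
    - by move=> y _; exact: (F0 (h y)).
    move=> y; rewrite /uball /= -h_iso => xy; rewrite /BL ballEmdist/=; move: xy.
    have -> : global_Lam * r1 = Lam * (2 * r1) + r1 by rewrite /global_Lam; ring.
    have := metric_triangle z (h x) (h y); lra.
  have nuB : (0 < nu B < +oo)%E by rewrite nE lte_fin n0 ltry.
  have iuB : nu.-integrable (B : set (borel Z)) (EFin \o u) by apply: iu.2.
  have mB : measurable (B : set (borel Z)) by exact: ball_borel.
  apply: le_trans (mean_oscillation_le c0 mB nuB iuB) _.
  have n20 : 0 <= 2 * n^-1 by rewrite mulr_ge0// invr_ge0 ltW.
  rewrite -/n; apply: le_trans (lee_wpmul2l _ Hosc) _; first by rewrite lee_fin.
  have intF : (\int[nu]_(y in (BL : set (borel Z))) F y =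
      N%:E * (k%:E + (k `^ (1 - p))%:E * S))%E.
    apply: ge0_integral_affine => //.
    - by rewrite NE lte_fin N0 ltry.
    - exact: measurable_funTS.
    - by move=> y; exact: poweR_ge0.
    - exact: ltW.
    - exact: powR_ge0.
  have T0 : (0 <= k%:E + (k `^ (1 - p))%:E * S)%E.
    by rewrite adde_ge0 ?lee_fin ?(ltW k0)// mule_ge0// lee_fin powR_ge0.
  rewrite intF; move: (k%:E + _)%E T0 => T T0.
  rewrite !muleA -!EFinM; apply: lee_wpmul2r => //.
  rewrite lee_fin /K.
  have -> : 2 * n^-1 * (C * (2 * r1)) * N = 2 * C * (2 * (N / n)) * r1 by ring.
  rewrite ler_pM2r// ler_pM2l ?mulr_gt0// ler_pM2l//.
  by rewrite ler_pdivrMr.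
apply: le_trans (poweR_optimize p1 K0 S0 lin) _.
rewrite lee_wpmul2r ?poweR_ge0// -EFinM lee_fin /K /global_C.
have D4 := r1D; rewrite -/B in D4.
have E0 : 0 < 2 * (2 * C * (2 * dbl_const Cd global_Lam)) by rewrite !mulr_gt0.
have := ler_wpM2l (ltW E0) D4; lra.
Qed.

End Transfer.

(** Rays and lines are isometric on [0, 1]. *)
Lemma starlike_two_points {R : realType} {X : pmetricType R} (K : R) (w : X + set (R -> X)) :
  roughly_starlike K w -> exists x y : X, x != y.
Proof.
move=> [_ star]; suff [c c01] : exists c : R -> X, mdist (c 0) (c 1) = `|0 - 1|.
  exists (c 0), (c 1); apply/eqP => cE.
  by move: c01; rewrite cE mdistxx sub0r normrN1 => /esym/eqP; rewrite oner_eq0.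
case: w star => [z /(_ z)[c [ray _ _]]|xi [_ /(_ point)[c [line _ _]]]]; exists c.
  by apply: ray; rewrite /= in_itv/= ?lexx ?ler01.
exact: line.
Qed.

Unset Implicit Arguments.
Set Strict Implicit.

Theorem theorem1p3 (R : realType)
    (delta K eps M beta Cmubeta p RPI CPI lambda RD Cmu : R) :
  0 < eps -> 0 < beta -> 1 <= p ->
  exists lambda' CPI' : R,
  forall (X : pmetricType R) (mu : {measure set (borel X) -> \bar R})
    (b : X -> R) (omega : X + set (R -> X))
    (Xbar : completePMetricType R) (i : uniformized eps b -> Xbar),
  proper_space X ->
  hyperbolic X delta ->
  is_Bhat b omega ->
  roughly_starlike K omega ->
  GH_density eps b M ->
  locally_doubling mu RD Cmu ->
  locally_poincare mu p RPI lambda CPI ->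
  is_completion i ->
  doubling (weighted_measure_ext mu beta i) Cmubeta ->
  poincare (Z := uniformized eps b) (weighted_measure mu beta b)
    p lambda' CPI' /\
  poincare (weighted_measure_ext mu beta i) p lambda' CPI'.
Proof.
move=> eps0 beta0 p1.
exists (global_Lam delta eps M RPI lambda), (global_C delta eps M beta Cmubeta p RPI CPI lambda).
move=> X mu b omega Xbar i properX hypX bw star GH _ PI [i_iso i_dense] dbl.
have hb := Bhat_horo_approx bw.
have two_points := starlike_two_points star.
have geoX : geodesic_space X by case: hypX.
have metU := unif_dist_is_metric eps0 (horo_lip hb) geoX.
have U_iso x y : mdist (x : uniformized eps b) y = unif_dist eps b x y.
  exact: mdist_metrized.
have X_iso x y : mdist (i x) (i y) = unif_dist eps b x y by rewrite i_iso.
split; last first.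
  exact: (global_poincare eps0 beta0 p1 hb hypX properX GH PI X_iso i_dense two_points dbl).
have dense_id : dense (range (id : X -> uniformized eps b)).
  by move=> O [x Ox] _; exists x; split => //; exists x.
have dblU : doubling (Z := uniformized eps b) (weighted_measure mu beta b) Cmubeta.
  split; first by case: dbl.
  move=> x r r0 _; have := dbl.2 (i x) r r0 (leey _).
  have iball s : i @^-1` (ball (i x) s) = ball x s.
    by apply/seteqP; split => y; rewrite /= !ballEmdist/= i_iso.
  by rewrite /weighted_measure_ext !iball.
exact: (global_poincare (X := X) (Z := uniformized eps b) (h := id)
  eps0 beta0 p1 hb hypX properX GH PI U_iso dense_id two_points dblU).
Qed.
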